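(* Let $n\ge1$ and $r>0$. The orthogonal ($G$-invariant) contact metric structures $(\xi,\mathbf g)$ on $T_r\mathbb{CP}^n=G/H$ of each type, with $\mathbf g=\mathbf g^{a_0,a_\varepsilon,b_\varepsilon,a_{\varepsilon/2},b_{\varepsilon/2}}$, are exactly the following, where $\kappa,q_\varepsilon,q_{\varepsilon/2}$ are arbitrary positive constants, $\theta\in\,]0,2\pi[\,\setminus\{\pi/2,\pi,3\pi/2\}$ and $\phi\in\,]-\pi/2,\pi/2[\,\setminus\{0\}$; and each of them is $K$-contact if and only if the stated condition holds (for $n=1$ the data with index $\varepsilon/2$ are absent): AI: $\xi_{o_H}=\pm\frac1\kappa X$, $(a_0,a_\varepsilon,b_\varepsilon,a_{\varepsilon/2},b_{\varepsilon/2})=\big(\kappa^2,\frac{\kappa}{2q_\varepsilon},\frac{\kappa q_\varepsilon}{2},\frac{\kappa}{4q_{\varepsilon/2}},\frac{\kappa q_{\varepsilon/2}}{4}\big)$; $K$-contact iff $q_\varepsilon=q_{\varepsilon/2}=1$. AII: $\xi_{o_H}=\pm\frac1\kappa\mu_\varepsilon$, $\big(\frac{\kappa}{2q_\varepsilon},\kappa^2,\frac{\kappa q_\varepsilon}{2},\frac{\kappa}{4q_{\varepsilon/2}},\frac{\kappa q_{\varepsilon/2}}{4}\big)$; $K$-contact iff $q_\varepsilon=q_{\varepsilon/2}=1$. AIII: $\xi_{o_H}=\pm\frac1\kappa\nu_\varepsilon$, $\big(\frac{\kappa}{2q_\varepsilon},\frac{\kappa q_\varepsilon}{2},\kappa^2,\frac\kappa4,\frac\kappa4\big)$;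 $K$-contact iff $q_\varepsilon=1$. BI: $\xi_{o_H}=\frac1\kappa(\cos\theta X+\sin\theta\,\mu_\varepsilon)$, $\big(\kappa^2,\kappa^2,\frac14,\frac{\kappa}{4q_{\varepsilon/2}},\frac{\kappa q_{\varepsilon/2}}{4}\big)$; $K$-contact iff $\kappa=\frac12$ and $q_{\varepsilon/2}=1$. BII: $\xi_{o_H}=\frac1\kappa(\cos\theta X+\sin\theta\,\nu_\varepsilon)$, $\big(\kappa^2,\frac14,\kappa^2,\frac\kappa4,\frac\kappa4\big)$; $K$-contact iff $\kappa=\frac12$. BIII: $\xi_{o_H}=\frac1\kappa(\cos\theta\,\mu_\varepsilon+\sin\theta\,\nu_\varepsilon)$, $\big(\frac14,\kappa^2,\kappa^2,\frac\kappa4,\frac\kappa4\big)$; $K$-contact iff $\kappa=\frac12$. C: $\xi_{o_H}=2(\cos\theta\cos\phi X+\sin\theta\cos\phi\,\mu_\varepsilon+\sin\phi\,\nu_\varepsilon)$, $\big(\frac14,\frac14,\frac14,\frac18,\frac18\big)$; always $K$-contact. Moreover, each orthogonal contact metric structure of Type AI, determined by a triple of positive constants $(\kappa,q_\varepsilon,q_{\varepsilon/2})$, is isomorphic to the corresponding one of Type AII (with the same triple).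
   Context: Setting. $\mathbb{CP}^n=G/K$ with $G=\mathrm{SU}(n+1)$, $K=\mathrm S(\mathrm U(1)\times\mathrm U(n))$. Let $E_{jk}$ be the elementary $(n+1)\times(n+1)$ matrices, $i=\sqrt{-1}$, $\langle U,V\rangle=-2\,\mathrm{trace}(UV)$ on $\mathfrak{su}(n+1)$, and $X=\frac12(E_{12}-E_{21})$, $\mu_\varepsilon=\frac i2(E_{12}+E_{21})$, $\nu_\varepsilon=-\frac i2(E_{11}-E_{22})$; $\mathfrak a=\mathbb RX$, $\mathfrak m_\varepsilon=\mathbb R\mu_\varepsilon$, $\mathfrak k_\varepsilon=\mathbb R\nu_\varepsilon$, $\overline{\mathfrak n}=\mathfrak a\oplus\mathfrak m_\varepsilon\oplus\mathfrak k_\varepsilon$; $\mathfrak m_{\varepsilon/2}=\mathbb R\{E_{1\,j+2}-E_{j+2\,1},\,i(E_{1\,j+2}+E_{j+2\,1}):1\le j\le n-1\}$; $\mathfrak k_{\varepsilon/2}=\mathbb R\{E_{2\,j+2}-E_{j+2\,2},\,i(E_{2\,j+2}+E_{j+2\,2}):1\le j\le n-1\}$. $H=\{k\in K:\mathrm{Ad}_kX=X\}$ with Lie algebra $\mathfrak h$; $\overline{\mathfrak m}=\overline{\mathfrak n}\oplus\mathfrak m_{\varepsilon/2}\oplus\mathfrak k_{\varepsilon/2}\cong T_{o_H}(G/H)$, $o_H=\{H\}$, and $\mathfrak g=\mathfrak h\oplus\overline{\mathfrak m}$ is reductive. $\overline{\mathfrak n}$ is the space of $\mathrm{Ad}(H)$-invariant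 vectors, so $G$-invariant vector fields on $G/H$ correspond to vectors of $\overline{\mathfrak n}$. $T_r\mathbb{CP}^n$ (tangent vectors of length $r$) is identified with $G/H$ by $aH\mapsto(\tau_a)_{*o}(rX)$, $o=K$, $\tau_a$ translation by $a$. Orthogonal metrics. A $G$-invariant metric on $G/H$ is orthogonal if $\mathbf g_{o_H}=a_0\langle\cdot,\cdot\rangle_{\mathfrak a}+a_\varepsilon\langle\cdot,\cdot\rangle_{\mathfrak m_\varepsilon}+b_\varepsilon\langle\cdot,\cdot\rangle_{\mathfrak k_\varepsilon}+a_{\varepsilon/2}\langle\cdot,\cdot\rangle_{\mathfrak m_{\varepsilon/2}}+b_{\varepsilon/2}\langle\cdot,\cdot\rangle_{\mathfrak k_{\varepsilon/2}}$ with positive constants; it is then denoted $\mathbf g^{a_0,a_\varepsilon,b_\varepsilon,a_{\varepsilon/2},b_{\varepsilon/2}}$. A $G$-invariant contact metric structure $(\xi,\mathbf g)$ (with $\xi$ and $\mathbf g$ both $G$-invariant) is orthogonal if $\mathbf g$ is. Types. For an orthogonal metric let $\xi_1=X/\sqrt{a_0}$, $\xi_2=\mu_\varepsilon/\sqrt{a_\varepsilon}$, $\xi_3=\nu_\varepsilon/\sqrt{b_\varepsilon}$. The structure is of Type AI, AII, AIII if $\xi_{o_H}=\pm\xi_1,\pm\xi_2,\pm\xi_3$; of Type BI, BII, BIII if $\xi_{o_H}=\cos\theta\,\xi_i+\sin\theta\,\xi_j$ with $(i,j)=(1,2),(1,3),(2,3)$; of Type C if $\xi_{o_H}=\cos\theta\cos\phi\,\xi_1+\sin\theta\cos\phi\,\xi_2+\sin\phi\,\xi_3$,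 with $\theta,\phi$ in the ranges given in the claim. Contact terminology. $2\,d\eta(U,V)=U\eta(V)-V\eta(U)-\eta([U,V])$. $(\xi,g)$ is a contact metric structure if, with $\eta=g(\xi,\cdot)$, there is a $(1,1)$-tensor $\varphi$ with $\varphi^2=-I+\eta\otimes\xi$, $\eta(\xi)=1$, $g(\varphi U,\varphi V)=g(U,V)-\eta(U)\eta(V)$ and $d\eta(U,V)=g(U,\varphi V)$. It is $K$-contact if $\xi$ is Killing. Two such structures $(\varphi_1,\xi_1,\eta_1,g_1)$, $(\varphi_2,\xi_2,\eta_2,g_2)$ are isomorphic if there is an isometry $f$ between the metrics with $f_*\xi_1=\xi_2$ and $f_*\circ\varphi_1=\varphi_2\circ f_*$. *)

(* Defs.v *)
From HB Require Import structures.
From mathcomp Require Import all_boot all_order all_algebra.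
From mathcomp Require Import all_classical all_reals all_analysis.
From mathcomp Require Import complex.

Set Implicit Arguments.
Unset Strict Implicit.
Unset Printing Implicit Defensive.

Import Order.TTheory GRing.Theory Num.Theory.
Import numFieldNormedType.Exports.

Local Open Scope classical_set_scope.
Local Open Scope ring_scope.
Local Open Scope complex_scope.
Local Open Scope sesquilinear_scope.

(** * Tensor calculus on an embedded submanifold [S] of a normed space [E]

    Functions, vector fields and tensors on [S] are represented by functions
    defined on all of [E]; only their values at points of [S] and on vectors
    tangent to [S] are ever used. *)

Section SmoothMaps.
Context {R : realType}.

(** On a finite-dimensional [E] this is the usual class C^k. *)
Fixpoint class_C (k : nat) (E F : normedModType R) (f : E -> F) : Prop :=
  if k is k'.+1 then
    (forall p, differentiable f p) /\ (forall v, class_C k' (fun p => 'D_v f p))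
  else continuous f.

Definition smooth (E F : normedModType R) (f : E -> F) : Prop :=
  forall k, class_C k f.

(** Smoothness on a subset: local extendability to a smooth map. *)
Definition smooth_on (E F : normedModType R) (S : set E) (f : E -> F) : Prop :=
  forall p, S p ->
    exists2 f' : E -> F, smooth f' & \forall q \near p, S q -> f' q = f q.

End SmoothMaps.

Section Submanifold.
Context {R : realType} {E : normedModType R}.
Variable S : set E.

(** For an embedded submanifold, requiring [c] to be smooth would not change the
    velocities obtained. *)
Definition curve_at (p w : E) (c : R -> E) : Prop :=
  [/\ forall t, S (c t), c 0 = p & is_derive (0 : R) (1 : R) c w].

Definition tangent (p : E) : set E := [set w | exists c, curve_at p w c].

(** The differential [f_* w] of [f] at [p] applied to a tangent vector [w]: the
    common derivative at [0] of [f \o c] over all curves [c] in [S] through [p]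
    with velocity [w] (and [0] if there is no such common value). It does exist
    when [f] is smooth on [S], being then ['D_w f' p] for any local smooth
    extension [f'] of [f]. *)
Definition tder (F : normedModType R) (f : E -> F) (p w : E) : F :=
  xget 0 [set z | forall c, curve_at p w c ->
                    is_derive (0 : R) (1 : R) (f \o c) z].

Definition vfield (U : E -> E) : Prop :=
  smooth_on S U /\ forall p, S p -> tangent p (U p).

(** For vector fields tangent to [S] this is again tangent to [S] and is the
    Lie bracket of [S]. *)
Definition lie (U V : E -> E) (p : E) : E :=
  tder V p (U p) - tder U p (V p).

Definition tensor11 (phi : E -> E -> E) : Prop :=
  [/\ forall p u, S p -> tangent p u -> tangent p (phi p u),
      forall p (k : R) u v, S p -> tangent p u -> tangent p v ->
        phi p (k *: u + v) = k *: phi p u + phi p v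
    & forall U, vfield U -> smooth_on S (fun p => phi p (U p))].

Definition riemannian (g : E -> E -> E -> R) : Prop :=
  [/\ forall p (k : R) u u' v, S p ->
        tangent p u -> tangent p u' -> tangent p v ->
        g p (k *: u + u') v = k * g p u v + g p u' v,
      forall p u v, S p -> tangent p u -> tangent p v -> g p u v = g p v u,
      forall p u, S p -> tangent p u -> u != 0 -> 0 < g p u u
    & forall U V, vfield U -> vfield V ->
        smooth_on S ((fun p => g p (U p) (V p)) : E -> R^o)].

(** Mind the factor [1/2] in this convention for [d eta]. *)
Definition ext_der (eta : E -> E -> R) (U V : E -> E) (p : E) : R :=
  2^-1 * (tder ((fun q => eta q (V q)) : E -> R^o) p (U p)
          - tder ((fun q => eta q (U q)) : E -> R^o) p (V p)
          - eta p (lie U V p)).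

Definition contact_metric (phi : E -> E -> E) (xi : E -> E)
    (g : E -> E -> E -> R) : Prop :=
  let eta p u := g p (xi p) u in
  [/\ vfield xi, riemannian g, tensor11 phi &
   [/\ forall p u, S p -> tangent p u ->
         phi p (phi p u) = - u + eta p u *: xi p,
       forall p, S p -> eta p (xi p) = 1,
       forall p u v, S p -> tangent p u -> tangent p v ->
         g p (phi p u) (phi p v) = g p u v - eta p u * eta p v
     & forall U V, vfield U -> vfield V -> forall p, S p ->
         ext_der eta U V p = g p (U p) (phi p (V p))]].

Definition contact_metric_structure (xi : E -> E) (g : E -> E -> E -> R) :
  Prop := exists phi, contact_metric phi xi g.

(** The Lie derivative of [g] along [xi] vanishes. *)
Definition killing (g : E -> E -> E -> R) (xi : E -> E) : Prop :=
  forall U V, vfield U -> vfield V -> forall p, S p ->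
    tder ((fun q => g q (U q) (V q)) : E -> R^o) p (xi p)
    = g p (lie xi U p) (V p) + g p (U p) (lie xi V p).

Definition K_contact (xi : E -> E) (g : E -> E -> E -> R) : Prop :=
  contact_metric_structure xi g /\ killing g xi.

Definition diffeo (f : E -> E) : Prop :=
  exists f' : E -> E,
    [/\ smooth_on S f, smooth_on S f',
        forall p, S p -> S (f p) /\ S (f' p)
      & forall p, S p -> f' (f p) = p /\ f (f' p) = p].

Definition pushes_metric (f : E -> E) (g1 g2 : E -> E -> E -> R) : Prop :=
  forall p u v, S p -> tangent p u -> tangent p v ->
    g2 (f p) (tder f p u) (tder f p v) = g1 p u v.

Definition pushes_field (f : E -> E) (U1 U2 : E -> E) : Prop :=
  forall p, S p -> tder f p (U1 p) = U2 (f p).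

Definition isomorphic_structures (xi1 : E -> E) (g1 : E -> E -> E -> R)
    (xi2 : E -> E) (g2 : E -> E -> E -> R) : Prop :=
  exists phi1 phi2 f,
    [/\ contact_metric phi1 xi1 g1, contact_metric phi2 xi2 g2 &
     [/\ diffeo f, pushes_metric f g1 g2, pushes_field f xi1 xi2
       & forall p u, S p -> tangent p u ->
           tder f p (phi1 p u) = phi2 (f p) (tder f p u)]].

End Submanifold.

(** * The Lie algebra [su(n+1)] *)

Notation "x *:R V" := ((x%:C)%C *: V) (at level 40).

Section LieAlgebra.
Context {R : realType} {n : nat}.
Notation CM := 'M[R[i]]_n.+1.

(** Elementary matrices, with indices starting from 1. *)
Definition E_ (j k : nat) : CM := delta_mx (inord j.-1) (inord k.-1).

Definition SU (a : CM) : Prop := a \is unitarymx /\ \det a = 1.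

Definition commutator (U V : CM) : CM := U *m V - V *m U.

Definition ip (U V : CM) : R := - 2 * complex.Re (\tr (U *m V)).

Definition X : CM := 2^-1 *: (E_ 1 2 - E_ 2 1).
Definition mu : CM := ('i%C / 2) *: (E_ 1 2 + E_ 2 1).
Definition nu : CM := - ('i%C / 2) *: (E_ 1 1 - E_ 2 2).

Definition sp_a : set CM := [set x *:R X | x in [set: R]].
Definition sp_m : set CM := [set x *:R mu | x in [set: R]].
Definition sp_k : set CM := [set x *:R nu | x in [set: R]].

(** [m_{eps/2}] for [l = 1] and [k_{eps/2}] for [l = 2]. *)
Definition sp_half (l : nat) : set CM :=
  [set A | exists x y : nat -> R,
     A = \sum_(1 <= j < n)
           (x j *:R (E_ l (j + 2) - E_ (j + 2) l)
            + y j *:R ('i%C *: (E_ l (j + 2) + E_ (j + 2) l)))].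

End LieAlgebra.

(** * The homogeneous manifold [T_r CP^n = G/H]

    [CP^n] is realised as the set of Hermitian projections [P] of rank one, with
    [G = SU(n+1)] acting by conjugation and base point [o = E_11]; a tangent
    vector at [P] is a matrix [W], and [G] acts on [TCP^n], the set of the pairs
    [(P, W)], by simultaneous conjugation. The vector of [T_o CP^n] defined by
    [A] in [su(n+1)] is [d/dt Ad(exp tA) o = [A, o]].

    As the calculus above needs a real normed space, complex matrices are stored
    as pairs (real part, imaginary part). *)

Section SphereBundle.
Context {R : realType} {n : nat}.
Notation CM := 'M[R[i]]_n.+1.
Notation RM := ('M[R]_n.+1 * 'M[R]_n.+1)%type.
Notation TM := (RM * RM)%type.

Definition cplx (A : RM) : CM := \matrix_(i, j) (A.1 i j +i* A.2 i j).
Definition reim (A : CM) : RM :=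
  (map_mx (@complex.Re R) A, map_mx (@complex.Im R) A).

Definition act (a : CM) (p : TM) : TM :=
  (reim (a *m cplx p.1 *m a^t*), reim (a *m cplx p.2 *m a^t*)).

(** Velocity at [t = 0] of [t |-> act (exp tA) p], for [A] in [su(n+1)]. *)
Definition inf_act (A : CM) (p : TM) : TM :=
  (reim (commutator A (cplx p.1)), reim (commutator A (cplx p.2))).

(** The tangent vector [r X] of [CP^n] at [o]. *)
Definition oH (r : R) : TM :=
  (reim (E_ 1 1), reim (r *:R commutator X (E_ 1 1))).

(** The image of [G/H] under [aH |-> (tau_a)_{*o} (rX)]; the stabiliser of
    [oH r] is [H], and the identification of the complement of [h] in [su(n+1)]
    with the tangent space at [oH r] is [A |-> inf_act A (oH r)]. *)
Definition TrCP (r : R) : set TM :=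
  [set p | exists2 a : CM, SU a & p = act a (oH r)].

Definition G_invariant_field (r : R) (xi : TM -> TM) : Prop :=
  forall a : CM, SU a -> pushes_field (TrCP r) (act a) xi xi.

Definition G_invariant_metric (r : R) (g : TM -> TM -> TM -> R) : Prop :=
  forall a : CM, SU a -> pushes_metric (TrCP r) (act a) g g.

(** [g] is the [G]-invariant metric [g^{a0, ae, be, ah, bh}]; the indices [e]
    and [h] stand for [eps] and [eps/2]. *)
Definition orthogonal_metric (r : R) (g : TM -> TM -> TM -> R)
    (a0 ae be ah bh : R) : Prop :=
  [/\ riemannian (TrCP r) g, G_invariant_metric r g,
      [/\ 0 < a0, 0 < ae, 0 < be, 0 < ah & 0 < bh] &
      forall A0 B0 A1 B1 A2 B2 A3 B3 A4 B4 : CM,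
        sp_a A0 -> sp_a B0 -> sp_m A1 -> sp_m B1 -> sp_k A2 -> sp_k B2 ->
        sp_half 1 A3 -> sp_half 1 B3 -> sp_half 2 A4 -> sp_half 2 B4 ->
        g (oH r) (inf_act (A0 + A1 + A2 + A3 + A4) (oH r))
                 (inf_act (B0 + B1 + B2 + B3 + B4) (oH r))
        = a0 * ip A0 B0 + ae * ip A1 B1 + be * ip A2 B2
          + ah * ip A3 B3 + bh * ip A4 B4].

(** [xi] is the [G]-invariant vector field with value [v] at [oH], and [g] is
    the metric [g^{a0, ae, be, ah, bh}]. *)
Definition invariant_pair (r : R) (xi : TM -> TM) (g : TM -> TM -> TM -> R)
    (v : CM) (a0 ae be ah bh : R) : Prop :=
  [/\ vfield (TrCP r) xi, G_invariant_field r xi, xi (oH r) = inf_act v (oH r)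
    & orthogonal_metric r g a0 ae be ah bh].

(** ** Types of orthogonal contact metric structures *)

Definition xi1 (a0 : R) : CM := (Num.sqrt a0)^-1 *:R X.
Definition xi2 (ae : R) : CM := (Num.sqrt ae)^-1 *:R mu.
Definition xi3 (be : R) : CM := (Num.sqrt be)^-1 *:R nu.

Definition theta_range (theta : R) : Prop :=
  (0 < theta < 2 * pi) /\
  [/\ theta <> pi / 2, theta <> pi & theta <> 3 * pi / 2].

Definition phi_range (phi : R) : Prop :=
  (- (pi / 2) < phi < pi / 2) /\ phi <> 0.

Definition type_AI (a0 ae be : R) (v : CM) : Prop :=
  exists s : bool, v = (-1) ^+ s *: xi1 a0.
Definition type_AII (a0 ae be : R) (v : CM) : Prop :=
  exists s : bool, v = (-1) ^+ s *: xi2 ae.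
Definition type_AIII (a0 ae be : R) (v : CM) : Prop :=
  exists s : bool, v = (-1) ^+ s *: xi3 be.
Definition type_BI (a0 ae be : R) (v : CM) : Prop :=
  exists2 theta, theta_range theta
    & v = cos theta *:R xi1 a0 + sin theta *:R xi2 ae.
Definition type_BII (a0 ae be : R) (v : CM) : Prop :=
  exists2 theta, theta_range theta
    & v = cos theta *:R xi1 a0 + sin theta *:R xi3 be.
Definition type_BIII (a0 ae be : R) (v : CM) : Prop :=
  exists2 theta, theta_range theta
    & v = cos theta *:R xi2 ae + sin theta *:R xi3 be.
Definition type_C (a0 ae be : R) (v : CM) : Prop :=
  exists theta phi, [/\ theta_range theta, phi_range phi
    & v = (cos theta * cos phi) *:R xi1 a0 + (sin theta * cos phi) *:R xi2 ae
          + sin phi *:R xi3 be].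

Definition orthogonal_contact (T : R -> R -> R -> CM -> Prop) (r : R)
    (xi : TM -> TM) (g : TM -> TM -> TM -> R) : Prop :=
  exists v a0 ae be ah bh,
    [/\ T a0 ae be v, invariant_pair r xi g v a0 ae be ah bh
      & contact_metric_structure (TrCP r) xi g].

(** ** The explicit families; [k, qe, qh] stand for [kappa, q_eps, q_{eps/2}] *)

Definition data_AI r xi g (s : bool) (k qe qh : R) : Prop :=
  invariant_pair r xi g ((-1) ^+ s *: (k^-1 *:R X))
    (k ^+ 2) (k / (2 * qe)) (k * qe / 2) (k / (4 * qh)) (k * qh / 4).

Definition data_AII r xi g (s : bool) (k qe qh : R) : Prop :=
  invariant_pair r xi g ((-1) ^+ s *: (k^-1 *:R mu))
    (k / (2 * qe)) (k ^+ 2) (k * qe / 2) (k / (4 * qh)) (k * qh / 4).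

Definition data_AIII r xi g (s : bool) (k qe : R) : Prop :=
  invariant_pair r xi g ((-1) ^+ s *: (k^-1 *:R nu))
    (k / (2 * qe)) (k * qe / 2) (k ^+ 2) (k / 4) (k / 4).

Definition data_BI r xi g (theta k qh : R) : Prop :=
  invariant_pair r xi g (k^-1 *:R (cos theta *:R X + sin theta *:R mu))
    (k ^+ 2) (k ^+ 2) (4^-1) (k / (4 * qh)) (k * qh / 4).

Definition data_BII r xi g (theta k : R) : Prop :=
  invariant_pair r xi g (k^-1 *:R (cos theta *:R X + sin theta *:R nu))
    (k ^+ 2) (4^-1) (k ^+ 2) (k / 4) (k / 4).

Definition data_BIII r xi g (theta k : R) : Prop :=
  invariant_pair r xi g (k^-1 *:R (cos theta *:R mu + sin theta *:R nu))
    (4^-1) (k ^+ 2) (k ^+ 2) (k / 4) (k / 4).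

Definition data_C r xi g (theta phi : R) : Prop :=
  invariant_pair r xi g
    (2 *:R ((cos theta * cos phi) *:R X + (sin theta * cos phi) *:R mu
            + sin phi *:R nu))
    (4^-1) (4^-1) (4^-1) (8^-1) (8^-1).

End SphereBundle.

(* Main.v *)
Require Import Defs.
From HB Require Import structures.
From mathcomp Require Import all_boot all_order all_algebra.
From mathcomp Require Import all_classical all_reals all_analysis.
From mathcomp Require Import complex.
From mathcomp Require Import ring lra.
Set Implicit Arguments.
Unset Strict Implicit.
Unset Printing Implicit Defensive.
Import Order.TTheory GRing.Theory Num.Theory.
Import numFieldNormedType.Exports.
Local Open Scope classical_set_scope.
Local Open Scope ring_scope.
Local Open Scope complex_scope.
Local Open Scope sesquilinear_scope.

(** Write a point of [T_r CP^n] as a pair of Hermitian matrices [(P, N)], where [P]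
    is the projection onto a line and [N] is the rescaled tangent vector. The
    unitary group acts by conjugation, transitively, and the fundamental field
    of a skew-Hermitian [A] is [p |-> inf_act A p]; every tangent vector at [p] is
    of this form, with [A] determined modulo the stabiliser of [p].

    The vectors [X], [mu], [nu] extend to equivariant maps of [(P, N)] ([Xpt],
    [mupt], [nupt]), and so does the linear operator [Gam] of the metric: for an
    orthogonal metric, [g p (inf_act A p) (inf_act B p) = ip A (Gam B)]
    ([orthogonal_canonical], [can_metric_inf_act]). An invariant field is
    [p |-> inf_act (vpt x y z P N) p] ([field_canonical]). Both therefore exist for
    all positive coefficients ([can_invariant_pair]).

    The exterior derivative of [eta] and the Lie derivative of [g] are tensors
    ([ext_der_pointwise], [killing_defect_pointwise]), so they can be computed on
    fundamental fields, whose derivatives are brackets in the Lie algebra. Let [v]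
    be the vector defining [xi], and [Z = Gam v], so that [eta] is the product
    with [Z]. Then [d eta] of two fundamental fields is
    [- (1 / 2) ip [A, B] Z = (1 / 2) ip A [Z, B]]; hence [phi] can only be
    [(1 / 2) Gam^-1 ad Z], and the structure is contact metric if and only if
    this operator satisfies [phi^2 = - 1 + eta (x) xi] and [eta xi = 1] modulo the
    stabiliser at the base point. Similarly [xi] is Killing if and only if [ad v] is
    skew for [Gam] ([contact_iff], [killing_iff]).

    At the base point, [X], [mu], [nu] span a copy of [su(2)] on which [ad Z] is a
    cross product, while each pair of entries of index [eps/2] carries the
    standard representation of [su(2)]. So the condition splits into equations on the
    three coordinates of [v], and one on [2 x 2] matrices, void when [n = 1]
    ([contact_base], [killing_base]). In the orthonormal frame
    [xi1], [xi2], [xi3] these equations become polynomial ([frame_contact]), and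
    according to which coordinates of the unit vector [xi] vanish they have the
    solutions listed in the theorem ([frame_axis], [frame_plane], [frame_sphere]).

    Types AI and AII are exchanged by the complex structure of [CP^n], that is by
    [(P, W) |-> (P, +- i [P, W])]. This map commutes with the action and fixes
    [P], while it exchanges, up to sign, [X] and [mu] ([quarter_isomorphic]). *)

(** * Smooth maps *)

Lemma sum_closed (T : Type) (V : nmodType) (P : (T -> V) -> Prop)
    (I : finType) (f : I -> T -> V) :
  P (fun=> 0) ->
  (forall g h, P g -> P h -> P (fun x => g x + h x)) ->
  (forall i, P (f i)) -> P (fun x => \sum_i f i x).
Proof.
move=> P0 PD Pf; elim: (index_enum I) => [|i s IH].
  by rewrite (_ : (fun _ => _) = (fun=> 0)) //; apply/funext => x; rewrite big_nil.
rewrite (_ : (fun _ => _) = (fun x => f i x + \sum_(j <- s) f j x)); first exact: PD.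
by apply/funext => x; rewrite big_cons.
Qed.

Section LinearMaps.
Context {R : realType}.

(** This property plays the part of finite dimension in the calculus: it holds for
    matrix spaces and their products. *)
Definition all_linear_continuous (E : normedModType R) : Prop :=
  forall (F : normedModType R) (l : E -> F), linear l -> continuous l.

Lemma linear_prop_diff (E F : normedModType R) (l : E -> F) p :
  linear l -> continuous l -> differentiable l p /\ forall v, 'd l p v = l v.
Proof.
move=> ll cl.
pose lM := GRing.isLinear.Build _ _ _ _ _ ll.
pose L : {linear E -> F} := HB.pack l lM.
by split; [exact: (linear_differentiable (f := L))|move=> v; rewrite (diff_lin (f := L))].
Qed.

Lemma linear_propD (E F : lmodType R) (l : E -> F) : linear l -> forall x y, l (x + y) = l x + l y.
Proof. by move=> ll x y; have := ll 1 x y; rewrite !scale1r. Qed.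

Lemma linear_prop0 (E F : lmodType R) (l : E -> F) : linear l -> l 0 = 0.
Proof. by move=> ll; apply: (addrI (l 0)); rewrite -(linear_propD ll) !addr0. Qed.

Lemma linear_propZ (E F : lmodType R) (l : E -> F) : linear l -> forall k x, l (k *: x) = k *: l x.
Proof. by move=> ll k x; have := ll k x 0; rewrite (linear_prop0 ll) !addr0. Qed.

Lemma linear_propB (E F : lmodType R) (l : E -> F) : linear l -> forall x y, l (x - y) = l x - l y.
Proof. by move=> ll x y; rewrite -scaleN1r addrC ll scaleN1r addrC. Qed.

Lemma all_linear_continuousR : all_linear_continuous R^o.
Proof.
move=> F l ll; have -> : l = ( *:%R^~ (l 1)).
  by apply/funext => x; rewrite -(linear_propZ ll) [_ *: _]mulr1.
exact: scalel_continuous.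
Qed.

Lemma all_linear_continuous_mx m n : all_linear_continuous 'M[R]_(m.+1, n.+1).
Proof.
move=> F l ll.
have -> : l = (fun A : 'M[R]_(m.+1, n.+1) => \sum_i \sum_j (A i j) *: l (delta_mx i j)).
  apply/funext => A; rewrite {1}(matrix_sum_delta A).
  rewrite (big_morph l (linear_propD ll) (linear_prop0 ll)); apply: eq_bigr => i _.
  rewrite (big_morph l (linear_propD ll) (linear_prop0 ll)); apply: eq_bigr => j _.
  exact: linear_propZ.
have c0 : continuous ((fun=> 0) : 'M[R]_(m.+1, n.+1) -> F) by move=> x; apply: cst_continuous.
have cD (g h : 'M[R]_(m.+1, n.+1) -> F) :
    continuous g -> continuous h -> continuous (fun x => g x + h x).
  by move=> cg ch x; apply: (@continuousD _ _ _ g h); [exact: cg|exact: ch].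
apply: (@sum_closed _ _ (fun f => continuous f)) => // i.
apply: (@sum_closed _ _ (fun f => continuous f)) => // j A.
apply: (@continuous_comp _ _ _ (fun A : 'M[R]_(m.+1, n.+1) => A i j : R^o) ( *:%R^~ (l (delta_mx i j)))).
  exact: coord_continuous.
exact: scalel_continuous.
Qed.

Lemma all_linear_continuous_prod (E1 E2 : normedModType R) :
  all_linear_continuous E1 -> all_linear_continuous E2 ->
  all_linear_continuous (E1 * E2)%type.
Proof.
move=> c1 c2 F l ll.
have l1 : linear (fun x : E1 => l (x, 0)).
  by move=> k x y; rewrite -ll; congr l; congr pair => /=; rewrite scaler0 addr0.
have l2 : linear (fun x : E2 => l (0, x)).
  by move=> k x y; rewrite -ll; congr l; congr pair => /=; rewrite scaler0 addr0.
have -> : l = (fun p => l (p.1, 0) + l (0, p.2)).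
  apply/funext => -[x y] /=; rewrite -(linear_propD ll); congr l.
  by congr pair => /=; rewrite ?addr0 ?add0r.
move=> p; apply: (@continuousD _ _ _ (fun p => l (p.1, 0)) (fun p => l (0, p.2))).
  by apply: (@continuous_comp _ _ _ fst (fun x => l (x, 0))); [exact: cvg_fst|exact: c1].
by apply: (@continuous_comp _ _ _ snd (fun x => l (0, x))); [exact: cvg_snd|exact: c2].
Qed.

End LinearMaps.

Section SmoothCalculus.
Context {R : realType}.
Implicit Types E F G : normedModType R.

Lemma class_C_cst k E F (c : F) : class_C k (fun _ : E => c).
Proof.
elim: k E F c => [|k IH] E F c /=; first by move=> x; apply: cst_continuous.
split=> [p|v]; first exact: differentiable_cst.
have -> : (fun p => 'D_v (fun _ : E => c) p) = (fun=> 0).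
  by apply/funext => p; exact: derive_cst.
exact: IH.
Qed.

Lemma class_C_lin k E F (l : E -> F) : linear l -> continuous l -> class_C k l.
Proof.
move=> ll cl; case: k => [|k] //=; split=> [p|v]; first exact: (linear_prop_diff p ll cl).1.
have -> : (fun p => 'D_v l p) = (fun=> l v); last exact: class_C_cst.
apply/funext => p; rewrite deriveE; last exact: (linear_prop_diff p ll cl).1.
exact: (linear_prop_diff p ll cl).2.
Qed.

Lemma class_CS k E F (f : E -> F) : class_C k.+1 f -> class_C k f.
Proof.
elim: k E F f => [|k IH] E F f; first by case=> df _ p; exact: differentiable_continuous.
by case=> df cf; split=> // v; apply: IH.
Qed.

Lemma class_CD k E F (f g : E -> F) :
  class_C k f -> class_C k g -> class_C k (fun p => f p + g p).
Proof.
elim: k E F f g => [|k IH] E F f g; first by move=> cf cg p; apply: (@continuousD _ _ _ f g); [exact: cf|exact: cg].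
case=> df cf [dg cg]; split=> [p|v]; first exact: differentiableD.
have -> : (fun p => 'D_v (fun p => f p + g p) p) = (fun p => 'D_v f p + 'D_v g p); last by apply: IH; [exact: cf|exact: cg].
by apply/funext => p; rewrite deriveD //; apply: diff_derivable; (exact: df || exact: dg).
Qed.

Lemma class_C_comp_lin k E F G (l : F -> G) (f : E -> F) :
  linear l -> continuous l -> class_C k f -> class_C k (fun p => l (f p)).
Proof.
move=> ll cl; elim: k f => [|k IH] f.
  by move=> cf p; apply: (continuous_comp (cf p) (cl _)).
case=> df cf; split=> [p|v].
  exact: (differentiable_comp (df p) (linear_prop_diff _ ll cl).1).
have -> : (fun p => 'D_v (fun p => l (f p)) p) = (fun p => l ('D_v f p)); last by apply: IH; exact: cf.
apply/funext => p; rewrite !deriveE //; last first.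
  exact: (differentiable_comp (df p) (linear_prop_diff _ ll cl).1).
rewrite (diff_comp (df p) (linear_prop_diff _ ll cl).1) /=.
exact: (linear_prop_diff _ ll cl).2.
Qed.

Lemma class_CM k E (f g : E -> R^o) :
  class_C k f -> class_C k g -> class_C k (fun p => f p * g p : R^o).
Proof.
elim: k f g => [|k IH] f g; first by move=> cf cg p; apply: (@continuousM _ _ f g); [exact: cf|exact: cg].
move=> Cf Cg; case: (Cf) => df cf; case: (Cg) => dg cg; split=> [p|v].
  exact: differentiableM.
have -> : (fun p => 'D_v (fun p => f p * g p : R^o) p) = (fun p => f p * 'D_v g p + g p * 'D_v f p); last first.
  by apply: class_CD; apply: IH; [exact: class_CS|exact: cg|exact: class_CS|exact: cf].
by apply/funext => p; rewrite deriveM //; apply: diff_derivable; (exact: df || exact: dg).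
Qed.

Lemma smooth_cst E F (c : F) : smooth (fun _ : E => c).
Proof. by move=> k; exact: class_C_cst. Qed.

Lemma smooth_lin E F (l : E -> F) : all_linear_continuous E -> linear l -> smooth l.
Proof. by move=> cE ll k; apply: class_C_lin => //; exact: cE. Qed.

Lemma smoothD E F (f g : E -> F) : smooth f -> smooth g -> smooth (fun p => f p + g p).
Proof. by move=> sf sg k; exact: class_CD. Qed.

Lemma smooth_sum E F (I : finType) (f : I -> E -> F) :
  (forall i, smooth (f i)) -> smooth (fun p => \sum_i f i p).
Proof.
by apply: (@sum_closed _ _ (fun f => smooth f)) => [|g h]; [exact: smooth_cst|exact: smoothD].
Qed.

Lemma smoothM E (f g : E -> R^o) : smooth f -> smooth g -> smooth (fun p => f p * g p : R^o).
Proof. by move=> sf sg k; exact: class_CM. Qed.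

Lemma smooth_comp_lin E F G (l : F -> G) (f : E -> F) :
  all_linear_continuous F -> linear l -> smooth f -> smooth (fun p => l (f p)).
Proof. by move=> cF ll sf k; apply: class_C_comp_lin => //; exact: cF. Qed.

Lemma smoothN E F (f : E -> F) : smooth f -> smooth (fun p => - f p).
Proof.
move=> sf k; apply: (@class_C_comp_lin k E F F -%R) => //.
  by move=> a x y; rewrite opprD scalerN.
by move=> x; exact: opp_continuous.
Qed.

Lemma smoothZl E F (f : E -> R^o) (e : F) : smooth f -> smooth (fun p => f p *: e).
Proof.
move=> sf; apply: (@smooth_comp_lin E R^o F (fun x => x *: e)) => //.
  exact: all_linear_continuousR.
by move=> a x y; rewrite scalerDl scalerA.
Qed.

Lemma smooth_mx E m n (f : E -> 'M[R]_(m.+1, n.+1)) :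
  (forall i j, smooth (fun p => f p i j : R^o)) -> smooth f.
Proof.
move=> sf.
rewrite (_ : f = (fun p => \sum_i \sum_j f p i j *: delta_mx i j)).
  by apply: smooth_sum => i; apply: smooth_sum => j; exact: smoothZl.
by apply/funext => p; exact: matrix_sum_delta.
Qed.

Lemma smooth_pair E F G (f : E -> F) (g : E -> G) :
  smooth f -> smooth g -> smooth (fun p => (f p, g p)).
Proof.
move=> sf sg.
have inl_lin : linear (fun x : F => (x, 0 : G)).
  by move=> a x y; congr pair => /=; rewrite scaler0 addr0.
have inr_lin : linear (fun x : G => (0 : F, x)).
  by move=> a x y; congr pair => /=; rewrite scaler0 addr0.
have -> : (fun p => (f p, g p)) = (fun p => (f p, 0) + (0, g p)).
  by apply/funext => p; congr pair => /=; rewrite ?addr0 ?add0r.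
have inl_cont : continuous (fun x : F => (x, 0 : G)).
  by move=> x; apply/differentiable_continuous/differentiable_pair.
have inr_cont : continuous (fun x : G => (0 : F, x)).
  by move=> x; apply/differentiable_continuous/differentiable_pair.
apply: smoothD => k; first exact: (class_C_comp_lin inl_lin).
exact: (class_C_comp_lin inr_lin).
Qed.

Lemma smooth_diff E F (f : E -> F) p : smooth f -> differentiable f p.
Proof. by move=> /(_ 1%N) [+ _]; exact. Qed.

Lemma smooth_is_derive E F (f : E -> F) p w : smooth f -> is_derive p w f ('D_w f p).
Proof. by move=> sf; apply/derivableP/diff_derivable/smooth_diff. Qed.

End SmoothCalculus.

(** * Derivatives along curves and tensoriality *)

Section Derivatives.
Context {R : realType}.
Implicit Types E F G : normedModType R.

Lemma is_derive_lin E F G (l : F -> G) (f : E -> F) p w df :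
  linear l -> continuous l ->
  is_derive p w f df -> is_derive p w (fun q => l (f q)) (l df).
Proof.
move=> ll cl [df1 <-].
have H : (fun h => h^-1 *: (((fun q => l (f q)) \o shift p) (h *: w) - l (f p))) @ 0^'
    --> l ('D_w f p).
  have -> : (fun h => h^-1 *: (((fun q => l (f q)) \o shift p) (h *: w) - l (f p)))
     = l \o (fun h => h^-1 *: ((f \o shift p) (h *: w) - f p)).
    apply/funext => h /=; rewrite (linear_propZ ll); congr (_ *: _).
    by rewrite (linear_propB ll).
  by apply: (@cvg_comp _ _ _ _ l _ (nbhs ('D_w f p)) _ df1); exact: cl.
apply: DeriveDef; first by apply/cvg_ex; exists (l ('D_w f p)).
exact: cvg_lim H.
Qed.

Lemma is_derive_comp_curve F (E : normedModType R) (f : E -> F) (c : R -> E) p w :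
  differentiable f p -> c 0 = p -> is_derive (0 : R) (1 : R) c w ->
  is_derive (0 : R) (1 : R) (f \o c) ('D_w f p).
Proof.
move=> df c0 [dc cw].
have dc' : differentiable c 0 by apply/derivable1_diffP.
have df' : differentiable f (c 0) by rewrite c0.
have dfc : differentiable (f \o c) 0 by apply: differentiable_comp.
apply: DeriveDef; first exact/derivable1_diffP.
rewrite deriveE // diff_comp //= c0 deriveE // -cw.
by congr ('d f p _); rewrite deriveE.
Qed.

Lemma is_derive_pair E F G (f : E -> F) (g : E -> G) p w df dg :
  is_derive p w f df -> is_derive p w g dg ->
  is_derive p w (fun q => (f q, g q)) (df, dg).
Proof.
move=> Hf Hg.
have inl_lin : linear (fun x : F => (x, 0 : G)).
  by move=> a x y; congr pair => /=; rewrite scaler0 addr0.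
have inr_lin : linear (fun x : G => (0 : F, x)).
  by move=> a x y; congr pair => /=; rewrite scaler0 addr0.
have inl_cont : continuous (fun x : F => (x, 0 : G)).
  by move=> x; apply/differentiable_continuous/differentiable_pair.
have inr_cont : continuous (fun x : G => (0 : F, x)).
  by move=> x; apply/differentiable_continuous/differentiable_pair.
have -> : (fun q => (f q, g q)) = (fun q => (f q, 0)) + (fun q => (0, g q)).
  by apply/funext => q; congr pair => /=; rewrite ?addr0 ?add0r.
have -> : (df, dg) = (df, 0) + (0, dg).
  by congr pair => /=; rewrite ?addr0 ?add0r.
apply: is_deriveD; first exact: (is_derive_lin inl_lin inl_cont).
exact: (is_derive_lin inr_lin inr_cont).
Qed.

Lemma is_derive_mx E m n (f : E -> 'M[R]_(m.+1, n.+1)) p w (df : 'M[R]_(m.+1, n.+1)) :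
  (forall i j, is_derive p w (fun q => f q i j : R^o) (df i j)) ->
  is_derive p w f df.
Proof.
move=> H; have D : derivable f p w.
  by apply/derivable_mxP => i j; case: (H i j).
apply: DeriveDef => //; rewrite derive_mx //; apply/matrixP => i j.
by rewrite mxE; case: (H i j).
Qed.

Lemma is_derive_uniq E F (f : E -> F) p w df df' :
  is_derive p w f df -> is_derive p w f df' -> df = df'.
Proof. by case=> _ <- [_ <-]. Qed.

(** Along the line through [p] the difference quotient is constant. *)
Lemma derive_affine E F (f : E -> F) p w z :
  (forall h : R, f (h *: w + p) = h *: z + f p) -> 'D_w f p = z.
Proof.
move=> H; apply: cvg_lim => //.
apply: (@cvg_near_cst).
near=> h; rewrite /= H addrK scalerA mulVf ?scale1r //.
by near: h; exact: nbhs_dnbhs_neq.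
Unshelve. all: by end_near. Qed.

End Derivatives.

Section TangentialDerivative.
Context {R : realType} {E : normedModType R} (S : set E).
Implicit Types F : normedModType R.

Lemma smooth_on_global F (f f' : E -> F) :
  smooth f' -> (forall p, S p -> f' p = f p) -> smooth_on S f.
Proof. by move=> sf ff' p Sp; exists f' => //; apply: nearW => q; exact: ff'. Qed.

Lemma near_imply (P Q : E -> Prop) (p : E) : (forall q, P q -> Q q) ->
  (\forall q \near p, P q) -> \forall q \near p, Q q.
Proof. by move=> PQ; apply: filterS. Qed.

(** All curves with velocity [w] give the same derivative, and there is at least
    one, so the choice made by [tder] has a unique candidate. *)
Lemma tder_derive F (f f' : E -> F) p w z :
  tangent S p w -> differentiable f' p -> is_derive p w f' z ->
  (\forall q \near p, S q -> f' q = f q) -> tder S f p w = z.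
Proof.
move=> [c0 hc0] df [_ <-] ff'.
have key c : curve_at S p w c -> is_derive (0 : R) (1 : R) (f \o c) ('D_w f' p).
  case=> Sc cp dc; apply: near_eq_is_derive (is_derive_comp_curve df cp dc).
  have cc : {for 0, continuous c}.
    by apply/differentiable_continuous/derivable1_diffP; case: dc.
  have : \forall t \near (0 : R), S (c t) -> f' (c t) = f (c t).
    have H : nbhs (c 0) [set q | S q -> f' q = f q] by rewrite cp.
    exact: (cc _ H).
  by apply: filterS => t /(_ (Sc t)).
rewrite /tder; apply: xget_subset1 => //.
by move=> x y Hx Hy; exact: is_derive_uniq (Hx _ hc0) (Hy _ hc0).
Qed.

Lemma tder_smooth F (f f' : E -> F) p w :
  tangent S p w -> smooth f' ->
  (\forall q \near p, S q -> f' q = f q) -> tder S f p w = 'D_w f' p.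
Proof.
move=> tw sf; apply: tder_derive => //; first exact: smooth_diff.
exact: smooth_is_derive.
Qed.

Lemma tder_global F (f f' : E -> F) p w :
  tangent S p w -> smooth f' -> {in S, f' =1 f} -> tder S f p w = 'D_w f' p.
Proof.
move=> tw sf ff'; apply: tder_smooth => //.
by apply: nearW => q Sq; apply: ff'; rewrite inE.
Qed.

Lemma tder_lin F (l : E -> F) p w : all_linear_continuous E -> linear l ->
  tangent S p w -> tder S l p w = l w.
Proof.
move=> cE ll tw; rewrite (@tder_global _ l l) //; last exact: smooth_lin.
by apply: derive_affine => h; exact: ll.
Qed.

End TangentialDerivative.

Section TwoTensors.
Context {R : realType} {E : normedModType R} (F : E * (E * E) -> R^o).
Hypothesis F_diff : forall x, differentiable F x.
Hypothesis F_linl : forall p v, linear (fun u => F (p, (u, v))).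
Hypothesis F_linr : forall p u, linear (fun v => F (p, (u, v))).

Lemma product_rule (U V : E -> E) p w :
  differentiable U p -> differentiable V p ->
  'D_w (fun q => F (q, (U q, V q))) p =
   'D_(w, (0, 0)) F (p, (U p, V p)) + F (p, ('D_w U p, V p)) + F (p, (U p, 'D_w V p)).
Proof.
move=> dU dV.
pose h q := (q, (U q, V q)).
have dUV : differentiable (fun q => (U q, V q)) p by apply: differentiable_pair.
have dh : differentiable h p by apply: differentiable_pair.
have -> : 'D_w (fun q => F (q, (U q, V q))) p = 'd F (h p) (w, ('d U p w, 'd V p w)).
  rewrite deriveE; last exact: (differentiable_comp (f := h)).
  rewrite (diff_comp (f := h)) //=; congr ('d F _ _).
  have idl : linear (fun q : E => q) by [].
  have did : 'd (fun q : E => q) p w = w.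
    exact: (linear_prop_diff p idl (fun x => @cvg_id _ _)).2.
  have dUVE : 'd (fun q => (U q, V q)) p w = ('d U p w, 'd V p w).
    exact: (congr1 (fun l => l w) (diff_pair dU dV)).
  have did' : differentiable (fun q : E => q) p by [].
  have dhE : 'd h p w = ('d (fun q : E => q) p w, 'd (fun q => (U q, V q)) p w).
    exact: (congr1 (fun l => l w) (diff_pair did' dUV)).
  exact: etrans dhE (f_equal2 pair did dUVE).
have -> : (w, ('d U p w, 'd V p w)) =
   (w, (0, 0)) + (0, ('d U p w, 0)) + (0, (0, 'd V p w)) :> E * (E * E).
  by congr (_, (_, _)) => /=; rewrite ?addr0 ?add0r.
rewrite !linearD /= -!deriveE //.
congr (_ + _ + _).
- apply: derive_affine => k; rewrite -F_linl; congr F.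
  by congr (_, (_, _)) => /=; rewrite ?scaler0 ?add0r.
- apply: derive_affine => k; rewrite -F_linr; congr F.
  by congr (_, (_, _)) => /=; rewrite ?scaler0 ?add0r.
Qed.

End TwoTensors.

Section Tensoriality.
Context {R : realType} {E : normedModType R} (S : set E).
Context (F : E * (E * E) -> R^o) (g : E -> E -> E -> R).
Hypothesis F_diff : forall x, differentiable F x.
Hypothesis F_linl : forall p v, linear (fun u => F (p, (u, v))).
Hypothesis F_linr : forall p u, linear (fun v => F (p, (u, v))).
Hypothesis gF : forall q u v, S q -> tangent S q u -> tangent S q v ->
  g q u v = F (q, (u, v)).
Hypothesis lie_tangent : forall U V, vfield S U -> vfield S V ->
  forall p, S p -> tangent S p (lie S U V p).

(** The form [F] represents [g] on the whole ambient space; the first term is the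
    derivative of its coefficients, with the arguments held fixed. *)
Lemma tder_pairing (U V : E -> E) p w :
  vfield S U -> vfield S V -> S p -> tangent S p w ->
  tder S ((fun q => g q (U q) (V q)) : E -> R^o) p w =
  'D_(w, (0, 0)) F (p, (U p, V p)) + F (p, (tder S U p w, V p))
  + F (p, (U p, tder S V p w)).
Proof.
move=> [sU tU] [sV tV] Sp tw.
have [U' sU' UU'] := sU _ Sp.
have [V' sV' VV'] := sV _ Sp.
rewrite (tder_smooth tw sU' UU') (tder_smooth tw sV' VV').
rewrite -(nbhs_singleton UU' Sp) -(nbhs_singleton VV' Sp).
rewrite -(product_rule F_diff F_linl F_linr); [|exact: smooth_diff..].
have dF : differentiable (fun q => F (q, (U' q, V' q))) p.
  apply: (differentiable_comp (f := fun q => (q, (U' q, V' q)))) => //.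
  apply: differentiable_pair => //.
  by apply: differentiable_pair; exact: smooth_diff.
apply: (tder_derive (f' := fun q => F (q, (U' q, V' q)))) => //.
  exact/derivableP/diff_derivable.
near=> q => Sq.
have Uq : U' q = U q by move: Sq; near: q.
have Vq : V' q = V q by move: Sq; near: q.
by rewrite Uq Vq gF //; [exact: tU|exact: tV].
Unshelve. all: by end_near. Qed.

(** The derivatives of [U] and [V] cancel against the bracket, so only their
    values at [p] remain. *)
Lemma ext_der_pointwise (xi U V : E -> E) p :
  vfield S xi -> vfield S U -> vfield S V -> S p ->
  ext_der S (fun q u => g q (xi q) u) U V p =
  2^-1 * ('D_(U p, (0, 0)) F (p, (xi p, V p)) + F (p, (tder S xi p (U p), V p))
   - ('D_(V p, (0, 0)) F (p, (xi p, U p)) + F (p, (tder S xi p (V p), U p)))).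
Proof.
move=> vxi vU vV Sp; rewrite /ext_der.
have tU := vU.2 _ Sp; have tV := vV.2 _ Sp; have txi := vxi.2 _ Sp.
rewrite !tder_pairing // gF //; last exact: lie_tangent.
rewrite /lie (linear_propB (F_linr _ _)); congr (_ * _).
set a := 'D_ _ _ _; set b := 'D_ _ _ _.
ring.
Qed.

(** As for [ext_der], the terms that differentiate [U] and [V] cancel. *)
Lemma killing_defect_pointwise (xi U V : E -> E) p :
  vfield S xi -> vfield S U -> vfield S V -> S p ->
  tder S ((fun q => g q (U q) (V q)) : E -> R^o) p (xi p)
   - (g p (lie S xi U p) (V p) + g p (U p) (lie S xi V p)) =
  'D_(xi p, (0, 0)) F (p, (U p, V p)) + F (p, (tder S xi p (U p), V p))
   + F (p, (U p, tder S xi p (V p))).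
Proof.
move=> vxi vU vV Sp.
have tU := vU.2 _ Sp; have tV := vV.2 _ Sp; have txi := vxi.2 _ Sp.
rewrite tder_pairing // !gF //; [|exact: lie_tangent..].
rewrite /lie (linear_propB (F_linl _ _)) (linear_propB (F_linr _ _)).
ring.
Qed.

End Tensoriality.

(** * Complex matrices over a real normed space *)

Section ComplexCalculus.
Context {R : realType}.
Implicit Types E F G : normedModType R.
Notation C := R[i].

Lemma cReD (x y : C) : complex.Re (x + y) = complex.Re x + complex.Re y.
Proof. by case: x y => [a b] [c d]. Qed.
Lemma cImD (x y : C) : complex.Im (x + y) = complex.Im x + complex.Im y.
Proof. by case: x y => [a b] [c d]. Qed.
Lemma cReN (x : C) : complex.Re (- x) = - complex.Re x.
Proof. by case: x => [a b]. Qed.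
Lemma cImN (x : C) : complex.Im (- x) = - complex.Im x.
Proof. by case: x => [a b]. Qed.
Lemma cReM (x y : C) : complex.Re (x * y) = complex.Re x * complex.Re y - complex.Im x * complex.Im y.
Proof. by case: x y => [a b] [c d]. Qed.
Lemma cImM (x y : C) : complex.Im (x * y) = complex.Re x * complex.Im y + complex.Im x * complex.Re y.
Proof. by case: x y => [a b] [c d]. Qed.
Lemma cReJ (x : C) : complex.Re x^* = complex.Re x.
Proof. by case: x => [a b]. Qed.
Lemma cImJ (x : C) : complex.Im x^* = - complex.Im x.
Proof. by case: x => [a b]. Qed.
Lemma Re_rM (k : R) (x : C) : complex.Re (k%:C * x) = k * complex.Re x.
Proof. by rewrite cReM /= mul0r subr0. Qed.
Lemma Im_rM (k : R) (x : C) : complex.Im (k%:C * x) = k * complex.Im x.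
Proof. by rewrite cImM /= mul0r addr0. Qed.

(** The calculus is over the reals, so complex maps are treated through their real
    and imaginary parts. *)
Definition smC E (f : E -> C) : Prop :=
  smooth (fun p => complex.Re (f p) : R^o) /\ smooth (fun p => complex.Im (f p) : R^o).

Definition isDC E (p w : E) (f : E -> C) (df : C) : Prop :=
  is_derive p w (fun q => complex.Re (f q) : R^o) (complex.Re df) /\
  is_derive p w (fun q => complex.Im (f q) : R^o) (complex.Im df).

Lemma smC_cst E (c : C) : smC (fun _ : E => c).
Proof. by split; exact: smooth_cst. Qed.

Lemma smCD E (f g : E -> C) : smC f -> smC g -> smC (fun p => f p + g p).
Proof.
move=> [f1 f2] [g1 g2]; split.
  by under eq_fun do rewrite cReD; exact: smoothD.
by under eq_fun do rewrite cImD; exact: smoothD.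
Qed.

Lemma smCM E (f g : E -> C) : smC f -> smC g -> smC (fun p => f p * g p).
Proof.
move=> [f1 f2] [g1 g2]; split.
  under eq_fun do rewrite cReM; apply: smoothD; first exact: smoothM.
  by apply: smoothN; exact: smoothM.
under eq_fun do rewrite cImM.
by apply: smoothD; exact: smoothM.
Qed.

Lemma smCJ E (f : E -> C) : smC f -> smC (fun p => (f p)^*).
Proof.
move=> [f1 f2]; split; first by under eq_fun do rewrite cReJ.
by under eq_fun do rewrite cImJ; exact: smoothN.
Qed.

Lemma smC_sum E (I : finType) (f : I -> E -> C) :
  (forall i, smC (f i)) -> smC (fun p => \sum_i f i p).
Proof.
apply: (@sum_closed _ _ (fun f => smC f)) => [|g h]; first exact: smC_cst.
exact: smCD.
Qed.

Lemma isDC_cst E p w (c : C) : isDC p w (fun _ : E => c) 0.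
Proof. by split; exact: is_derive_cst. Qed.

Lemma isDCD E p w (f g : E -> C) df dg :
  isDC p w f df -> isDC p w g dg -> isDC p w (fun p => f p + g p) (df + dg).
Proof.
move=> [f1 f2] [g1 g2]; split.
  by rewrite cReD; under eq_fun do rewrite cReD; exact: is_deriveD.
by rewrite cImD; under eq_fun do rewrite cImD; exact: is_deriveD.
Qed.

Lemma isDCM E p w (f g : E -> C) df dg :
  isDC p w f df -> isDC p w g dg ->
  isDC p w (fun p => f p * g p) (df * g p + f p * dg).
Proof.
move=> [f1 f2] [g1 g2]; split.
  rewrite cReD !cReM; under eq_fun do rewrite cReM.
  apply: is_derive_eq.
  by rewrite /GRing.scale /=; ring.
rewrite cImD !cImM; under eq_fun do rewrite cImM.
apply: is_derive_eq.
by rewrite /GRing.scale /=; ring.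
Qed.

Lemma isDCJ E p w (f : E -> C) df : isDC p w f df -> isDC p w (fun p => (f p)^*) df^*.
Proof.
move=> [f1 f2]; split.
  by rewrite cReJ; under eq_fun do rewrite cReJ.
by rewrite cImJ; under eq_fun do rewrite cImJ; exact: is_deriveN.
Qed.

Lemma isDC_sum E p w (I : finType) (f : I -> E -> C) df :
  (forall i, isDC p w (f i) (df i)) -> isDC p w (fun p => \sum_i f i p) (\sum_i df i).
Proof.
move=> H; elim: (index_enum I) => [|i s IH].
  by rewrite big_nil; under eq_fun do rewrite big_nil; exact: isDC_cst.
by rewrite big_cons; under eq_fun do rewrite big_cons; exact: isDCD.
Qed.

Lemma isDC_uniq E p w (f : E -> C) a b : isDC p w f a -> isDC p w f b -> a = b.
Proof.
move=> [a1 a2] [b1 b2]; apply/eqP; rewrite eq_complex.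
by rewrite (is_derive_uniq a1 b1) (is_derive_uniq a2 b2) !eqxx.
Qed.

Definition smM E m n (A : E -> 'M[C]_(m, n)) : Prop :=
  forall i j, smC (fun p => A p i j).

Definition isDM E (p w : E) m n (A : E -> 'M[C]_(m, n)) (dA : 'M[C]_(m, n)) : Prop :=
  forall i j, isDC p w (fun q => A q i j) (dA i j).

Section Rules.
Context {E : normedModType R}.

Lemma smM_cst m n (A : 'M[C]_(m, n)) : smM (fun _ : E => A).
Proof. by move=> i j; exact: smC_cst. Qed.

Lemma smMD m n (A B : E -> 'M[C]_(m, n)) : smM A -> smM B -> smM (fun p => A p + B p).
Proof. by move=> sA sB i j; under eq_fun do rewrite mxE; exact: smCD. Qed.

Lemma smMZ m n (c : E -> C) (A : E -> 'M[C]_(m, n)) :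
  smC c -> smM A -> smM (fun p => c p *: A p).
Proof. by move=> sc sA i j; under eq_fun do rewrite mxE; exact: smCM. Qed.

Lemma smMZc m n (c : C) (A : E -> 'M[C]_(m, n)) : smM A -> smM (fun p => c *: A p).
Proof. by apply: smMZ; exact: smC_cst. Qed.

Lemma smMN m n (A : E -> 'M[C]_(m, n)) : smM A -> smM (fun p => - A p).
Proof. by move=> sA; under eq_fun do rewrite -scaleN1r; exact: smMZc. Qed.

Lemma smMB m n (A B : E -> 'M[C]_(m, n)) : smM A -> smM B -> smM (fun p => A p - B p).
Proof. by move=> sA sB; apply: smMD => //; exact: smMN. Qed.

Lemma smMM m n k (A : E -> 'M[C]_(m, n)) (B : E -> 'M[C]_(n, k)) :
  smM A -> smM B -> smM (fun p => A p *m B p).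
Proof.
move=> sA sB i j; under eq_fun do rewrite mxE.
by apply: smC_sum => l; exact: smCM.
Qed.

Lemma smMJ m n (A : E -> 'M[C]_(m, n)) : smM A -> smM (fun p => (A p)^t*).
Proof.
by move=> sA i j; under eq_fun do rewrite !mxE; exact: smCJ.
Qed.

Lemma smC_tr n (A : E -> 'M[C]_n) : smM A -> smC (fun p => \tr (A p)).
Proof. by move=> sA; apply: smC_sum. Qed.

Context (p w : E).

Lemma isDM_cst m n (A : 'M[C]_(m, n)) : isDM p w (fun _ : E => A) 0.
Proof. by move=> i j; rewrite mxE; exact: isDC_cst. Qed.

Lemma isDMD m n (A B : E -> 'M[C]_(m, n)) dA dB :
  isDM p w A dA -> isDM p w B dB -> isDM p w (fun p => A p + B p) (dA + dB).
Proof. by move=> sA sB i j; rewrite mxE; under eq_fun do rewrite mxE; exact: isDCD. Qed.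

Lemma isDMZc m n (c : C) (A : E -> 'M[C]_(m, n)) dA :
  isDM p w A dA -> isDM p w (fun p => c *: A p) (c *: dA).
Proof.
move=> sA i j; rewrite mxE; under eq_fun do rewrite mxE.
by rewrite -[X in isDC _ _ _ X]add0r -(mul0r (A p i j)); apply: isDCM => //; exact: isDC_cst.
Qed.

Lemma isDMN m n (A : E -> 'M[C]_(m, n)) dA :
  isDM p w A dA -> isDM p w (fun p => - A p) (- dA).
Proof.
by move=> sA; rewrite -scaleN1r; under eq_fun do rewrite -scaleN1r; exact: isDMZc.
Qed.

Lemma isDMB m n (A B : E -> 'M[C]_(m, n)) dA dB :
  isDM p w A dA -> isDM p w B dB -> isDM p w (fun p => A p - B p) (dA - dB).
Proof. by move=> sA sB; apply: isDMD => //; exact: isDMN. Qed.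

Lemma isDMM m n k (A : E -> 'M[C]_(m, n)) (B : E -> 'M[C]_(n, k)) dA dB :
  isDM p w A dA -> isDM p w B dB ->
  isDM p w (fun p => A p *m B p) (dA *m B p + A p *m dB).
Proof.
move=> sA sB i j; under eq_fun do rewrite mxE.
rewrite !mxE -big_split /=.
by apply: isDC_sum => l; exact: isDCM.
Qed.

Lemma isDMJ m n (A : E -> 'M[C]_(m, n)) dA : isDM p w A dA -> isDM p w (fun p => (A p)^t*) (dA^t*).
Proof.
by move=> sA i j; rewrite !mxE; under eq_fun do rewrite !mxE; exact: isDCJ.
Qed.

Lemma isDC_tr n (A : E -> 'M[C]_n) dA :
  isDM p w A dA -> isDC p w (fun p => \tr (A p)) (\tr dA).
Proof. by move=> sA; apply: isDC_sum. Qed.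

Lemma isDM_uniq m n (A : E -> 'M[C]_(m, n)) dA dB :
  isDM p w A dA -> isDM p w A dB -> dA = dB.
Proof. by move=> a b; apply/matrixP => i j; exact: isDC_uniq (a i j) (b i j). Qed.

End Rules.

Section Pairs.
Context {n : nat} {E : normedModType R}.
Notation RM := ('M[R]_n.+1 * 'M[R]_n.+1)%type.
Notation TM := (RM * RM)%type.

Lemma cplxK : cancel (@reim R n) cplx.
Proof. by move=> A; apply/matrixP => i j; rewrite !mxE; case: (A i j). Qed.

Lemma reimK : cancel (@cplx R n) reim.
Proof. by case=> A B; congr (_, _); apply/matrixP => i j; rewrite !mxE. Qed.

Lemma cplxP (k : R) (A B : RM) : cplx (k *: A + B) = k%:C *: cplx A + cplx B.
Proof.
apply/matrixP => i j; rewrite !mxE; apply/eqP.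
by rewrite eq_complex cReD cImD Re_rM Im_rM /= !eqxx.
Qed.

Lemma reimP (k : R) (A B : 'M[C]_n.+1) : reim (k%:C *: A + B) = k *: reim A + reim B.
Proof. by apply: (can_inj reimK); rewrite cplxP !cplxK. Qed.

Lemma RM_cont : all_linear_continuous (RM : normedModType R).
Proof. by apply: all_linear_continuous_prod; exact: all_linear_continuous_mx. Qed.

Lemma TM_cont : all_linear_continuous (TM : normedModType R).
Proof. by apply: all_linear_continuous_prod; exact: RM_cont. Qed.

Lemma smM_cplx (f : E -> RM) : smooth f -> smM (fun p => cplx (f p)).
Proof.
move=> sf i j; split; under eq_fun do rewrite mxE /=.
  apply: (@smooth_comp_lin _ _ _ R^o (fun A : RM => A.1 i j)) => //; first exact: RM_cont.
  by move=> k x y /=; rewrite !mxE.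
apply: (@smooth_comp_lin _ _ _ R^o (fun A : RM => A.2 i j)) => //; first exact: RM_cont.
by move=> k x y /=; rewrite !mxE.
Qed.

Lemma isDM_cplx (f : E -> RM) p w df :
  is_derive p w f df -> isDM p w (fun p => cplx (f p)) (cplx df).
Proof.
move=> sf i j; rewrite mxE; split; under eq_fun do rewrite mxE /=; rewrite /=.
  apply: (@is_derive_lin _ _ _ R^o (fun A : RM => A.1 i j)) => //.
    by move=> k x y /=; rewrite !mxE.
  apply: RM_cont; by move=> k x y /=; rewrite !mxE.
apply: (@is_derive_lin _ _ _ R^o (fun A : RM => A.2 i j)) => //.
  by move=> k x y /=; rewrite !mxE.
apply: RM_cont; by move=> k x y /=; rewrite !mxE.
Qed.

Lemma smooth_reim (A : E -> 'M[C]_n.+1) : smM A -> smooth (fun p => reim (A p)).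
Proof.
move=> sA; apply: smooth_pair; apply: smooth_mx => i j.
  by under eq_fun do rewrite mxE; case: (sA i j).
by under eq_fun do rewrite mxE; case: (sA i j).
Qed.

Lemma is_derive_reim (A : E -> 'M[C]_n.+1) p w dA :
  isDM p w A dA -> is_derive p w (fun p => reim (A p)) (reim dA).
Proof.
move=> sA; apply: is_derive_pair; apply: is_derive_mx => i j.
  by rewrite mxE; under eq_fun do rewrite mxE; case: (sA i j).
by rewrite mxE; under eq_fun do rewrite mxE; case: (sA i j).
Qed.

End Pairs.
End ComplexCalculus.

(** * Infinitesimal motions of a flag *)

Section MatrixTools.
Context {R : comPzRingType}.
Lemma mxD m n (A B : 'M[R]_(m, n)) i j : (A + B) i j = A i j + B i j.
Proof. by rewrite mxE. Qed.
Lemma mxN m n (A : 'M[R]_(m, n)) i j : (- A) i j = - A i j.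
Proof. by rewrite mxE. Qed.
Lemma mxZ m n (c : R) (A : 'M[R]_(m, n)) i j : (c *: A) i j = c * A i j.
Proof. by rewrite mxE. Qed.
Lemma mx0 m n i j : (0 : 'M[R]_(m, n)) i j = 0.
Proof. by rewrite mxE. Qed.
End MatrixTools.

(* Linear identities between matrices, their products being taken as atoms. *)
Ltac mxlin :=
  repeat match goal with |- context [@mulmx ?S ?a ?b ?c ?A ?B] =>
    move: (@mulmx S a b c A B) => ? end;
  apply/matrixP => ? ?; rewrite ?(mxD, mxN, mxZ, mx0); ring.
Ltac mxdist := rewrite ?(mulmxDl, mulmxDr, mulmxBl, mulmxBr, mulmxN, mulNmx, mulmx0, mul0mx, mulmx1, mul1mx) -?scalemxAl -?scalemxAr ?mulmxA.

Section Adjoint.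
Context {R : realType} {n : nat}.
Notation C := R[i].
Notation CM := 'M[C]_n.+1.
Implicit Types A B M P N : CM.

Definition skewherm A : Prop := A^t* = - A.
Definition selfadj A : Prop := A^t* = A.

Lemma ctD A B : (A + B)^t* = A^t* + B^t*.
Proof. by rewrite linearD map_mxD. Qed.
Lemma ctN A : (- A)^t* = - A^t*.
Proof. by rewrite linearN map_mxN. Qed.
Lemma ctB A B : (A - B)^t* = A^t* - B^t*.
Proof. by rewrite ctD ctN. Qed.
Lemma ctM A B : (A *m B)^t* = B^t* *m A^t*.
Proof. by rewrite trmx_mul map_mxM. Qed.
Lemma ctZ (c : C) A : (c *: A)^t* = c^* *: A^t*.
Proof. by rewrite linearZ map_mxZ. Qed.
Lemma ctK A : (A^t*)^t* = A.
Proof. by apply/matrixP => i j; rewrite !mxE; exact: conjCK. Qed.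
Lemma ct1 : (1%:M : CM)^t* = 1%:M.
Proof. by rewrite trmx1 map_mx1. Qed.
End Adjoint.

Section FlagAlgebra.
Context {R : realType} {n : nat}.
Notation CM := 'M[R[i]]_n.+1.
Implicit Types A B M P N : CM.

(** These relations hold for [P = E11] and [N = E12 + E21], hence along their
    orbit under unitary conjugation, and they suffice to find an infinitesimal motion
    with a prescribed velocity. *)
Definition flag P N : Prop :=
  [/\ selfadj P, selfadj N, P *m P = P, P *m N + N *m P = N & P *m (N *m N) = P].

Lemma commutatorE A B : commutator A B = A *m B - B *m A. Proof. by []. Qed.

Lemma commMr A B D : commutator A (B *m D) = commutator A B *m D + B *m commutator A D.
Proof. by rewrite !commutatorE; mxdist; mxlin. Qed.

Lemma commDr A B D : commutator A (B + D) = commutator A B + commutator A D.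
Proof. by rewrite !commutatorE; mxdist; mxlin. Qed.

Lemma commDl A B D : commutator (A + B) D = commutator A D + commutator B D.
Proof. by rewrite !commutatorE; mxdist; mxlin. Qed.

Lemma mulmx_pre A B M : A *m B = M -> forall D : CM, A *m (B *m D) = M *m D.
Proof. by move=> <- D; rewrite mulmxA. Qed.

Lemma mulmx_pre3 A B D M : A *m (B *m D) = M -> forall F : CM, A *m (B *m (D *m F)) = M *m F.
Proof. by move=> <- F; rewrite !mulmxA. Qed.

Section Rel.
Context (P N : CM) (fl : flag P N).

Lemma flagPP : P *m P = P. Proof. by case: fl. Qed.
Lemma flagPNN : P *m (N *m N) = P. Proof. by case: fl. Qed.
Lemma flagN : N = P *m N + N *m P. Proof. by case: fl. Qed.

(** Multiply [N = P N + N P] on the left by [P]. *)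
Lemma flagPNP : P *m (N *m P) = 0.
Proof.
have : P *m N = P *m (P *m N + N *m P) by rewrite -flagN.
rewrite mulmxDr (mulmx_pre flagPP) => /eqP.
by rewrite -subr_eq0 opprD addrA subrr add0r oppr_eq0 => /eqP.
Qed.

(** Expand the left factor [N] as [P N + N P]; the second term is killed by
    [P N P = 0], and the first one is [P N N P]. *)
Lemma flagNNP : N *m (N *m P) = P.
Proof.
rewrite {1}flagN mulmxDl -!mulmxA flagPNP mulmx0 addr0.
by rewrite (mulmx_pre3 flagPNN) flagPP.
Qed.

Section LiftHalf.
Context (M : CM) (HM : M = P *m M + M *m P).
Context (HMN : P *m (M *m N) = - (P *m (N *m M))).

(** A solution [L] of [[L, P] = 0] and [[L, N] = M] that is polynomial in [P], [N]
    and [M]. *)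
Definition lift_half := M *m (P *m N) - N *m (P *m M) - N *m (P *m (N *m (M *m (P *m N)))).

Lemma offdiagPP : P *m (M *m P) = 0.
Proof.
have : P *m M = P *m (P *m M + M *m P) by rewrite -HM.
rewrite mulmxDr (mulmx_pre flagPP) => /eqP.
by rewrite -subr_eq0 opprD addrA subrr add0r oppr_eq0 => /eqP.
Qed.

Lemma offdiagNP : N *m (M *m P) = P *m (N *m (M *m P)).
Proof. by rewrite {1}flagN mulmxDl -!mulmxA offdiagPP mulmx0 addr0. Qed.

Lemma offdiagPN : P *m (N *m M) = P *m (N *m (M *m P)).
Proof. by rewrite {1}HM !mulmxDr (mulmx_pre3 flagPNP) mul0mx add0r. Qed.

Lemma lift_halfP : commutator lift_half P = 0.
Proof.
rewrite commutatorE /lift_half !mulmxBl !mulmxBr -!mulmxA flagPNP offdiagPP.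
rewrite (mulmx_pre3 offdiagPP) !(mulmx_pre3 flagPNP).
by rewrite !(mulmx0, mul0mx, subr0).
Qed.

Lemma lift_halfN : commutator lift_half N = M.
Proof.
rewrite commutatorE /lift_half !mulmxBl !mulmxBr -!mulmxA flagPNN !(mulmx_pre3 flagNNP).
rewrite HMN !(mulmxN, mulNmx, opprK).
rewrite offdiagPN -offdiagNP.
have -> : N *m (M *m (P *m N)) = P *m (N *m (M *m (P *m N))).
  by have /(congr1 (fun M => M *m N)) := offdiagNP; rewrite -!mulmxA.
rewrite [in RHS]HM.
rewrite (mulmx_pre flagPP); mxlin.
Qed.

Lemma lift_half_skew : selfadj M -> skewherm lift_half.
Proof.
have [hP hN _ _ _] := fl => hM.
rewrite /skewherm /lift_half !ctB !ctM hM hP hN -!mulmxA.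
rewrite (mulmx_pre3 HMN) !(mulmxN, mulNmx) -!mulmxA.
mxlin.
Qed.

End LiftHalf.

(** The equations of [flag], differentiated. *)
Definition flag_tangent (dP dN : CM) : Prop :=
  [/\ selfadj dP, selfadj dN, dP = dP *m P + P *m dP,
     dN = dP *m N + P *m dN + (dN *m P + N *m dP) &
     dP *m (N *m N) + P *m (dN *m N + N *m dN) = dP].

(** First move [P], by [[dP, P]]; then correct the velocity of [N] by a motion that
    fixes [P]. *)
Definition flaglift (dP dN : CM) : CM :=
  let A1 := commutator dP P in A1 + lift_half (dN - commutator A1 N).

Section Lift.
Context (dP dN : CM) (ft : flag_tangent dP dN).
Local Notation A1 := (commutator dP P).
Local Notation N1 := (dN - commutator A1 N).

Lemma tangentPdPP : P *m (dP *m P) = 0.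
Proof. by have [_ _ H _ _] := ft; apply: offdiagPP; rewrite addrC. Qed.

(** Since [P dP P = 0], the double bracket [[[dP, P], P]] is [dP P + P dP = dP]. *)
Lemma lift1P : commutator A1 P = dP.
Proof.
have [_ _ H _ _] := ft.
rewrite commutatorE [A1]commutatorE mulmxBl mulmxBr -!mulmxA flagPP tangentPdPP.
by rewrite (mulmx_pre flagPP) subr0 sub0r opprK -H.
Qed.

Lemma lift2P : N1 = P *m N1 + N1 *m P.
Proof.
have [_ _ _ H _] := ft.
have H1 A : commutator A N = commutator A P *m N + P *m commutator A N
      + (commutator A N *m P + N *m commutator A P).
  by rewrite -!commMr -commDr -flagN.
move: (H1 A1) H; rewrite lift1P; move: (commutator A1 N) => U {}H1 H.
have -> : P *m (dN - U) + (dN - U) *m P = P *m dN + dN *m P - (P *m U + U *m P).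
  by mxdist; mxlin.
by rewrite {1}H1 {1}H; mxlin.
Qed.

Lemma lift2PNN : P *m (N1 *m N) = - (P *m (N *m N1)).
Proof.
have [_ _ _ _ H] := ft.
have H1 A : commutator A P *m (N *m N) + P *m (commutator A N *m N + N *m commutator A N) = commutator A P.
  by rewrite -!commMr flagPNN.
move: (H1 A1) H; rewrite lift1P; move: (commutator A1 N) => U {}H1 H.
apply/eqP; rewrite -subr_eq0 opprK; apply/eqP.
have -> : P *m ((dN - U) *m N) + P *m (N *m (dN - U)) =
  (dP *m (N *m N) + P *m (dN *m N + N *m dN)) - (dP *m (N *m N) + P *m (U *m N + N *m U)).
  by mxdist; mxlin.
by rewrite H H1 subrr.
Qed.

Lemma flagliftP : commutator (flaglift dP dN) P = dP.
Proof. by rewrite /flaglift commDl lift1P lift_halfP ?addr0 //; exact: lift2P. Qed.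

Lemma flagliftN : commutator (flaglift dP dN) N = dN.
Proof.
rewrite /flaglift commDl lift_halfN; [|exact: lift2P|exact: lift2PNN].
by rewrite addrCA subrr addr0.
Qed.

Lemma flaglift_skew : skewherm (flaglift dP dN).
Proof.
have [hP hN _ _ _] := fl.
have [hdP hdN _ _ _] := ft.
have sA1 : A1^t* = - A1 by rewrite commutatorE ctB !ctM hP hdP opprB.
have s2 : skewherm (lift_half N1).
  apply: lift_half_skew; first exact: lift2PNN.
  rewrite /selfadj ctB hdN; congr (_ - _).
  by rewrite !(commutatorE _ N) ctB !ctM hN sA1 mulmxN mulNmx opprK addrC.
exact: etrans (ctD _ _) (etrans (f_equal2 +%R sA1 s2) (esym (opprD _ _))).
Qed.

End Lift.

End Rel.

End FlagAlgebra.

(** * Unitary conjugation *)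

Section Unitary.
Context {R : realType} {n : nat}.
Notation C := R[i].
Notation CM := 'M[C]_n.+1.
Implicit Types A B M : CM.

Definition cj (a A : CM) : CM := a *m A *m a^t*.

Lemma commZr (c : C) A B : commutator A (c *: B) = c *: commutator A B.
Proof. by rewrite !commutatorE -scalemxAl -scalemxAr scalerBr. Qed.
Lemma commZl (c : C) A B : commutator (c *: A) B = c *: commutator A B.
Proof. by rewrite !commutatorE -scalemxAl -scalemxAr scalerBr. Qed.
Lemma commNr A B : commutator A (- B) = - commutator A B.
Proof. by rewrite -scaleN1r commZr scaleN1r. Qed.
Lemma commNl A B : commutator (- A) B = - commutator A B.
Proof. by rewrite -scaleN1r commZl scaleN1r. Qed.
Lemma commBl A B M : commutator (A - B) M = commutator A M - commutator B M.
Proof. by rewrite commDl commNl. Qed.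
Lemma commC A B : commutator A B = - commutator B A.
Proof. by rewrite !commutatorE opprB. Qed.
Lemma comm_skew A B : skewherm A -> skewherm B -> skewherm (commutator A B).
Proof. by move=> hA hB; rewrite /skewherm !commutatorE ctB !ctM hA hB !mulNmx !mulmxN !opprK opprB. Qed.
Lemma jacobi A B M : commutator (commutator A B) M = commutator A (commutator B M) - commutator B (commutator A M).
Proof. by rewrite !commutatorE; mxdist; mxlin. Qed.

Lemma skewD A B : skewherm A -> skewherm B -> skewherm (A + B).
Proof. by move=> hA hB; rewrite /skewherm ctD hA hB opprD. Qed.
Lemma skewN A : skewherm A -> skewherm (- A).
Proof. by move=> hA; rewrite /skewherm ctN hA. Qed.
Lemma skewZ (k : R) A : skewherm A -> skewherm (k%:C *: A).
Proof. by move=> hA; rewrite /skewherm ctZ hA scalerN; congr (- (_ *: _)); exact: conjc_real. Qed.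

Lemma cjD a A B : cj a (A + B) = cj a A + cj a B.
Proof. by rewrite /cj mulmxDr mulmxDl. Qed.
Lemma cjZ a (c : C) A : cj a (c *: A) = c *: cj a A.
Proof. by rewrite /cj -scalemxAr -scalemxAl. Qed.
Lemma cjN a A : cj a (- A) = - cj a A.
Proof. by rewrite -scaleN1r cjZ scaleN1r. Qed.
Lemma cj_adj a A : (cj a A)^t* = cj a (A^t*).
Proof. by rewrite /cj !ctM ctK mulmxA. Qed.
Lemma cj1 A : cj 1%:M A = A.
Proof. by rewrite /cj mul1mx ct1 mulmx1. Qed.
Lemma cjM a b A : cj (a *m b) A = cj a (cj b A).
Proof. by rewrite /cj ctM !mulmxA. Qed.
Lemma cj_skew a A : skewherm A -> skewherm (cj a A).
Proof. by move=> hA; rewrite /skewherm cj_adj hA cjN. Qed.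

Section ConjUnitary.
Context (a : CM) (ua : a \is unitarymx).

Lemma unitaryV : a *m a^t* = 1%:M. Proof. exact/unitarymxP. Qed.
Lemma unitaryVl : a^t* *m a = 1%:M. Proof. exact/mulmx1C/unitaryV. Qed.
Lemma cj_mul A B : cj a (A *m B) = cj a A *m cj a B.
Proof.
by rewrite /cj -!mulmxA [a^t* *m (a *m _)]mulmxA unitaryVl mul1mx.
Qed.
Lemma cj_id : cj a 1%:M = 1%:M.
Proof. by rewrite /cj mulmx1 unitaryV. Qed.
Lemma cj_comm A B : cj a (commutator A B) = commutator (cj a A) (cj a B).
Proof. by rewrite !commutatorE cjD cjN !cj_mul. Qed.
Lemma cj_tr A : \tr (cj a A) = \tr A.
Proof. by rewrite /cj mxtrace_mulC mulmxA unitaryVl mul1mx. Qed.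
Lemma adj_unitary : a^t* \is unitarymx.
Proof. by rewrite trmxC_unitary. Qed.
Lemma cjK : cancel (cj (a^t*)) (cj a).
Proof. by move=> A; rewrite -cjM unitaryV cj1. Qed.
Lemma cjVK : cancel (cj a) (cj (a^t*)).
Proof. by move=> A; rewrite -cjM unitaryVl cj1. Qed.
End ConjUnitary.

(** Scalars of modulus one act trivially by conjugation, and have roots of
    order [n + 1]; so the unitary group has the same orbits as [SU]. *)
Lemma unitary_rescale (a : CM) : a \is unitarymx ->
  exists b : CM, SU b /\ forall A, cj b A = cj a A.
Proof.
move=> ua.
have dd : \det a * (\det a)^* = 1.
  have := congr1 determinant (unitaryV ua).
  by rewrite det_mulmx det1 det_map_mx det_tr.
(* Multiplying [a] by [l] multiplies its determinant by [l ^ (n + 1)]. *)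
pose l := (n.+1).-root ((\det a)^*).
have ln : l ^+ n.+1 = (\det a)^* by rewrite rootCK.
have ll : l * l^* = 1.
  have H : (l * l^*) ^+ n.+1 = 1.
    rewrite exprMn ln.
    have -> : (l^*) ^+ n.+1 = (l ^+ n.+1)^* by rewrite rmorphXn.
    by rewrite ln conjcK mulrC.
  by apply/eqP; rewrite -(@pexpr_eq1 _ _ n.+1) ?H ?eqxx //; exact: mulcJ_ge0.
exists (l *: a); split.
  split.
    apply/unitarymxP; rewrite ctZ -scalemxAl -scalemxAr scalerA unitaryV //.
    by rewrite [X in X *: _]ll scale1r.
  by rewrite detZ ln mulrC.
by move=> A; rewrite /cj ctZ -!scalemxAl -scalemxAr scalerA [X in X *: _]ll scale1r.
Qed.

(** The one-parameter group [exp (tA)], obtained from the diagonalisation of [A],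
    whose eigenvalues are imaginary. *)
Lemma unitary_curve A : skewherm A -> exists c : R -> CM,
  [/\ forall t, c t \is unitarymx, c 0 = 1%:M & isDM (0 : R) (1 : R) c A].
Proof.
move=> sA.
have nA : A \is normalmx.
  by apply/normalmxP; rewrite sA mulmxN mulNmx.
have /orthomx_spectralP := nA.
set U := spectralmx A; set d := spectral_diag A.
have uU : U \is unitarymx by exact: spectral_unitarymx.
rewrite invmx_unitary // => AE.
have dE : diag_mx d = cj U A.
  by rewrite AE /cj !mulmxA unitaryV // mul1mx -mulmxA unitaryV // mulmx1.
have dre i : complex.Re (d 0 i) = 0.
  have : (diag_mx d)^t* = - diag_mx d by rewrite dE cj_adj sA cjN.
  move/matrixP/(_ i i); rewrite !mxE eqxx mulr1n => /(congr1 (@complex.Re R)).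
  by rewrite cReJ cReN => /eqP; rewrite -addr_eq0 -mulr2n mulrn_eq0 /= => /eqP.
pose th i := complex.Im (d 0 i).
(* The diagonal of [exp (t d)], where [d = i th]. *)
pose e (t : R) : 'rV[C]_n.+1 := \row_i (cos (th i * t) +i* sin (th i * t)).
exists (fun t => U^t* *m diag_mx (e t) *m U); split.
- move=> t.
  have uD : diag_mx (e t) \is unitarymx.
    apply/unitarymxP; rewrite tr_diag_mx map_diag_mx mulmx_diag -[RHS]diag_const_mx.
    congr diag_mx; apply/matrixP => i j; rewrite !mxE; apply/eqP; rewrite eq_complex /=.
    by apply/andP; split; apply/eqP; have := cos2Dsin2 (th j * t); nra.
  exact: (mul_unitarymx (mul_unitarymx (adj_unitary uU) uD) uU).
- have -> : e 0 = const_mx 1.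
    by apply/matrixP => i j; rewrite !mxE mulr0 cos0 sin0.
  by rewrite diag_const_mx mulmx1 unitaryVl.
- have -> : A = 0 *m diag_mx (e 0) *m U + U^t* *m diag_mx d *m U.
    by rewrite !mul0mx add0r.
  have D : isDM (0 : R) (1 : R) (fun t => diag_mx (e t)) (diag_mx d).
    move=> i j; under eq_fun do rewrite !mxE; rewrite !mxE.
    have [->|ij] := eqVneq i j; last first.
      by under eq_fun do rewrite mulr0n; rewrite mulr0n; exact: isDC_cst.
    under eq_fun do rewrite mulr1n; rewrite mulr1n.
    split; rewrite ?dre /=.
      apply: is_derive_eq; rewrite mulr0 sin0 oppr0.
      by rewrite mul0r.
    apply: is_derive_eq; rewrite mulr0 cos0.
    by rewrite /GRing.scale /= mulr1 mul1r.
  have := isDMM (isDMM (isDM_cst (0 : R) (1 : R) (U^t*)) D) (isDM_cst (0 : R) (1 : R) U).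
  by rewrite mulmx0 addr0 mulmxDl.
Qed.

End Unitary.

(** * The manifold and its tangent vectors *)

Lemma addrBACA (V : zmodType) (x y z t : V) : x + y - (z + t) = x - z + (y - t).
Proof. by rewrite opprD addrACA. Qed.

Section Manifold.
Context {R : realType} {n : nat}.
Notation C := R[i].
Notation CM := 'M[C]_n.+1.
Notation RM := ('M[R]_n.+1 * 'M[R]_n.+1)%type.
Notation TM := (RM * RM)%type.
Implicit Types (A B M : CM) (p u v w : TM).

Lemma rcM (a b : R) : (a * b)%:C = a%:C * b%:C. Proof. exact: rmorphM. Qed.

Section Points.
Context (r : R).

Definition Pm p : CM := cplx p.1.
(** At [oH r] the tangent vector is [- (r / 2) (E12 + E21)]; the factor makes [N]
    independent of [r]. *)
Definition Nm p : CM := (- (2 / r))%:C *: cplx p.2.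

Lemma PmP (k : R) u v : Pm (k *: u + v) = k%:C *: Pm u + Pm v.
Proof. exact: cplxP. Qed.

Lemma NmP (k : R) u v : Nm (k *: u + v) = k%:C *: Nm u + Nm v.
Proof. by rewrite /Nm cplxP scalerDr !scalerA mulrC. Qed.

Lemma PmD u v : Pm (u + v) = Pm u + Pm v.
Proof. by rewrite -[u in LHS]scale1r PmP scale1r. Qed.
Lemma NmD u v : Nm (u + v) = Nm u + Nm v.
Proof. by rewrite -[u in LHS]scale1r NmP scale1r. Qed.
Lemma Pm0 : Pm 0 = 0.
Proof. by apply: (addrI (Pm 0)); rewrite -PmD !addr0. Qed.
Lemma Nm0 : Nm 0 = 0.
Proof. by apply: (addrI (Nm 0)); rewrite -NmD !addr0. Qed.
Lemma PmZ (k : R) u : Pm (k *: u) = k%:C *: Pm u.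
Proof. by rewrite -[k *: u]addr0 PmP Pm0 addr0. Qed.
Lemma NmZ (k : R) u : Nm (k *: u) = k%:C *: Nm u.
Proof. by rewrite -[k *: u]addr0 NmP Nm0 addr0. Qed.

Lemma Pm_inf_act A p : Pm (inf_act A p) = commutator A (Pm p).
Proof. by rewrite /Pm cplxK. Qed.

Lemma Nm_inf_act A p : Nm (inf_act A p) = commutator A (Nm p).
Proof. by rewrite /Nm cplxK commZr. Qed.

Lemma Pm_act a p : Pm (act a p) = cj a (Pm p).
Proof. by rewrite /Pm cplxK. Qed.

Lemma Nm_act a p : Nm (act a p) = cj a (Nm p).
Proof. by rewrite /Nm cplxK -cjZ. Qed.

Hypothesis hr : 0 < r.

Lemma PNm_inj u v : Pm u = Pm v -> Nm u = Nm v -> u = v.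
Proof.
case: u v => [u1 u2] [v1 v2]; rewrite /Pm /Nm /= => /(can_inj reimK) -> H.
congr (_, _); apply: (can_inj reimK); apply: scalerI H.
by rewrite eq_complex /= eqxx andbT oppr_eq0; apply: mulf_neq0; rewrite ?pnatr_eq0 // invr_eq0 lt0r_neq0.
Qed.

Lemma inf_actD A B p : inf_act (A + B) p = inf_act A p + inf_act B p.
Proof.
by apply: PNm_inj; rewrite (PmD, NmD) !(Pm_inf_act, Nm_inf_act) commDl.
Qed.

Lemma inf_actZ (k : R) A p : inf_act (k%:C *: A) p = k *: inf_act A p.
Proof.
by apply: PNm_inj; rewrite (PmZ, NmZ) !(Pm_inf_act, Nm_inf_act) commZl.
Qed.

Lemma inf_actN A p : inf_act (- A) p = - inf_act A p.
Proof.
have -> : - A = (- 1)%:C *: A by rewrite -scaleN1r; congr (_ *: _); rewrite rmorphN1.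
by rewrite inf_actZ scaleN1r.
Qed.

Lemma inf_actB A B p : inf_act (A - B) p = inf_act A p - inf_act B p.
Proof. by rewrite inf_actD inf_actN. Qed.

Lemma inf_act_linr A : linear (inf_act A : TM -> TM).
Proof.
move=> k u v; apply: PNm_inj.
  apply: (etrans (Pm_inf_act A _)); apply: (etrans (congr1 _ (PmP k u v))).
  apply: esym; apply: (etrans (PmP k _ _)); rewrite commDr commZr.
  by congr (_ *: _ + _); exact: Pm_inf_act.
apply: (etrans (Nm_inf_act A _)); apply: (etrans (congr1 _ (NmP k u v))).
apply: esym; apply: (etrans (NmP k _ _)); rewrite commDr commZr.
by congr (_ *: _ + _); exact: Nm_inf_act.
Qed.

Lemma act_lin a : linear (act a : TM -> TM).
Proof.
move=> k u v; apply: PNm_inj.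
  apply: (etrans (Pm_act a _)); apply: (etrans (congr1 _ (PmP k u v))).
  apply: esym; apply: (etrans (PmP k _ _)); rewrite cjD cjZ.
  by congr (_ *: _ + _); exact: Pm_act.
apply: (etrans (Nm_act a _)); apply: (etrans (congr1 _ (NmP k u v))).
apply: esym; apply: (etrans (NmP k _ _)); rewrite cjD cjZ.
by congr (_ *: _ + _); exact: Nm_act.
Qed.

Lemma act_inf_act a A p : a \is unitarymx -> act a (inf_act A p) = inf_act (cj a A) (act a p).
Proof.
move=> ua; apply: PNm_inj.
  by rewrite Pm_act !Pm_inf_act Pm_act cj_comm.
by rewrite Nm_act !Nm_inf_act Nm_act cj_comm.
Qed.

Lemma act_mul a b p : act a (act b p) = act (a *m b) p.
Proof.
apply: PNm_inj.
  by apply: (etrans (Pm_act a _)); apply: (etrans (congr1 _ (Pm_act b p))); rewrite -cjM -Pm_act.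
by apply: (etrans (Nm_act a _)); apply: (etrans (congr1 _ (Nm_act b p))); rewrite -cjM -Nm_act.
Qed.

Lemma act1 p : act 1%:M p = p.
Proof.
by apply: PNm_inj; [rewrite [LHS]Pm_act|rewrite [LHS]Nm_act]; rewrite cj1.
Qed.

Lemma inf_actP A p w : inf_act A p = w <->
  commutator A (Pm p) = Pm w /\ commutator A (Nm p) = Nm w.
Proof.
split=> [<-|[h1 h2]]; first by rewrite Pm_inf_act Nm_inf_act.
by apply: PNm_inj; rewrite ?Pm_inf_act ?Nm_inf_act.
Qed.

Lemma act_SU a : a \is unitarymx -> exists2 b : CM, SU b & forall p, act b p = act a p.
Proof.
move=> ua; have [b [sb hb]] := unitary_rescale ua; exists b; first exact: sb.
move=> p.
by apply: PNm_inj; [rewrite [LHS]Pm_act [RHS]Pm_act|rewrite [LHS]Nm_act [RHS]Nm_act]; rewrite hb.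
Qed.

Local Notation S := (@TrCP R n r).

Lemma TrCP_unitary p : S p <-> exists2 a : CM, a \is unitarymx & p = act a (oH r).
Proof.
split=> [[a [ua _] ->]|[a ua ->]]; first by exists a.
by have [b sb <-] := act_SU ua; exists b.
Qed.

Lemma TrCP_act a p : a \is unitarymx -> S p -> S (act a p).
Proof.
move=> ua /TrCP_unitary [b ub ->]; apply/TrCP_unitary; exists (a *m b).
  exact: mul_unitarymx.
by rewrite act_mul.
Qed.

Lemma TrCP_oH : S (oH r).
Proof.
apply/TrCP_unitary; exists 1%:M; last by rewrite act1.
by apply/unitarymxP; rewrite ct1 mulmx1.
Qed.

Hypothesis hn : (1 <= n)%N.

Lemma neq01 : ((inord 0 : 'I_n.+1) == inord 1) = false.
Proof. by apply/negbTE; rewrite -val_eqE /= !inordK. Qed.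
Lemma neq10 : ((inord 1 : 'I_n.+1) == inord 0) = false.
Proof. by rewrite eq_sym neq01. Qed.

Lemma ctE a b : (E_ a b : CM)^t* = E_ b a.
Proof.
apply/matrixP => i j; rewrite !mxE andbC; case: (_ && _); [exact: rmorph1|exact: rmorph0].
Qed.

Lemma mulEE a b c d : (E_ a b : CM) *m E_ c d =
  if (inord b.-1 : 'I_n.+1) == inord c.-1 then E_ a d else 0.
Proof. by rewrite /E_ mul_delta_mx_cond; case: eqP. Qed.

Lemma flag_E : flag (E_ 1 1 : CM) (E_ 1 2 + E_ 2 1).
Proof.
have e11 : (E_ 1 1 : CM) *m E_ 1 1 = E_ 1 1 by rewrite mulEE /= eqxx.
have e112 : (E_ 1 1 : CM) *m E_ 1 2 = E_ 1 2 by rewrite mulEE /= eqxx.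
have e121 : (E_ 1 1 : CM) *m E_ 2 1 = 0 by rewrite mulEE /= neq01.
have e1211 : (E_ 1 2 : CM) *m E_ 1 1 = 0 by rewrite mulEE /= neq10.
have e2111 : (E_ 2 1 : CM) *m E_ 1 1 = E_ 2 1 by rewrite mulEE /= eqxx.
have e1212 : (E_ 1 2 : CM) *m E_ 1 2 = 0 by rewrite mulEE /= neq10.
have e1221 : (E_ 1 2 : CM) *m E_ 2 1 = E_ 1 1 by rewrite mulEE /= eqxx.
split.
- exact: ctE.
- by rewrite /selfadj ctD !ctE addrC.
- by [].
- by rewrite mulmxDr mulmxDl e112 e121 e1211 e2111 addr0 add0r.
- by rewrite mulmxA (mulmxDr (E_ 1 1)) e112 e121 addr0 mulmxDr e1212 e1221 add0r.
Qed.

Lemma Pm_oH : Pm (oH r) = E_ 1 1.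
Proof. exact: cplxK. Qed.

Lemma Nm_oH : Nm (oH r) = E_ 1 2 + E_ 2 1.
Proof.
have -> : Nm (oH r) = (- (2 / r))%:C *: (r%:C *: commutator X (E_ 1 1)).
  by congr (_ *: _); exact: cplxK.
rewrite scalerA -rcM mulNr divfK ?gt_eqF // /X commZl commBl !commutatorE !mulEE /= ?eqxx neq01 neq10.
rewrite sub0r subr0 -opprD !scalerN scalerA -scaleNr.
rewrite -[RHS]scale1r; congr (_ *: _).
by rewrite rmorphN mulNr opprK /= rmorph_nat mulfV ?pnatr_eq0.
Qed.

Lemma flag_TrCP p : S p -> flag (Pm p) (Nm p).
Proof.
move=> /TrCP_unitary [a ua ->]; rewrite Pm_act Nm_act Pm_oH Nm_oH.
have [h1 h2 h3 h4 h5] := flag_E.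
split.
- by rewrite /selfadj cj_adj h1.
- by rewrite /selfadj cj_adj h2.
- exact: (etrans (esym (cj_mul ua _ _)) (congr1 (cj a) h3)).
- by rewrite -!cj_mul // -cjD h4.
- apply: (etrans (congr1 (mulmx _) (esym (cj_mul ua _ _)))).
  exact: (etrans (esym (cj_mul ua _ _)) (congr1 (cj a) h5)).
Qed.

(** The one-parameter group of [A] moves [p] with this velocity. *)
Lemma tangent_inf_act p A : S p -> skewherm A -> tangent S p (inf_act A p).
Proof.
move=> Sp sA; have [c [uc c0 dc]] := unitary_curve sA.
have D M : isDM (0 : R) (1 : R) (fun t => c t *m M *m (c t)^t*) (commutator A M).
  have := isDMM (isDMM dc (isDM_cst _ _ M)) (isDMJ dc).
  rewrite c0 ct1 mulmx0 addr0 mulmx1 mul1mx sA mulmxN.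
  exact.
exists (fun t => act (c t) p); split.
- by move=> t; exact: TrCP_act.
- by rewrite c0 act1.
- by apply: is_derive_pair; apply: is_derive_reim; exact: D.
Qed.

(** The relations [flag] hold along every curve in the manifold. *)
Lemma flag_tangent_TrCP p w : S p -> tangent S p w ->
  flag_tangent (Pm p) (Nm p) (Pm w) (Nm w).
Proof.
move=> Sp [c [Sc c0 dc]].
have fl t : flag (Pm (c t)) (Nm (c t)) by exact/flag_TrCP.
have dP : isDM (0 : R) (1 : R) (fun t => Pm (c t)) (Pm w).
  apply: isDM_cplx; apply: (@is_derive_lin _ _ _ _ (fun v : TM => v.1)) => //.
  by apply: TM_cont.
have dN : isDM (0 : R) (1 : R) (fun t => Nm (c t)) (Nm w).
  apply: isDMZc; apply: isDM_cplx; apply: (@is_derive_lin _ _ _ _ (fun v : TM => v.2)) => //.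
  by apply: TM_cont.
rewrite -c0; split.
- have := isDMJ dP.
  have -> : (fun t => (Pm (c t))^t*) = (fun t => Pm (c t)).
    by apply/funext => t; case: (fl t).
  by move=> D; exact: (isDM_uniq D dP).
- have := isDMJ dN.
  have -> : (fun t => (Nm (c t))^t*) = (fun t => Nm (c t)).
    by apply/funext => t; case: (fl t).
  by move=> D; exact: (isDM_uniq D dN).
- have := isDMM dP dP.
  have -> : (fun t => Pm (c t) *m Pm (c t)) = (fun t => Pm (c t)).
    by apply/funext => t; case: (fl t).
  by move=> D; exact: (esym (isDM_uniq D dP)).
- have := isDMD (isDMM dP dN) (isDMM dN dP).
  have -> : (fun t => Pm (c t) *m Nm (c t) + Nm (c t) *m Pm (c t)) = (fun t => Nm (c t)).
    by apply/funext => t; case: (fl t).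
  by move=> D; exact: (esym (isDM_uniq D dN)).
- have := isDMM dP (isDMM dN dN).
  have -> : (fun t => Pm (c t) *m (Nm (c t) *m Nm (c t))) = (fun t => Pm (c t)).
    by apply/funext => t; case: (fl t).
  by move=> D; exact: (isDM_uniq D dP).
Qed.

(** A skew-Hermitian matrix inducing a given velocity [u]. It is polynomial in the
    point, which makes it smooth; taking the skew part keeps it skew-Hermitian
    when [u] is not tangent. *)
Definition lie_lift p u : CM :=
  let L := flaglift (Pm p) (Nm p) (Pm u) (Nm u) in 2^-1 *: (L - L^t*).

Lemma lie_lift_skew p u : skewherm (lie_lift p u).
Proof.
rewrite /lie_lift; set L := flaglift _ _ _ _.
have -> : 2^-1 *: (L - L^t*) = (2^-1)%:C *: (L - L^t*).
  by congr (_ *: _); rewrite fmorphV rmorph_nat.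
by apply: skewZ; rewrite /skewherm ctB ctK opprB.
Qed.

Lemma lie_liftK p w : S p -> tangent S p w -> inf_act (lie_lift p w) p = w.
Proof.
move=> Sp tw; have fl := flag_TrCP Sp; have ft := flag_tangent_TrCP Sp tw.
have -> : lie_lift p w = flaglift (Pm p) (Nm p) (Pm w) (Nm w).
  rewrite /lie_lift flaglift_skew // opprK.
  set L := flaglift _ _ _ _.
  have -> : L + L = (1 + 1) *: L by rewrite scalerDl scale1r.
  by rewrite scalerA mulVf ?scale1r // pnatr_eq0.
by apply/inf_actP; split; [exact: flagliftP|exact: flagliftN].
Qed.

(** The action is infinitesimally transitive, the motion being [lie_lift]. *)
Lemma tangentP p w : S p -> tangent S p w -> exists2 A, skewherm A & w = inf_act A p.
Proof.
by move=> Sp tw; exists (lie_lift p w); [exact: lie_lift_skew|rewrite lie_liftK].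
Qed.

Lemma flaglift_lin (P N : CM) (k : R) (dP dN dP' dN' : CM) :
  flaglift P N (k%:C *: dP + dP') (k%:C *: dN + dN') =
  k%:C *: flaglift P N dP dN + flaglift P N dP' dN'.
Proof.
have lin M M' : lift_half P N (k%:C *: M + M') = k%:C *: lift_half P N M + lift_half P N M'.
  rewrite /lift_half !(mulmxDr, mulmxDl) -?(scalemxAl, scalemxAr) -?(scalemxAl, scalemxAr).
  mxlin.
rewrite /flaglift commDl commZl.
move: (commutator dP P) (commutator dP' P) => A1 A2.
rewrite commDl commZl; move: (commutator A1 N) (commutator A2 N) => B1 B2.
have -> : k%:C *: dN + dN' - (k%:C *: B1 + B2) = k%:C *: (dN - B1) + (dN' - B2) by mxlin.
rewrite lin; move: (lift_half _ _ _) (lift_half _ _ _) => C1 C2; mxlin.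
Qed.

Lemma ctZr (k : R) A : (k%:C *: A)^t* = k%:C *: A^t*.
Proof. by rewrite ctZ; congr (_ *: _); exact: conjc_real. Qed.

Lemma lie_lift_lin p (k : R) u v :
  lie_lift p (k *: u + v) = k%:C *: lie_lift p u + lie_lift p v.
Proof.
rewrite /lie_lift (PmP k u v) (NmP k u v) flaglift_lin ctD ctZr.
move: (flaglift _ _ _ _) (flaglift _ _ _ _) => L L'.
move: (L^t*) (L'^t*) => L1 L1'; mxlin.
Qed.

Section SmoothLift.
Context {E : normedModType R}.

Lemma smM_Pm (f : E -> TM) : smooth f -> smM (fun q => Pm (f q)).
Proof.
move=> sf; apply: smM_cplx; apply: (@smooth_comp_lin _ _ _ _ (fun v : TM => v.1)) => //.
exact: TM_cont.
Qed.

Lemma smM_Nm (f : E -> TM) : smooth f -> smM (fun q => Nm (f q)).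
Proof.
move=> sf; apply: smMZc; apply: smM_cplx; apply: (@smooth_comp_lin _ _ _ _ (fun v : TM => v.2)) => //.
exact: TM_cont.
Qed.

Lemma smM_comm (A B : E -> CM) : smM A -> smM B -> smM (fun q => commutator (A q) (B q)).
Proof. by move=> sA sB; apply: smMB; apply: smMM. Qed.

Lemma isDM_comm (A B : E -> CM) (p w : E) dA dB : isDM p w A dA -> isDM p w B dB ->
  isDM p w (fun q => commutator (A q) (B q)) (commutator dA (B p) + commutator (A p) dB).
Proof.
move=> sA sB; have := isDMB (isDMM sA sB) (isDMM sB sA).
suff -> : dA *m B p + A p *m dB - (dB *m A p + B p *m dA) =
  commutator dA (B p) + commutator (A p) dB by [].
by rewrite !commutatorE; mxlin.
Qed.

Lemma smM_lie_lift (f u : E -> TM) : smooth f -> smooth u ->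
  smM (fun q => lie_lift (f q) (u q)).
Proof.
move=> sf su; have sP := smM_Pm sf; have sN := smM_Nm sf.
have sdP := smM_Pm su; have sdN := smM_Nm su.
have sA := smM_comm sdP sP.
have sB := smMB sdN (smM_comm sA sN).
have sL : smM (fun q => flaglift (Pm (f q)) (Nm (f q)) (Pm (u q)) (Nm (u q))).
  apply: (smMD sA); apply: smMB; first apply: smMB.
  - by apply: smMM => //; exact: smMM.
  - by apply: smMM => //; exact: smMM.
  - apply: smMM => //; apply: smMM => //; apply: smMM => //.
    by apply: smMM => //; exact: smMM.
by apply: smMZc; apply: smMB => //; exact: smMJ.
Qed.

Lemma smooth_inf_act (M : E -> CM) (f : E -> TM) : smM M -> smooth f ->
  smooth (fun q => inf_act (M q) (f q)).
Proof.
move=> sM sf; apply: smooth_pair; apply: smooth_reim; apply: smM_comm => //; apply: smM_cplx.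
  by apply: (@smooth_comp_lin _ _ _ _ (fun v : TM => v.1)) => //; exact: TM_cont.
by apply: (@smooth_comp_lin _ _ _ _ (fun v : TM => v.2)) => //; exact: TM_cont.
Qed.

Lemma is_derive_inf_act (M : E -> CM) (f : E -> TM) (p w : E) dM df :
  isDM p w M dM -> is_derive p w f df ->
  is_derive p w (fun q => inf_act (M q) (f q)) (inf_act dM (f p) + inf_act (M p) df).
Proof.
move=> sM sf.
have D (l : TM -> RM) : linear l ->
    is_derive p w (fun q => reim (commutator (M q) (cplx (l (f q)))))
      (reim (commutator dM (cplx (l (f p)))) + reim (commutator (M p) (cplx (l df)))).
  move=> ll.
  have -> : reim (commutator dM (cplx (l (f p)))) + reim (commutator (M p) (cplx (l df))) =
    reim (commutator dM (cplx (l (f p))) + commutator (M p) (cplx (l df))).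
    rewrite -[X in X + _]scale1r -reimP; congr (reim (_ + _)); exact: scale1r.
  apply: is_derive_reim; apply: isDM_comm => //; apply: isDM_cplx.
  by apply: (is_derive_lin ll) => //; exact: TM_cont.
by apply: is_derive_pair; [exact: (D fst)|exact: (D snd)].
Qed.

End SmoothLift.

Lemma smooth_idTM : smooth (fun p : TM => p).
Proof. by apply: smooth_lin => //; exact: TM_cont. Qed.

Lemma vfield_inf_act (M : TM -> CM) (U : TM -> TM) : smM M ->
  (forall p, S p -> skewherm (M p)) -> (forall p, S p -> U p = inf_act (M p) p) ->
  vfield S U.
Proof.
move=> sM hM UM; split.
  apply: (smooth_on_global (f' := fun p => inf_act (M p) p)); last by move=> p /UM.
  by apply: smooth_inf_act => //; exact: smooth_idTM.
by move=> p Sp; rewrite UM //; apply: tangent_inf_act => //; exact: hM.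
Qed.

Lemma vfield_fund A : skewherm A -> vfield S (inf_act A).
Proof. by move=> sA; apply: (vfield_inf_act (M := fun=> A)) => //; exact: smM_cst. Qed.

Lemma tder_inf_act (M : TM -> CM) (U : TM -> TM) p w dM : smM M ->
  (\forall q \near p, S q -> inf_act (M q) q = U q) -> S p -> tangent S p w ->
  isDM p w M dM -> tder S U p w = inf_act dM p + inf_act (M p) w.
Proof.
move=> sM UM Sp tw D.
have s := smooth_inf_act sM smooth_idTM.
apply: (tder_derive (f' := fun p => inf_act (M p) p)) => //; first exact: smooth_diff.
exact: is_derive_inf_act.
Qed.

Lemma tder_fund A p w : S p -> tangent S p w -> tder S (inf_act A) p w = inf_act A w.
Proof. by move=> Sp tw; apply: tder_lin => //; [exact: TM_cont|exact: inf_act_linr]. Qed.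

(** Write the field as [q |-> inf_act (M q) q] with [M] smooth. Of the two terms
    of the product rule, the derivative of [M] gives a tangent vector. *)
Lemma tder_vfield U p w : vfield S U -> S p -> tangent S p w ->
  exists2 B, skewherm B & tder S U p w = inf_act B p + inf_act (lie_lift p (U p)) w.
Proof.
move=> [sU tU] Sp tw; have [U' sU' UU'] := sU _ Sp.
(* A smooth matrix-valued map inducing [U] near [p]. *)
pose M q := lie_lift q (U' q).
have sM : smM M by apply: smM_lie_lift => //; exact: smooth_idTM.
pose dM : CM := \matrix_(i, j) (('D_w (fun q => complex.Re (M q i j) : R^o) p)
                       +i* ('D_w (fun q => complex.Im (M q i j) : R^o) p)).
have D : isDM p w M dM.
  by move=> i j; rewrite mxE; split; apply: smooth_is_derive; case: (sM i j).
exists dM.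
  have := isDMJ D; have -> : (fun q => (M q)^t*) = (fun q => - M q).
    by apply/funext => q; exact: lie_lift_skew.
  by move/isDM_uniq; apply; exact: isDMN.
rewrite -(nbhs_singleton UU' Sp); apply: (tder_inf_act sM) => //.
apply: near_imply UU' => q UU' Sq.
by rewrite /M UU' // lie_liftK //; exact: tU.
Qed.

Lemma inf_act_comm A B p :
  inf_act A (inf_act B p) - inf_act B (inf_act A p) = inf_act (commutator A B) p.
Proof.
apply/eqP; rewrite subr_eq; apply/eqP; apply: PNm_inj.
  apply: (etrans (Pm_inf_act _ _)); apply: (etrans (congr1 _ (Pm_inf_act _ _))).
  apply: esym; apply: (etrans (PmD _ _)).
  apply: (etrans (f_equal2 +%R (Pm_inf_act _ _) (etrans (Pm_inf_act _ _) (congr1 _ (Pm_inf_act _ _))))).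
  by rewrite jacobi subrK.
apply: (etrans (Nm_inf_act _ _)); apply: (etrans (congr1 _ (Nm_inf_act _ _))).
apply: esym; apply: (etrans (NmD _ _)).
apply: (etrans (f_equal2 +%R (Nm_inf_act _ _) (etrans (Nm_inf_act _ _) (congr1 _ (Nm_inf_act _ _))))).
by rewrite jacobi subrK.
Qed.

(** In the difference of the two derivatives, the parts that are not of the form
    [inf_act B p] combine into [inf_act] of a commutator. *)
Lemma lie_tangent U V : vfield S U -> vfield S V ->
  forall p, S p -> tangent S p (lie S U V p).
Proof.
move=> vU vV p Sp; have tU := vU.2 _ Sp; have tV := vV.2 _ Sp.
have [B sB HB] := tder_vfield vV Sp tU.
have [D sD HD] := tder_vfield vU Sp tV.
have eU := lie_liftK Sp tU; have eV := lie_liftK Sp tV.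
move: (lie_lift_skew p (U p)) (lie_lift_skew p (V p)) eU eV HB HD.
move: (lie_lift p (U p)) (lie_lift p (V p)) => A A' sA sA' eU eV HB HD.
have E1 := etrans HB (congr1 (fun x => inf_act B p + inf_act A' x) (esym eU)).
have E2 := etrans HD (congr1 (fun x => inf_act D p + inf_act A x) (esym eV)).
have E : inf_act (B - D + commutator A' A) p =
  inf_act B p - inf_act D p + (inf_act A' (inf_act A p) - inf_act A (inf_act A' p)).
  exact: (etrans (inf_actD _ _ _) (f_equal2 +%R (inf_actB _ _ _) (esym (inf_act_comm _ _ _)))).
have -> : lie S U V p = inf_act (B - D + commutator A' A) p.
  apply: (etrans _ (esym E)); apply: (etrans (f_equal2 (fun x y => x - y) E1 E2)).
  exact: addrBACA.
apply: tangent_inf_act => //; apply: skewD; last by apply: comm_skew.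
by apply: skewD => //; exact: skewN.
Qed.

(** The sign is that of a left action. *)
Lemma lie_fund A B p : S p -> skewherm A -> skewherm B ->
  lie S (inf_act A) (inf_act B) p = - inf_act (commutator A B) p.
Proof.
move=> Sp sA sB; rewrite /lie !tder_fund //; [|exact: tangent_inf_act..].
by rewrite inf_act_comm commC inf_actN.
Qed.

End Points.
End Manifold.

(** * Equivariant vectors and metric operators *)

(** [Xpt P N], [mupt N] and [nupt P N] are equivariant, and take the values [X], [mu]
    and [nu] at the base point. *)
HB.lock Definition Xpt (R : realType) (n : nat) (P N : 'M[R[i]]_n.+1) : 'M[R[i]]_n.+1 :=
  2^-1 *: (P *m N - N *m P).
HB.lock Definition mupt (R : realType) (n : nat) (N : 'M[R[i]]_n.+1) : 'M[R[i]]_n.+1 :=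
  ('i%C / 2) *: N.
HB.lock Definition nupt (R : realType) (n : nat) (P N : 'M[R[i]]_n.+1) : 'M[R[i]]_n.+1 :=
  - ('i%C / 2) *: (P + P - N *m N).
(** [N ^ 2] projects onto the plane spanned by the line of [P] and its image
    by [N], and [Tpt N] onto the orthogonal of that plane. *)
HB.lock Definition Tpt (R : realType) (n : nat) (N : 'M[R[i]]_n.+1) : 'M[R[i]]_n.+1 :=
  1%:M - N *m N.
Arguments Xpt {R n} P N.
Arguments mupt {R n} N.
Arguments nupt {R n} P N.
Arguments Tpt {R n} N.

Section Forms.
Context {R : realType} {n : nat}.
Notation C := R[i].
Notation CM := 'M[C]_n.+1.
Implicit Types (A B M P N : CM).

Lemma ipC A B : ip A B = ip B A.
Proof. by rewrite /ip mxtrace_mulC. Qed.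
Lemma ipDl A B M : ip (A + B) M = ip A M + ip B M.
Proof. by rewrite /ip mulmxDl mxtraceD cReD mulrDr. Qed.
Lemma ipDr A B M : ip M (A + B) = ip M A + ip M B.
Proof. by rewrite !(ipC M) ipDl. Qed.
Lemma ipZl (k : R) A B : ip (k%:C *: A) B = k * ip A B.
Proof. by rewrite /ip -scalemxAl mxtraceZ Re_rM mulrCA. Qed.
Lemma ipZr (k : R) A B : ip A (k%:C *: B) = k * ip A B.
Proof. by rewrite ipC ipZl ipC. Qed.
Lemma ipNl A B : ip (- A) B = - ip A B.
Proof. by rewrite /ip mulNmx linearN /= cReN mulrN. Qed.
Lemma ipNr A B : ip A (- B) = - ip A B.
Proof. by rewrite ipC ipNl ipC. Qed.
Lemma ip_comm A B M : ip (commutator A B) M = ip A (commutator B M).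
Proof.
congr (_ * complex.Re _).
rewrite /commutator mulmxBl mulmxBr !raddfB /=; congr (_ - _); first by rewrite mulmxA.
by rewrite -(mulmxA B A M) mxtrace_mulC mulmxA.
Qed.
Lemma ip_cj (a : CM) A B : a \is unitarymx -> ip (cj a A) (cj a B) = ip A B.
Proof. by move=> ua; rewrite /ip -cj_mul // cj_tr. Qed.

Definition vpt (x y z : R) P N : CM :=
  x%:C *: Xpt P N + y%:C *: mupt N + z%:C *: nupt P N.

(** The blocks of [B] between the image of the projection [E] and that of
    [Tpt N]: the components of index [eps/2]. *)
Definition halfpart E N B : CM := E *m B *m Tpt N + Tpt N *m B *m E.

(** The operator of the metric with the given coefficients: [ip A (Gam B)] is the
    product of the vectors induced by [A] and [B] at [(P, N)]. It vanishes on the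
    stabiliser. *)
Definition Gam (a0 ae be ah bh : R) P N B : CM :=
  vpt (a0 * ip B (Xpt P N)) (ae * ip B (mupt N)) (be * ip B (nupt P N)) P N
  + ah%:C *: halfpart P N B + bh%:C *: halfpart (N *m N - P) N B.

Section Equivariance.
Context (a : CM) (ua : a \is unitarymx).

Lemma Xpt_cj P N : Xpt (cj a P) (cj a N) = cj a (Xpt P N).
Proof. by rewrite !Xpt.unlock cjZ cjD cjN !cj_mul. Qed.
Lemma mupt_cj N : mupt (cj a N) = cj a (mupt N).
Proof. by rewrite !mupt.unlock cjZ. Qed.
Lemma nupt_cj P N : nupt (cj a P) (cj a N) = cj a (nupt P N).
Proof. by rewrite !nupt.unlock cjZ !cjD cjN cj_mul. Qed.
Lemma vpt_cj x y z P N : vpt x y z (cj a P) (cj a N) = cj a (vpt x y z P N).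
Proof.
rewrite /vpt Xpt_cj mupt_cj nupt_cj; move: (Xpt P N) (mupt N) (nupt P N) => X1 X2 X3.
by rewrite !cjD !cjZ.
Qed.
Lemma Tpt_cj N : Tpt (cj a N) = cj a (Tpt N).
Proof. by rewrite !Tpt.unlock cjD cjN cj_mul // cj_id. Qed.
Lemma halfpart_cj E N B : halfpart (cj a E) (cj a N) (cj a B) = cj a (halfpart E N B).
Proof. by rewrite /halfpart Tpt_cj cjD !(cj_mul ua). Qed.
Lemma Gam_cj a0 ae be ah bh P N B :
  Gam a0 ae be ah bh (cj a P) (cj a N) (cj a B) = cj a (Gam a0 ae be ah bh P N B).
Proof.
have T : cj a N *m cj a N - cj a P = cj a (N *m N - P) by rewrite cjD cjN cj_mul.
rewrite /Gam T Xpt_cj mupt_cj nupt_cj !(ip_cj _ _ ua) vpt_cj !halfpart_cj.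
by rewrite -(cjZ a ah%:C) -(cjZ a bh%:C) -!cjD.
Qed.
End Equivariance.

Lemma vpt_lin (k x y z x' y' z' : R) P N :
  vpt (k * x + x') (k * y + y') (k * z + z') P N = k%:C *: vpt x y z P N + vpt x' y' z' P N.
Proof.
rewrite /vpt; move: (Xpt P N) (mupt N) (nupt P N) => X Y Z.
by rewrite !rmorphD !rmorphM /=; mxlin.
Qed.

Lemma halfpart_lin (k : R) E N B B' :
  halfpart E N (k%:C *: B + B') = k%:C *: halfpart E N B + halfpart E N B'.
Proof.
rewrite /halfpart; move: (Tpt N) => T.
by rewrite !(mulmxDr, mulmxDl) -?(scalemxAl, scalemxAr); mxlin.
Qed.

Lemma Gam_lin a0 ae be ah bh (k : R) P N B B' :
  Gam a0 ae be ah bh P N (k%:C *: B + B') =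
  k%:C *: Gam a0 ae be ah bh P N B + Gam a0 ae be ah bh P N B'.
Proof.
rewrite /Gam !halfpart_lin !ipDl !ipZl.
have -> : vpt (a0 * (k * ip B (Xpt P N) + ip B' (Xpt P N)))
     (ae * (k * ip B (mupt N) + ip B' (mupt N))) (be * (k * ip B (nupt P N) + ip B' (nupt P N))) P N
  = k%:C *: vpt (a0 * ip B (Xpt P N)) (ae * ip B (mupt N)) (be * ip B (nupt P N)) P N
   + vpt (a0 * ip B' (Xpt P N)) (ae * ip B' (mupt N)) (be * ip B' (nupt P N)) P N.
  by rewrite -vpt_lin; congr (vpt _ _ _ _ _); ring.
move: (vpt _ _ _ _ _) (vpt _ _ _ _ _) (halfpart _ _ _) (halfpart _ _ _) (halfpart _ _ _) (halfpart _ _ _).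
by move=> *; mxlin.
Qed.

Lemma conj_halfi : Num.conj ('i%C / 2 : C) = - ('i%C / 2).
Proof.
rewrite rmorphM rmorphV ?unitfE ?pnatr_eq0 // rmorph_nat -mulNr; congr (_ * _).
by apply/eqP; rewrite eq_complex /= oppr0 !eqxx.
Qed.

Section FlagSkew.
Context P N (fl : flag P N).

Lemma Xpt_skew : skewherm (Xpt P N).
Proof.
have [hP hN _ _ _] := fl.
rewrite /skewherm Xpt.unlock ctZ ctB !ctM hP hN -scalerN opprB; congr (_ *: _).
by rewrite rmorphV ?unitfE ?pnatr_eq0 // rmorph_nat.
Qed.
Lemma mupt_skew : skewherm (mupt N).
Proof.
have [hP hN _ _ _] := fl.
rewrite /skewherm mupt.unlock ctZ hN -scaleNr; congr (_ *: _).
exact: conj_halfi.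
Qed.
Lemma nupt_skew : skewherm (nupt P N).
Proof.
have [hP hN _ _ _] := fl.
rewrite /skewherm nupt.unlock ctZ ctB ctD ctM hN hP -scaleNr; congr (_ *: _).
by rewrite rmorphN; congr (- _); exact: conj_halfi.
Qed.
Lemma vpt_skew x y z : skewherm (vpt x y z P N).
Proof. by apply: skewD; [apply: skewD|]; apply: skewZ; [exact: Xpt_skew|exact: mupt_skew|exact: nupt_skew]. Qed.
Lemma halfpart_skew E B : selfadj E -> skewherm B -> skewherm (halfpart E N B).
Proof.
have [hP hN _ _ _] := fl => hE sB.
have hT : (Tpt N)^t* = Tpt N by rewrite Tpt.unlock ctB ct1 ctM hN.
rewrite /skewherm /halfpart; move: (Tpt N) hT => T hT.
by rewrite ctD !ctM hT hE sB !mulNmx !mulmxN addrC opprD !mulmxA.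
Qed.
Lemma Gam_skew a0 ae be ah bh B : skewherm B -> skewherm (Gam a0 ae be ah bh P N B).
Proof.
have [hP hN _ _ _] := fl => sB.
have hR : selfadj (N *m N - P) by rewrite /selfadj ctB ctM hN hP.
by apply: skewD; [apply: skewD; first exact: vpt_skew|]; apply: skewZ; exact: halfpart_skew.
Qed.
End FlagSkew.
End Forms.

(** * Coordinates modulo the stabiliser *)

Section BasePoint.
Context {R : realType} {n : nat} (hn : (1 <= n)%N).
Notation C := R[i].
Notation CM := 'M[C]_n.+1.
Implicit Types (A B D M : CM).
Notation i1 := (inord 0 : 'I_n.+1).
Notation i2 := (inord 1 : 'I_n.+1).
Notation re := (@complex.Re R).
Notation im := (@complex.Im R).
Notation P0 := (E_ 1 1 : CM).
Notation N0 := (E_ 1 2 + E_ 2 1 : CM).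

Definition outer (k : 'I_n.+1) : bool := (k != i1) && (k != i2).

Lemma index_cases (k : 'I_n.+1) : [\/ k = i1, k = i2 | outer k].
Proof.
rewrite /outer; have [->|] := eqVneq k i1; first by constructor 1.
have [->|] := eqVneq k i2; first by constructor 2.
by constructor 3.
Qed.

Lemma outer1 k : outer k -> ((k == i1) = false) * ((i1 == k) = false).
Proof. by rewrite ![_ == k]eq_sym => /andP[/negPf -> _]. Qed.
Lemma outer2 k : outer k -> ((k == i2) = false) * ((i2 == k) = false).
Proof. by rewrite ![_ == k]eq_sym => /andP[_ /negPf ->]. Qed.

Lemma E_entry a b i j : (E_ a b : CM) i j = ((i == inord a.-1) && (j == inord b.-1))%:R.
Proof. by rewrite mxE. Qed.

Lemma mulE_r A a b i j :
  (A *m E_ a b) i j = if j == inord b.-1 then A i (inord a.-1) else 0.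
Proof.
rewrite mxE (bigD1 (inord a.-1)) //= big1 ?addr0; last first.
  by move=> k /negPf ka; rewrite E_entry ka mulr0.
by rewrite E_entry eqxx /=; case: eqP; rewrite ?mulr1 ?mulr0.
Qed.

Lemma mulE_l A a b i j :
  (E_ a b *m A) i j = if i == inord a.-1 then A (inord b.-1) j else 0.
Proof.
rewrite mxE (bigD1 (inord b.-1)) //= big1 ?addr0; last first.
  by move=> k /negPf ka; rewrite E_entry ka andbF mul0r.
by rewrite E_entry eqxx andbT; case: eqP; rewrite ?mul1r ?mul0r.
Qed.

Lemma tr_mulE A a b : \tr (A *m E_ a b) = A (inord b.-1) (inord a.-1).
Proof.
rewrite /mxtrace (bigD1 (inord b.-1)) //= big1 ?addr0; last first.
  by move=> k /negPf ka; rewrite mulE_r ka.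
by rewrite mulE_r eqxx.
Qed.

Lemma N0N0 : N0 *m N0 = E_ 1 1 + E_ 2 2.
Proof.
by rewrite mulmxDl !mulmxDr !mulEE /= !eqxx (neq01 hn) (neq10 hn) add0r addr0.
Qed.

Lemma N0N0P0 : N0 *m N0 - P0 = E_ 2 2.
Proof. by rewrite N0N0 addrAC subrr add0r. Qed.

Lemma Xpt0 : Xpt P0 N0 = X.
Proof.
by rewrite Xpt.unlock mulmxDl !mulmxDr !mulEE /= !eqxx (neq01 hn) (neq10 hn) add0r addr0.
Qed.
Lemma mupt0 : mupt N0 = mu.
Proof. by rewrite mupt.unlock. Qed.
Lemma nupt0 : nupt P0 N0 = nu.
Proof. by rewrite nupt.unlock N0N0 /nu; congr (_ *: _); rewrite opprD addrA addrK. Qed.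

Lemma skew_re A i j : skewherm A -> re (A j i) = - re (A i j).
Proof. by move/matrixP/(_ i j); rewrite !mxE => /(congr1 re); rewrite cReJ cReN. Qed.
Lemma skew_im A i j : skewherm A -> im (A j i) = im (A i j).
Proof. by move/matrixP/(_ i j); rewrite !mxE => /(congr1 im); rewrite cImJ cImN => /oppr_inj. Qed.
Lemma skew_re0 A i : skewherm A -> re (A i i) = 0.
Proof. by move/skew_re => /(_ i i) /eqP; rewrite -addr_eq0 -mulr2n mulrn_eq0 /= => /eqP. Qed.

Lemma C_half : (2^-1 : C) = (2^-1)%:C.
Proof. by rewrite fmorphV rmorph_nat. Qed.
Lemma Re_halfi (x : C) : re ('i%C / 2 * x) = - 2^-1 * im x.
Proof. by rewrite C_half -mulrA mulrCA Re_rM cReM /= mul0r mul1r sub0r mulrN mulNr. Qed.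
Lemma Im_halfi (x : C) : im ('i%C / 2 * x) = 2^-1 * re x.
Proof. by rewrite C_half -mulrA mulrCA Im_rM cImM /= mul0r mul1r add0r. Qed.
Lemma Re_half (x : C) : re (2^-1 * x) = 2^-1 * re x.
Proof. by rewrite C_half Re_rM. Qed.
Lemma Im_half (x : C) : im (2^-1 * x) = 2^-1 * im x.
Proof. by rewrite C_half Im_rM. Qed.

Lemma ip_X A : ip A X = re (A i1 i2) - re (A i2 i1).
Proof.
rewrite /ip /X -scalemxAr mxtraceZ mulmxBr raddfB /= !tr_mulE /= Re_half cReD cReN; lra.
Qed.
Lemma ip_mu A : ip A mu = im (A i1 i2) + im (A i2 i1).
Proof.
rewrite /ip /mu -scalemxAr mxtraceZ mulmxDr mxtraceD !tr_mulE /= Re_halfi cImD; lra.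
Qed.
Lemma ip_nu A : ip A nu = im (A i2 i2) - im (A i1 i1).
Proof.
rewrite /ip /nu scaleNr mulmxN -scalemxAr linearN /= mxtraceZ mulmxBr raddfB /= !tr_mulE /=.
by rewrite cReN Re_halfi cImD cImN; lra.
Qed.

(** For skew-Hermitian [A] and [B]: they induce the same tangent vector at the base
    point. *)
Definition same_coords A B : Prop :=
  [/\ A i1 i2 = B i1 i2, A i2 i2 - A i1 i1 = B i2 i2 - B i1 i1 &
   forall k, outer k -> A i1 k = B i1 k /\ A i2 k = B i2 k].

Lemma commP0 D i j : commutator D P0 i j =
  (if j == i1 then D i i1 else 0) - (if i == i1 then D i1 j else 0).
Proof. by rewrite commutatorE mxD mxN mulE_r mulE_l. Qed.

Lemma commN0 D i j : commutator D N0 i j =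
  (if j == i2 then D i i1 else 0) + (if j == i1 then D i i2 else 0)
  - ((if i == i1 then D i2 j else 0) + (if i == i2 then D i1 j else 0)).
Proof. by rewrite commutatorE mulmxDl mulmxDr !(mxD, mxN) !mulE_r !mulE_l. Qed.

(** The stabiliser of the pair [(E11, E12 + E21)], read off its entries. *)
Lemma stabilizer_coords D : skewherm D ->
  (commutator D P0 = 0 /\ commutator D N0 = 0) <->
    [/\ D i1 i2 = 0, D i2 i2 = D i1 i1 &
      forall k, outer k -> D i1 k = 0 /\ D i2 k = 0].
Proof.
move=> sD.
split=> [[e1 e2]|[h1 h2 h3]].
  have E1 i j : commutator D P0 i j = 0 by rewrite e1 mxE.
  have E2 i j : commutator D N0 i j = 0 by rewrite e2 mxE.
  split.
  - have := E1 i1 i2; rewrite commP0 (neq10 hn) eqxx sub0r => /eqP.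
    by rewrite oppr_eq0 => /eqP.
  - have := E2 i1 i2; rewrite commN0 (neq10 hn) (neq01 hn) !eqxx !addr0 => /eqP.
    by rewrite subr_eq0 eq_sym => /eqP.
  - move=> k ok; split.
      have := E1 i1 k; rewrite commP0 (outer1 ok) eqxx sub0r => /eqP.
      by rewrite oppr_eq0 => /eqP.
    have := E2 i1 k; rewrite commN0 (outer1 ok) (outer2 ok) (neq01 hn) eqxx !addr0 sub0r => /eqP.
    by rewrite oppr_eq0 => /eqP.
have z i j : D i j = 0 -> D j i = 0.
  move=> e; apply/eqP; rewrite eq_complex (skew_re i j sD) (skew_im i j sD) e /=.
  by rewrite oppr0 !eqxx.
have h21 := z _ _ h1.
have h4 k : outer k -> D k i1 = 0 /\ D k i2 = 0 by move=> /h3 [a b]; split; exact: z.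
split; apply/matrixP => i j.
  rewrite commP0 [RHS]mxE.
  case: (index_cases i) => [->|->|oi]; case: (index_cases j) => [->|->|oj];
   rewrite ?eqxx ?(neq01 hn) ?(neq10 hn) ?(outer1 oi) ?(outer1 oj) ?h1 ?h21 ?(h3 _ oj).1 ?(h4 _ oi).1 ?(subrr, subr0, oppr0) //.
rewrite commN0 [RHS]mxE.
case: (index_cases i) => [->|->|oi]; case: (index_cases j) => [->|->|oj];
 rewrite ?eqxx ?(neq01 hn) ?(neq10 hn) ?(outer1 oi) ?(outer1 oj) ?(outer2 oi) ?(outer2 oj) ?h1 ?h21 ?h2 ?(h3 _ oj).1 ?(h3 _ oj).2 ?(h4 _ oi).1 ?(h4 _ oi).2 ?(addr0, add0r, subrr, subr0, oppr0) //.
Qed.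

Lemma same_coordsP A B : skewherm A -> skewherm B ->
  (commutator A P0 = commutator B P0 /\ commutator A N0 = commutator B N0) <->
  same_coords A B.
Proof.
move=> sA sB; have sD : skewherm (A - B) by apply: skewD => //; exact: skewN.
have e x : commutator A x = commutator B x <-> commutator (A - B) x = 0.
  by rewrite commBl; split=> [->|/eqP]; [exact: subrr|rewrite subr_eq0 => /eqP].
have d i j : A i j = B i j <-> (A - B) i j = 0.
  by rewrite mxD mxN; split=> [->|/eqP]; [exact: subrr|rewrite subr_eq0 => /eqP].
have d2 : A i2 i2 - A i1 i1 = B i2 i2 - B i1 i1 <-> (A - B) i2 i2 = (A - B) i1 i1.
  have E : (A i2 i2 - B i2 i2) - (A i1 i1 - B i1 i1) = (A i2 i2 - A i1 i1) - (B i2 i2 - B i1 i1).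
    ring.
  rewrite !mxD !mxN; split=> [h|h].
    by apply/eqP; rewrite -subr_eq0 E h subrr.
  by apply/eqP; rewrite -subr_eq0 -E h subrr.
have H := stabilizer_coords sD; split.
  move=> [/e e1 /e e2]; have [h1 h2 h3] := H.1 (conj e1 e2).
  by split; [exact/d|exact/d2|move=> k /h3 [? ?]; split; exact/d].
move=> [/d h1 /d2 h2 h3]; have [|e1 e2] := H.2.
  by split=> // k /h3 [/d ? /d ?].
by split; exact/e.
Qed.

End BasePoint.

(** * The metric operator in coordinates *)

Section BaseForms.
Context {R : realType} {n : nat} (hn : (1 <= n)%N).
Notation C := R[i].
Notation CM := 'M[C]_n.+1.
Implicit Types (A B D M : CM).
Notation i1 := (inord 0 : 'I_n.+1).
Notation i2 := (inord 1 : 'I_n.+1).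
Notation re := (@complex.Re R).
Notation im := (@complex.Im R).
Notation P0 := (E_ 1 1 : CM).
Notation N0 := (E_ 1 2 + E_ 2 1 : CM).

Lemma sum_outer (V : nmodType) (F : 'I_n.+1 -> V) :
  \sum_i F i = F i1 + F i2 + \sum_(k | outer k) F k.
Proof.
rewrite (bigD1 i1) //= (bigD1 i2) /=; last by rewrite (neq10 hn).
by rewrite addrA; congr (_ + _).
Qed.

Lemma outer_i1 : outer i1 = false. Proof. by rewrite /outer eqxx. Qed.
Lemma outer_i2 : outer i2 = false. Proof. by rewrite /outer eqxx andbF. Qed.

Lemma mulT_r B i j : (B *m Tpt N0) i j = if outer j then B i j else 0.
Proof.
rewrite Tpt.unlock (N0N0 hn) mulmxBr (mulmx1 B) (mulmxDr B) !(mxD, mxN) !mulE_r /=.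
case: (index_cases j) => [->|->|oj].
- by rewrite outer_i1 eqxx (neq01 hn) addr0 subrr.
- by rewrite outer_i2 eqxx (neq10 hn) add0r subrr.
- by rewrite oj (outer1 oj) (outer2 oj) addr0 subr0.
Qed.

Lemma mulT_l B i j : (Tpt N0 *m B) i j = if outer i then B i j else 0.
Proof.
rewrite Tpt.unlock (N0N0 hn) mulmxBl (mul1mx B) (mulmxDl _ _ B) !(mxD, mxN) !mulE_l /=.
case: (index_cases i) => [->|->|oj].
- by rewrite outer_i1 eqxx (neq01 hn) addr0 subrr.
- by rewrite outer_i2 eqxx (neq10 hn) add0r subrr.
- by rewrite oj (outer1 oj) (outer2 oj) addr0 subr0.
Qed.

Lemma halfpart_entry a B i j : halfpart (E_ a a) N0 B i j =
  (if outer j then if i == inord a.-1 then B (inord a.-1) j else 0 else 0) +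
  (if j == inord a.-1 then if outer i then B i (inord a.-1) else 0 else 0).
Proof. by rewrite /halfpart mxD mulT_r mulE_l mulE_r mulT_l. Qed.

Lemma vpt_entry x y z i j : vpt x y z P0 N0 i j =
  x%:C * (2^-1 * (E_ 1 2 i j - E_ 2 1 i j)) + y%:C * ('i%C / 2 * (E_ 1 2 i j + E_ 2 1 i j))
   - z%:C * ('i%C / 2 * (E_ 1 1 i j - E_ 2 2 i j)).
Proof.
have eX : (X : CM) i j = 2^-1 * (E_ 1 2 i j - E_ 2 1 i j) by rewrite mxZ mxD mxN.
have emu : (mu : CM) i j = 'i%C / 2 * (E_ 1 2 i j + E_ 2 1 i j) by rewrite mxZ mxD.
have enu : (nu : CM) i j = - ('i%C / 2 * (E_ 1 1 i j - E_ 2 2 i j)).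
  by rewrite mxZ mxD mxN mulNr.
have e : vpt x y z P0 N0 = x%:C *: X + y%:C *: mu + z%:C *: nu.
  by rewrite /vpt (Xpt0 hn) mupt0 (nupt0 hn).
have v3 (U V W : CM) : (x%:C *: U + y%:C *: V + z%:C *: W) i j =
    x%:C * U i j + y%:C * V i j + z%:C * W i j.
  by rewrite !mxE.
by rewrite e v3 eX emu enu mulrN.
Qed.

Lemma vpt12 x y z : vpt x y z P0 N0 i1 i2 = (x / 2) +i* (y / 2).
Proof.
rewrite vpt_entry !E_entry /= !eqxx (neq01 hn) (neq10 hn) /= subr0 addr0 subrr !mulr0 subr0.
apply/eqP; rewrite eq_complex cReD cImD !Re_rM !Im_rM Re_half Im_half Re_halfi Im_halfi /=.
by apply/andP; split; apply/eqP; ring.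
Qed.

Lemma vpt11 x y z : vpt x y z P0 N0 i1 i1 = 0 +i* (- (z / 2)).
Proof.
rewrite vpt_entry !E_entry /= !eqxx (neq01 hn) /= subr0 addr0 !mulr0 !add0r.
apply/eqP; rewrite eq_complex cReN cImN !Re_rM !Im_rM Re_halfi Im_halfi /=.
by apply/andP; split; apply/eqP; ring.
Qed.

Lemma vpt22 x y z : vpt x y z P0 N0 i2 i2 = 0 +i* (z / 2).
Proof.
rewrite vpt_entry !E_entry /= !eqxx (neq10 hn) /= subr0 addr0 !mulr0 !add0r.
apply/eqP; rewrite eq_complex cReN cImN !Re_rM !Im_rM Re_halfi Im_halfi /=.
by apply/andP; split; apply/eqP; ring.
Qed.

Lemma vpt21 x y z : vpt x y z P0 N0 i2 i1 = (- (x / 2)) +i* (y / 2).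
Proof.
rewrite vpt_entry !E_entry /= !eqxx (neq10 hn) (neq01 hn) /= subrr !mulr0 subr0 sub0r add0r.
apply/eqP; rewrite eq_complex cReD cImD !Re_rM !Im_rM Re_half Im_half Re_halfi Im_halfi /=.
by apply/andP; split; apply/eqP; ring.
Qed.

Lemma vpt_outer_l x y z i j : outer i -> vpt x y z P0 N0 i j = 0.
Proof.
by move=> oi; rewrite vpt_entry !E_entry /= (outer1 oi) (outer2 oi) /= !(subrr, addr0, mulr0, subr0).
Qed.

Lemma vpt_outer_r x y z i j : outer j -> vpt x y z P0 N0 i j = 0.
Proof.
by move=> oi; rewrite vpt_entry !E_entry /= (outer1 oi) (outer2 oi) !andbF /= !(subrr, addr0, mulr0, subr0).
Qed.

Section GamEntries.
Context (a0 ae be ah bh : R).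
Notation Gam0 := (Gam a0 ae be ah bh P0 N0).

Lemma Gam0E B : Gam0 B = vpt (a0 * ip B X) (ae * ip B mu) (be * ip B nu) P0 N0
  + ah%:C *: halfpart P0 N0 B + bh%:C *: halfpart (E_ 2 2) N0 B.
Proof. by rewrite /Gam (N0N0P0 hn) (Xpt0 hn) mupt0 (nupt0 hn). Qed.

Lemma Gam0_entry B i j : Gam0 B i j = vpt (a0 * ip B X) (ae * ip B mu) (be * ip B nu) P0 N0 i j
  + ah%:C * halfpart P0 N0 B i j + bh%:C * halfpart (E_ 2 2) N0 B i j.
Proof.
have v3 (U V W : CM) : (U + ah%:C *: V + bh%:C *: W) i j =
    U i j + ah%:C * V i j + bh%:C * W i j by rewrite !mxE.
by rewrite Gam0E v3.
Qed.

Lemma Gam12 B : Gam0 B i1 i2 = (a0 * ip B X / 2) +i* (ae * ip B mu / 2).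
Proof.
rewrite Gam0_entry vpt12 !halfpart_entry /= outer_i1 outer_i2.
by rewrite (neq10 hn) eqxx !addr0 !mulr0 !addr0.
Qed.

Lemma Gam11 B : Gam0 B i1 i1 = 0 +i* (- (be * ip B nu / 2)).
Proof.
rewrite Gam0_entry vpt11 !halfpart_entry /= outer_i1.
by rewrite (neq01 hn) eqxx !addr0 !mulr0 !addr0.
Qed.

Lemma Gam22 B : Gam0 B i2 i2 = 0 +i* (be * ip B nu / 2).
Proof.
rewrite Gam0_entry vpt22 !halfpart_entry /= outer_i2.
by rewrite (neq10 hn) eqxx !addr0 !mulr0 !addr0.
Qed.

Lemma Gam1k B k : outer k -> Gam0 B i1 k = ah%:C * B i1 k.
Proof.
move=> ok; rewrite Gam0_entry (vpt_outer_r _ _ _ _ ok) !halfpart_entry /= ok (outer1 ok) (outer2 ok).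
by rewrite (neq01 hn) eqxx !addr0 mulr0 addr0 add0r.
Qed.

Lemma Gam2k B k : outer k -> Gam0 B i2 k = bh%:C * B i2 k.
Proof.
move=> ok; rewrite Gam0_entry (vpt_outer_r _ _ _ _ ok) !halfpart_entry /= ok (outer1 ok) (outer2 ok).
by rewrite (neq10 hn) eqxx !addr0 mulr0 !add0r.
Qed.

Lemma Gamkl B k l : outer k -> outer l -> Gam0 B k l = 0.
Proof.
move=> ok ol; rewrite Gam0_entry (vpt_outer_r _ _ _ _ ol) !halfpart_entry /= ok ol.
by rewrite !(outer1 ok) !(outer2 ok) !(outer1 ol) !(outer2 ol) !addr0 !mulr0 !addr0.
Qed.

End GamEntries.

Lemma half_inj (a b : R) : a / 2 = b / 2 -> a = b.
Proof. lra. Qed.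

Lemma skew12 A : skewherm A -> A i1 i2 = (ip A X / 2) +i* (ip A mu / 2).
Proof.
move=> sA; rewrite ip_X ip_mu (skew_re i1 i2 sA) (skew_im i1 i2 sA) opprK.
by case: (A i1 i2) => a b /=; apply/eqP; rewrite eq_complex /=; apply/andP; split; apply/eqP; lra.
Qed.

Lemma skew22 A : skewherm A -> A i2 i2 - A i1 i1 = 0 +i* ip A nu.
Proof.
move=> sA; rewrite ip_nu; apply/eqP; rewrite eq_complex cReD cReN cImD cImN /=.
by rewrite !(skew_re0 _ sA) subrr !eqxx.
Qed.

Lemma same_coords_ip A B : skewherm A -> skewherm B ->
  same_coords A B <->
  [/\ ip A X = ip B X, ip A mu = ip B mu, ip A nu = ip B nu &
    forall k, outer k -> A i1 k = B i1 k /\ A i2 k = B i2 k].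
Proof.
move=> sA sB; rewrite /same_coords (skew12 sA) (skew12 sB) (skew22 sA) (skew22 sB).
split=> [[h12 h22 h]|[e1 e2 e3 h]].
  have e1 := congr1 re h12; have e2 := congr1 im h12; have e3 := congr1 im h22.
  by split; [exact: half_inj e1|exact: half_inj e2|exact: e3|exact: h].
by rewrite e1 e2 e3; split.
Qed.

Lemma ip_Gam a0 ae be ah bh B : skewherm B ->
  [/\ ip (Gam a0 ae be ah bh P0 N0 B) X = a0 * ip B X,
      ip (Gam a0 ae be ah bh P0 N0 B) mu = ae * ip B mu &
      ip (Gam a0 ae be ah bh P0 N0 B) nu = be * ip B nu].
Proof.
move=> sB; have sG := Gam_skew (flag_E hn) a0 ae be ah bh sB.
have := skew12 sG; rewrite Gam12 => h.
have := skew22 sG; rewrite Gam22 Gam11 => h'.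
have e1 := congr1 re h; have e2 := congr1 im h; have e3 := congr1 im h'.
split; [exact: (esym (half_inj e1))|exact: (esym (half_inj e2))|].
by rewrite -[LHS]e3 /= opprK -splitr.
Qed.

Lemma ip_vpt x y z A : ip A (vpt x y z P0 N0) = x * ip A X + y * ip A mu + z * ip A nu.
Proof.
have e : vpt x y z P0 N0 = x%:C *: X + y%:C *: mu + z%:C *: nu.
  by rewrite /vpt (Xpt0 hn) mupt0 (nupt0 hn).
have v3 (U V W : CM) : ip A (x%:C *: U + y%:C *: V + z%:C *: W) =
    x * ip A U + y * ip A V + z * ip A W.
  by rewrite !ipDr !ipZr.
by rewrite e v3.
Qed.

Lemma ip_halfpart a A B : skewherm A -> skewherm B ->
  ip A (halfpart (E_ a a) N0 B) = 4 * \sum_(k | outer k)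
    (re (A (inord a.-1) k) * re (B (inord a.-1) k) + im (A (inord a.-1) k) * im (B (inord a.-1) k)).
Proof.
move=> sA sB; rewrite ipDr /ip.
have e1 : \tr (A *m (Tpt N0 *m B *m E_ a a)) =
    \sum_(k | outer k) A (inord a.-1) k * B k (inord a.-1).
  rewrite mulmxA tr_mulE mxE [RHS]big_mkcond; apply: eq_bigr => k _.
  by rewrite mulT_l; case: ifP => // _; rewrite mulr0.
have e2 : \tr (A *m (E_ a a *m B *m Tpt N0)) =
    \sum_(k | outer k) B (inord a.-1) k * A k (inord a.-1).
  rewrite -mulmxA mulmxA mxtrace_mulC mulmxA tr_mulE -mulmxA mxE [RHS]big_mkcond.
  apply: eq_bigr => k _.
  by rewrite mulT_l; case: ifP => // _; rewrite mulr0.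
rewrite e1 e2 !(big_morph re (@cReD R) (erefl : re 0 = 0)) -mulrDr -big_split /=.
rewrite [LHS]mulr_sumr [RHS]mulr_sumr; apply: eq_bigr => k _.
rewrite !cReM (skew_re _ _ sA) (skew_im _ _ sA) (skew_re _ _ sB) (skew_im _ _ sB).
ring.
Qed.

Definition row_dot (i : 'I_n.+1) A B : R :=
  \sum_(k | outer k) (re (A i k) * re (B i k) + im (A i k) * im (B i k)).

(** The first three terms are the components along [X], [mu], [nu]; the rows [i1]
    and [i2] outside of the first two columns are those of index [eps/2]. The
    factor 4 comes from [ip] and from skew-symmetry, which counts each entry twice. *)
Lemma ip_Gam0 a0 ae be ah bh A B : skewherm A -> skewherm B ->
  ip A (Gam a0 ae be ah bh P0 N0 B) =
  a0 * (ip A X * ip B X) + ae * (ip A mu * ip B mu) + be * (ip A nu * ip B nu)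
  + 4 * ah * row_dot i1 A B + 4 * bh * row_dot i2 A B.
Proof.
move=> sA sB; have v3 (U V W : CM) : ip A (U + ah%:C *: V + bh%:C *: W) =
    ip A U + ah * ip A V + bh * ip A W.
  by rewrite !ipDr !ipZr.
rewrite Gam0E v3 ip_vpt !ip_halfpart //= /row_dot.
move: (ip A X) (ip A mu) (ip A nu) (ip B X) (ip B mu) (ip B nu) => *.
ring.
Qed.

End BaseForms.

(** * Brackets with invariant vectors *)

Section BaseAlgebra.
Context {R : realType} {n : nat} (hn : (1 <= n)%N).
Notation C := R[i].
Notation CM := 'M[C]_n.+1.
Implicit Types (A B D M : CM).
Notation i1 := (inord 0 : 'I_n.+1).
Notation i2 := (inord 1 : 'I_n.+1).
Notation re := (@complex.Re R).
Notation im := (@complex.Im R).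
Notation P0 := (E_ 1 1 : CM).
Notation N0 := (E_ 1 2 + E_ 2 1 : CM).

Lemma comm_E a b c d : commutator (E_ a b : CM) (E_ c d) =
  (if (inord b.-1 : 'I_n.+1) == inord c.-1 then E_ a d else 0) -
  (if (inord d.-1 : 'I_n.+1) == inord a.-1 then E_ c b else 0).
Proof. by rewrite commutatorE !mulEE. Qed.

Lemma comm_self A : commutator A A = 0.
Proof. by rewrite commutatorE subrr. Qed.

Lemma commBr A B D : commutator A (B - D) = commutator A B - commutator A D.
Proof. by rewrite commDr commNr. Qed.

Lemma comm_c_d : commutator (E_ 1 2 : CM) (E_ 2 1) = E_ 1 1 - E_ 2 2.
Proof. by rewrite comm_E /= !eqxx. Qed.
Lemma comm_c_a : commutator (E_ 1 2 : CM) (E_ 1 1) = - E_ 1 2.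
Proof. by rewrite comm_E /= !eqxx (neq10 hn) sub0r. Qed.
Lemma comm_c_b : commutator (E_ 1 2 : CM) (E_ 2 2) = E_ 1 2.
Proof. by rewrite comm_E /= !eqxx (neq10 hn) subr0. Qed.
Lemma comm_d_a : commutator (E_ 2 1 : CM) (E_ 1 1) = E_ 2 1.
Proof. by rewrite comm_E /= !eqxx (neq01 hn) subr0. Qed.
Lemma comm_d_b : commutator (E_ 2 1 : CM) (E_ 2 2) = - E_ 2 1.
Proof. by rewrite comm_E /= !eqxx (neq01 hn) sub0r. Qed.

Lemma neq2C : (2 : C) != 0. Proof. by rewrite pnatr_eq0. Qed.

Lemma comm_X_mu : commutator (X : CM) mu = - nu.
Proof.
rewrite /X /mu /nu commZl commZr commDr !commBl !comm_self comm_c_d [commutator (E_ 2 1) _]commC comm_c_d.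
move: (E_ 1 1) (E_ 2 2) => a b; apply/matrixP => i j.
by rewrite ?(mxD, mxN, mxZ, mx0); field.
Qed.

Lemma comm_X_nu : commutator (X : CM) nu = mu.
Proof.
rewrite /X /mu /nu commZl commZr !commBl !commBr comm_c_a comm_c_b comm_d_a comm_d_b.
move: (E_ 1 2) (E_ 2 1) => a b; apply/matrixP => i j.
by rewrite ?(mxD, mxN, mxZ, mx0); field.
Qed.

Lemma comm_mu_nu : commutator (mu : CM) nu = - X.
Proof.
rewrite /X /mu /nu commZl commZr !commDl !commBr comm_c_a comm_c_b comm_d_a comm_d_b scalerA.
have -> : 'i%C / 2 * - ('i%C / 2) = 4^-1 :> C.
  have ii : 'i%C * 'i%C = -1 :> C by rewrite -expr2 sqr_i.
  have -> : 'i%C / 2 * - ('i%C / 2) = - ('i%C * 'i%C) / 4 :> C by field.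
  by rewrite ii opprK mul1r.
move: (E_ 1 2) (E_ 2 1) => a b; apply/matrixP => i j.
by rewrite ?(mxD, mxN, mxZ, mx0); field.
Qed.

Section CommVpt.
Context (x y z : R).
Notation Z := (vpt x y z P0 N0).

Lemma vptE : Z = x%:C *: X + y%:C *: mu + z%:C *: nu.
Proof. by rewrite /vpt (Xpt0 hn) mupt0 (nupt0 hn). Qed.

Lemma comm_vpt :
  [/\ commutator Z X = y%:C *: nu - z%:C *: mu,
      commutator Z mu = z%:C *: X - x%:C *: nu &
      commutator Z nu = x%:C *: mu - y%:C *: X].
Proof.
rewrite vptE; move: (comm_self (X : CM)) (comm_self (mu : CM)) (comm_self (nu : CM)) comm_X_mu comm_X_nu comm_mu_nu.
move: (X : CM) mu nu => U V W cU cV cW c1 c2 c3.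
split; rewrite !commDl !commZl.
- by rewrite cU (commC V) c1 (commC W) c2; mxlin.
- by rewrite cV c1 (commC W) c3; mxlin.
- by rewrite cW c2 c3; mxlin.
Qed.

(** On the span of [X], [mu], [nu] the bracket is the cross product of [su(2)]. *)
Lemma ip_comm_vpt B :
  [/\ ip (commutator Z B) X = z * ip B mu - y * ip B nu,
      ip (commutator Z B) mu = x * ip B nu - z * ip B X &
      ip (commutator Z B) nu = y * ip B X - x * ip B mu].
Proof.
have [e1 e2 e3] := comm_vpt.
have H M : ip (commutator Z B) M = - ip B (commutator Z M).
  by rewrite -ip_comm -ipNl -commC.
have L (a b : R) (U V : CM) : - ip B (a%:C *: U - b%:C *: V) = b * ip B V - a * ip B U.
  by rewrite ipDr ipNr !ipZr opprB.
split; apply: (etrans (H _)).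
- exact: (etrans (congr1 (fun M => - ip B M) e1) (L _ _ _ _)).
- exact: (etrans (congr1 (fun M => - ip B M) e2) (L _ _ _ _)).
- exact: (etrans (congr1 (fun M => - ip B M) e3) (L _ _ _ _)).
Qed.

(** On the pairs of entries of index [eps/2], the bracket is the standard
    representation of [su(2)]. *)
Lemma comm_vpt_row i B k : outer k ->
  commutator Z B i k = Z i i1 * B i1 k + Z i i2 * B i2 k.
Proof.
move=> ok; rewrite commutatorE mxD mxN ![(_ *m _) _ _]mxE (sum_outer hn).
rewrite [X in _ + X - _]big1; last by move=> l ol; rewrite (vpt_outer_r hn) ?mul0r.
rewrite [X in _ - X]big1 ?subr0 ?addr0 // => l _.
by rewrite (vpt_outer_r hn) ?mulr0.
Qed.

Lemma comm_vpt_outer B k l : outer k -> outer l -> commutator Z B k l = 0.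
Proof.
by move=> ok ol; rewrite (comm_vpt_row _ _ ol) !(vpt_outer_l hn) ?mul0r ?addr0.
Qed.

Lemma comm_vpt_trace B : commutator Z B i1 i1 + commutator Z B i2 i2 = 0.
Proof.
have Zk i k : outer k -> Z i k = 0 by move=> ok; rewrite (vpt_outer_r hn).
have Zk' i k : outer k -> Z k i = 0 by move=> ok; rewrite (vpt_outer_l hn).
have row i : (Z *m B) i i = Z i i1 * B i1 i + Z i i2 * B i2 i.
  rewrite mxE (sum_outer hn) [X in _ + X]big1 ?addr0 // => l ol.
  by rewrite Zk ?mul0r.
have col i : (B *m Z) i i = B i i1 * Z i1 i + B i i2 * Z i2 i.
  rewrite mxE (sum_outer hn) [X in _ + X]big1 ?addr0 // => l ol.
  by rewrite Zk' ?mulr0.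
rewrite commutatorE !(mxD, mxN) !row !col.
move: (Z i1 i1) (Z i1 i2) (Z i2 i1) (Z i2 i2) => *; ring.
Qed.

End CommVpt.

Lemma reduced_eq A B : skewherm A -> skewherm B -> same_coords A B ->
  (forall k l, outer k -> outer l -> A k l = B k l) ->
  A i1 i1 + A i2 i2 = B i1 i1 + B i2 i2 -> A = B.
Proof.
move=> sA sB [h12 hd hk] hkl ht.
have e22 : A i2 i2 = B i2 i2.
  apply: (mulfI neq2C).
  have -> : 2 * A i2 i2 = (A i1 i1 + A i2 i2) + (A i2 i2 - A i1 i1) by ring.
  by rewrite ht hd; ring.
have e11 : A i1 i1 = B i1 i1 by move: ht; rewrite e22 => /addIr.
have z i j : A i j = B i j -> A j i = B j i.
  move=> e; apply/eqP; rewrite eq_complex !(skew_re i j sA) !(skew_im i j sA) e.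
  by rewrite !(skew_re i j sB) !(skew_im i j sB) !eqxx.
apply/matrixP => i j.
case: (index_cases i) => [->|->|oi]; case: (index_cases j) => [->|->|oj] //.
- by case: (hk _ oj).
- exact: z.
- by case: (hk _ oj).
- by apply: z; case: (hk _ oi).
- by apply: z; case: (hk _ oi).
- exact: hkl.
Qed.

Lemma Gam1_reduced D : skewherm D -> (forall k l, outer k -> outer l -> D k l = 0) ->
  D i1 i1 + D i2 i2 = 0 -> Gam 1 1 1 1 1 P0 N0 D = D.
Proof.
move=> sD Dkl Dtr; have fl := @flag_E R n hn.
have sG := Gam_skew fl 1 1 1 1 1 sD.
apply: reduced_eq => //.
- apply/same_coords_ip => //; have [e1 e2 e3] := ip_Gam hn 1 1 1 1 1 sD.
  split; [exact: (etrans e1 (mul1r _))|exact: (etrans e2 (mul1r _))|exact: (etrans e3 (mul1r _))|].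
  move=> k ok; split.
    exact: (etrans (Gam1k hn _ _ _ _ _ _ ok) (mul1r _)).
  exact: (etrans (Gam2k hn _ _ _ _ _ _ ok) (mul1r _)).
- by move=> k l ok ol; rewrite (Gamkl hn _ _ _ _ _ _ ok ol) Dkl.
- rewrite Dtr (Gam11 hn) (Gam22 hn); apply/eqP; rewrite eq_complex /=.
  by rewrite addr0 addNr !eqxx.
Qed.

(** With all coefficients equal to 1, [Gam] is the projection onto the complement
    of the stabiliser, where the brackets with [Z] take their values. *)
Lemma Gam1_comm x y z B : skewherm B ->
  Gam 1 1 1 1 1 P0 N0 (commutator (vpt x y z P0 N0) B) = commutator (vpt x y z P0 N0) B.
Proof.
move=> sB; apply: Gam1_reduced.
- by apply: comm_skew => //; apply: vpt_skew; exact: flag_E.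
- by move=> k l; exact: comm_vpt_outer.
- exact: comm_vpt_trace.
Qed.

Lemma row_dot_eq0 i A : row_dot i A A = 0 -> forall k, outer k -> A i k = 0.
Proof.
move=> /eqP; rewrite psumr_eq0 => [/allP H k ok|k ok]; last first.
  by rewrite addr_ge0 // -expr2 sqr_ge0.
have := H k (mem_index_enum k); rewrite ok /= => /eqP H'.
apply/eqP; rewrite eq_complex /=.
have h1 : 0 <= re (A i k) ^+ 2 by exact: sqr_ge0.
have h2 : 0 <= im (A i k) ^+ 2 by exact: sqr_ge0.
by rewrite -(sqrf_eq0 (re _)) -(sqrf_eq0 (im _)); apply/andP; split; apply/eqP; nra.
Qed.

Lemma row_dot_ge0 i A : 0 <= row_dot i A A.
Proof. by apply: sumr_ge0 => k _; rewrite addr_ge0 // -expr2 sqr_ge0. Qed.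

Lemma sum_pos_form (a b c d e u v w s t : R) :
  0 < a -> 0 < b -> 0 < c -> 0 < d -> 0 < e -> 0 <= s -> 0 <= t ->
  [/\ 0 <= a * (u * u) + b * (v * v) + c * (w * w) + 4 * d * s + 4 * e * t &
      a * (u * u) + b * (v * v) + c * (w * w) + 4 * d * s + 4 * e * t = 0 ->
      [/\ u = 0, v = 0, w = 0, s = 0 & t = 0]].
Proof.
move=> a0 b0 c0 d0 e0 s0 t0.
have p1 : 0 <= a * (u * u) by rewrite mulr_ge0 ?(ltW a0) // -expr2 sqr_ge0.
have p2 : 0 <= b * (v * v) by rewrite mulr_ge0 ?(ltW b0) // -expr2 sqr_ge0.
have p3 : 0 <= c * (w * w) by rewrite mulr_ge0 ?(ltW c0) // -expr2 sqr_ge0.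
have p4 : 0 <= 4 * d * s by rewrite !mulr_ge0 // ltW.
have p5 : 0 <= 4 * e * t by rewrite !mulr_ge0 // ltW.
split; first by rewrite !addr_ge0.
move=> H.
have sq0 (k x : R) : 0 < k -> k * (x * x) = 0 -> x = 0.
  by move=> k0 /eqP; rewrite mulf_eq0 gt_eqF //= mulf_eq0 orbb => /eqP.
have r0 (k x : R) : 0 < k -> 4 * k * x = 0 -> x = 0.
  by move=> k0 /eqP; rewrite !mulf_eq0 pnatr_eq0 (gt_eqF k0) /= => /eqP.
by split; [apply: (sq0 a)|apply: (sq0 b)|apply: (sq0 c)|apply: (r0 d)|apply: (r0 e)] => //;
  move: p1 p2 p3 p4 p5 H; lra.
Qed.

Lemma Gam_pos (a0 ae be ah bh : R) A : skewherm A ->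
  0 < a0 -> 0 < ae -> 0 < be -> 0 < ah -> 0 < bh ->
  [/\ 0 <= ip A (Gam a0 ae be ah bh P0 N0 A) &
      ip A (Gam a0 ae be ah bh P0 N0 A) = 0 ->
      commutator A P0 = 0 /\ commutator A N0 = 0].
Proof.
move=> sA h1 h2 h3 h4 h5; rewrite (ip_Gam0 hn) //.
have [p H] := sum_pos_form (ip A X) (ip A mu) (ip A nu) h1 h2 h3 h4 h5 (row_dot_ge0 i1 A) (row_dot_ge0 i2 A).
split; first exact: p.
move=> /H [e1 e2 e3 e4 e5].
apply/stabilizer_coords => //; split.
- by rewrite skew12 // e1 e2 mul0r.
- by apply/eqP; rewrite -subr_eq0 skew22 // e3.
- by move=> k ok; rewrite (row_dot_eq0 e4 ok) (row_dot_eq0 e5 ok).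
Qed.

End BaseAlgebra.

(** * The contact condition as a system of equations *)

Section RealAlgebra.
Context {R : realType}.

(** Here the [x_i] are the coordinates of the Reeb vector and [z_i = g_i x_i] those
    of the vector [Z] dual to [eta]. The equations express that [eta] takes the value
    1 on the Reeb vector and that [phi^2 = - 1 + eta (x) xi] on the span of [X], [mu],
    [nu]. *)
Definition contact_cond (g1 g2 g3 x1 x2 x3 : R) : Prop :=
  let z1 := g1 * x1 in let z2 := g2 * x2 in let z3 := g3 * x3 in
  [/\ z1 * x1 + z2 * x2 + z3 * x3 = 1,
   [/\ z1 * z2 * (1 - 4 * g3) = 0, z1 * z3 * (1 - 4 * g2) = 0 & z2 * z3 * (1 - 4 * g1) = 0] &
   [/\ (z3 ^+ 2 / g2 + z2 ^+ 2 / g3) / (4 * g1) + z1 * x1 = 1,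
       (z3 ^+ 2 / g1 + z1 ^+ 2 / g3) / (4 * g2) + z2 * x2 = 1 &
       (z2 ^+ 2 / g1 + z1 ^+ 2 / g2) / (4 * g3) + z3 * x3 = 1]].

(** The condition [phi^2 = - 1] on the components of index [eps/2]. *)
Definition half_cond (z1 z2 z3 ah bh : R) : Prop :=
  z3 * (ah - bh) = 0 /\ z1 ^+ 2 + z2 ^+ 2 + z3 ^+ 2 = 16 * ah * bh.

(** A coordinate of [(1 / 2) Gam^-1 [Z, B]] along [X], [mu] or [nu]. *)
Definition crossg (g u v c d : R) : R := 2^-1 * (g^-1 * (u * c - v * d)).

(** The equations are obtained by evaluating on the three basis vectors, and
    conversely suffice by linearity. *)
Lemma contact_su2 (g1 g2 g3 x1 x2 x3 : R) : 0 < g1 -> 0 < g2 -> 0 < g3 ->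
  let z1 := g1 * x1 in let z2 := g2 * x2 in let z3 := g3 * x3 in
  (z1 * x1 + z2 * x2 + z3 * x3 = 1 /\
   forall c1 c2 c3, let d1 := crossg g1 z3 z2 c2 c3 in let d2 := crossg g2 z1 z3 c3 c1 in
     let d3 := crossg g3 z2 z1 c1 c2 in let q := z1 * c1 + z2 * c2 + z3 * c3 in
     [/\ crossg g1 z3 z2 d2 d3 = - c1 + q * x1, crossg g2 z1 z3 d3 d1 = - c2 + q * x2 &
         crossg g3 z2 z1 d1 d2 = - c3 + q * x3]) <->
  contact_cond g1 g2 g3 x1 x2 x3.
Proof.
move=> p1 p2 p3 z1 z2 z3; rewrite /contact_cond -/z1 -/z2 -/z3.
have n1 : g1 != 0 by rewrite gt_eqF.
have n2 : g2 != 0 by rewrite gt_eqF.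
have n3 : g3 != 0 by rewrite gt_eqF.
have ex1 : x1 = z1 / g1 by rewrite /z1 mulrC mulKf.
have ex2 : x2 = z2 / g2 by rewrite /z2 mulrC mulKf.
have ex3 : x3 = z3 / g3 by rewrite /z3 mulrC mulKf.
move: z1 z2 z3 ex1 ex2 ex3 => z1 z2 z3 -> -> -> {x1 x2 x3}; rewrite /crossg.
have key (E L Rh k : R) : L = Rh -> E = k * (L - Rh) -> E = 0.
  by move=> -> ->; rewrite subrr mulr0.
have key1 (E L Rh k : R) : L = Rh -> E - 1 = k * (L - Rh) -> E = 1.
  by move=> e e'; apply/eqP; rewrite -subr_eq0; apply/eqP; exact: key e e'.
have key2 (L Rh u a v b w c : R) : a = 1 -> b = 0 -> c = 0 ->
    L - Rh = u * (a - 1) + v * b + w * c -> L = Rh.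
  move=> -> -> -> e; apply/eqP; rewrite -subr_eq0 e.
  by rewrite subrr !mulr0 !addr0.
split=> [[h0 h]|[h0 [a b c] [e1 e2 e3]]].
  have [A1 A2 A3] := h 1 0 0; have [B1 B2 B3] := h 0 1 0; have [C1 C2 C3] := h 0 0 1.
  split=> //; split.
  - by apply: (key _ _ _ (4 * g2 * g3) A2); field; rewrite ?n1 ?n2 ?n3.
  - by apply: (key _ _ _ (4 * g2 * g3) A3); field; rewrite ?n1 ?n2 ?n3.
  - by apply: (key _ _ _ (4 * g1 * g3) B3); field; rewrite ?n1 ?n2 ?n3.
  - by apply: (key1 _ _ _ (- 1) A1); field; rewrite ?n1 ?n2 ?n3.
  - by apply: (key1 _ _ _ (- 1) B2); field; rewrite ?n1 ?n2 ?n3.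
  - by apply: (key1 _ _ _ (- 1) C3); field; rewrite ?n1 ?n2 ?n3.
split=> // c1 c2 c3; split.
- apply: (key2 _ _ (- c1) _ (c3 / (4 * g1 * g2)) _ (c2 / (4 * g1 * g3)) _ e1 b a).
  by field; rewrite ?n1 ?n2 ?n3.
- apply: (key2 _ _ (- c2) _ (c3 / (4 * g1 * g2)) _ (c1 / (4 * g2 * g3)) _ e2 c a).
  by field; rewrite ?n1 ?n2 ?n3.
- apply: (key2 _ _ (- c3) _ (c2 / (4 * g1 * g3)) _ (c1 / (4 * g2 * g3)) _ e3 c b).
  by field; rewrite ?n1 ?n2 ?n3.
Qed.

Definition row11 (z3 : R) : R[i] := 0 +i* (- (z3 / 2)).
Definition row12 (z1 z2 : R) : R[i] := (z1 / 2) +i* (z2 / 2).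
Definition row21 (z1 z2 : R) : R[i] := (- (z1 / 2)) +i* (z2 / 2).
Definition row22 (z3 : R) : R[i] := 0 +i* (z3 / 2).

(** An entry of [(1 / 2) Gam^-1 [Z, B]] in the first or second row. *)
Definition row_rot (g : R) (u v b1 b2 : R[i]) : R[i] :=
  (2^-1)%:C * (g^-1%:C * (u * b1 + v * b2)).

(** The operator is the [2 x 2] matrix of the standard representation of [Z], whose
    rows are divided by [2 ah] and [2 bh]; its square is [- 1] exactly under
    [half_cond]. *)
Lemma contact_half (ah bh z1 z2 z3 : R) : 0 < ah -> 0 < bh ->
  (forall b1 b2, let d1 := row_rot ah (row11 z3) (row12 z1 z2) b1 b2 in
     let d2 := row_rot bh (row21 z1 z2) (row22 z3) b1 b2 in
     row_rot ah (row11 z3) (row12 z1 z2) d1 d2 = - b1 /\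
     row_rot bh (row21 z1 z2) (row22 z3) d1 d2 = - b2) <->
  half_cond z1 z2 z3 ah bh.
Proof.
move=> pa pb; have na : ah != 0 by rewrite gt_eqF.
have nb : bh != 0 by rewrite gt_eqF.
rewrite /half_cond /row_rot /row11 /row12 /row21 /row22; split=> [h|[h1 h2]].
  have [/(congr1 (@complex.Re R)) A1 e2] := h 1 0.
  have [_ /(congr1 (@complex.Re R)) B2] := h 0 1.
  move: (congr1 (@complex.Re R) e2) (congr1 (@complex.Im R) e2) A1 B2 => /=.
  move=> A2 A3 A1 B2.
  have key (E L Rh k : R) : L = Rh -> E = k * (L - Rh) -> E = 0.
    by move=> -> ->; rewrite subrr mulr0.
  have K1 : z2 * z3 * (ah - bh) = 0.
    apply: (key _ _ _ (- 16 * ah * bh ^+ 2) A2); field; by rewrite ?na ?nb.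
  have K2 : z1 * z3 * (ah - bh) = 0.
    apply: (key _ _ _ (- 16 * ah * bh ^+ 2) A3); field; by rewrite ?na ?nb.
  have K3 : z3 ^+ 2 * bh + (z1 ^+ 2 + z2 ^+ 2) * ah - 16 * ah ^+ 2 * bh = 0.
    apply: (key _ _ _ (- 16 * ah ^+ 2 * bh) A1); field; by rewrite ?na ?nb.
  have K4 : z3 ^+ 2 * ah + (z1 ^+ 2 + z2 ^+ 2) * bh - 16 * ah * bh ^+ 2 = 0.
    apply: (key _ _ _ (- 16 * ah * bh ^+ 2) B2); field; by rewrite ?na ?nb.
  have K5 : z3 * (ah - bh) = 0.
    have [->|z30] := eqVneq z3 0; first by rewrite mul0r.
    apply/eqP; rewrite mulf_eq0 (negPf z30) /=; apply/eqP.
    have : z3 ^+ 2 * (ah - bh) * (ah + bh) = 0.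
      have -> : z3 ^+ 2 * (ah - bh) * (ah + bh) =
         ah * (z3 ^+ 2 * ah + (z1 ^+ 2 + z2 ^+ 2) * bh - 16 * ah * bh ^+ 2)
         - bh * (z3 ^+ 2 * bh + (z1 ^+ 2 + z2 ^+ 2) * ah - 16 * ah ^+ 2 * bh) by ring.
      by rewrite K3 K4 !mulr0 subrr.
    move=> /eqP; rewrite mulf_eq0 => /orP[|]; last by rewrite gt_eqF // addr_gt0.
    by rewrite mulf_eq0 sqrf_eq0 (negPf z30) /= => /eqP.
  split=> //; apply: (mulfI na); apply/eqP; rewrite -subr_eq0.
  have -> : ah * (z1 ^+ 2 + z2 ^+ 2 + z3 ^+ 2) - ah * (16 * ah * bh) =
     z3 ^+ 2 * bh + (z1 ^+ 2 + z2 ^+ 2) * ah - 16 * ah ^+ 2 * bh + z3 * (z3 * (ah - bh)) by ring.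
  by rewrite K3 K5 mulr0 addr0.
have e1 : ah^-1 * bh^-1 * (z1 ^+ 2 + z2 ^+ 2 + z3 ^+ 2) = 16.
  by rewrite h2; field; rewrite ?na ?nb.
have e2 : z3 * ah^-1 = z3 * bh^-1.
  have -> : z3 * ah^-1 = z3 * bh^-1 - (z3 * (ah - bh)) / (ah * bh) by field; rewrite ?na ?nb.
  by rewrite h1 mul0r subr0.
move: (ah^-1) (bh^-1) e1 e2 => p q e1 e2 [a b] [c d] /=.
have key2 (L Rh u v : R) : p * q * (z1 ^+ 2 + z2 ^+ 2 + z3 ^+ 2) = 16 -> z3 * p = z3 * q ->
    L - Rh = u * (p * q * (z1 ^+ 2 + z2 ^+ 2 + z3 ^+ 2) - 16) + v * (z3 * p - z3 * q) -> L = Rh.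
  move=> E1 E2 e; apply/eqP; rewrite -subr_eq0 e E1 E2.
  by rewrite !subrr !mulr0 !addr0.
split; apply/eqP; rewrite eq_complex /=; apply/andP; split; apply/eqP.
- apply: (key2 _ _ (- a / 16) (- p * z3 * a / 16 + p * (z1 * d + z2 * c) / 16) e1 e2); by field.
- apply: (key2 _ _ (- b / 16) (- p * z3 * b / 16 - p * (z1 * c - z2 * d) / 16) e1 e2); by field.
- apply: (key2 _ _ (- c / 16) (q * z3 * c / 16 + q * (z2 * a - z1 * b) / 16) e1 e2); by field.
- apply: (key2 _ _ (- d / 16) (q * z3 * d / 16 + q * (z1 * a + z2 * b) / 16) e1 e2); by field.
Qed.

End RealAlgebra.

(** * Contact and Killing conditions at the base point *)

Section BaseConditions.
Context {R : realType} {n : nat} (hn : (1 <= n)%N).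
Notation C := R[i].
Notation CM := 'M[C]_n.+1.
Implicit Types (A B D M : CM).
Notation i1 := (inord 0 : 'I_n.+1).
Notation i2 := (inord 1 : 'I_n.+1).
Notation re := (@complex.Re R).
Notation im := (@complex.Im R).
Notation P0 := (E_ 1 1 : CM).
Notation N0 := (E_ 1 2 + E_ 2 1 : CM).

Definition test_row (i k : 'I_n.+1) (w : C) : CM :=
  w *: delta_mx i k - w^*%C *: delta_mx k i.

Lemma test_row_skew i k w : skewherm (test_row i k w).
Proof.
have e (a b : 'I_n.+1) (c : C) : (c *: delta_mx a b : CM)^t* = c^*%C *: delta_mx b a.
  rewrite ctZ; congr (_ *: _); apply/matrixP => u v; rewrite !mxE andbC.
  by case: (_ && _); [exact: rmorph1|exact: rmorph0].
by rewrite /skewherm /test_row ctB !e conjcK opprB.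
Qed.

Lemma test_row_entry i k w a b : test_row i k w a b =
  w * ((a == i) && (b == k))%:R - w^*%C * ((a == k) && (b == i))%:R.
Proof. by rewrite mxD mxN !mxZ ![delta_mx _ _ _ _]mxE. Qed.

(** Vectors with prescribed first two entries in one column [k], and no other
    coordinates. *)
Definition test_vec (k : 'I_n.+1) (b1 b2 : C) : CM := test_row i1 k b1 + test_row i2 k b2.

Lemma test_vec_skew k b1 b2 : skewherm (test_vec k b1 b2).
Proof. by apply: skewD; exact: test_row_skew. Qed.

Lemma test_vec_entry k b1 b2 i j : test_vec k b1 b2 i j =
  b1 * ((i == i1) && (j == k))%:R - b1^*%C * ((i == k) && (j == i1))%:R
  + (b2 * ((i == i2) && (j == k))%:R - b2^*%C * ((i == k) && (j == i2))%:R).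
Proof. exact: (etrans (mxD _ _ _ _) (f_equal2 +%R (test_row_entry _ _ _ _ _) (test_row_entry _ _ _ _ _))). Qed.

Lemma test_vec_rows k b1 b2 : outer k ->
  [/\ test_vec k b1 b2 i1 k = b1, test_vec k b1 b2 i2 k = b2 &
   forall l, outer l -> l != k -> test_vec k b1 b2 i1 l = 0 /\ test_vec k b1 b2 i2 l = 0].
Proof.
move=> ok; split.
- rewrite test_vec_entry !eqxx (neq01 hn) !(outer1 ok) !(outer2 ok) /=.
  by rewrite !mulr0 mulr1 !subr0 addr0.
- rewrite test_vec_entry !eqxx (neq10 hn) !(outer1 ok) !(outer2 ok) /=.
  by rewrite !mulr0 mulr1 !subr0 add0r.
- move=> l ol /negPf lk; rewrite !test_vec_entry !eqxx lk (neq10 hn) (neq01 hn).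
  rewrite ?(outer1 ok) ?(outer2 ok) ?andbF /=.
  by rewrite !mulr0 !subr0 !addr0.
Qed.

Lemma test_vec_ip k b1 b2 : outer k ->
  [/\ ip (test_vec k b1 b2) X = 0, ip (test_vec k b1 b2) mu = 0 & ip (test_vec k b1 b2) nu = 0].
Proof.
move=> ok; rewrite ip_X ip_mu ip_nu.
have z a b : ~~ outer a -> ~~ outer b -> test_vec k b1 b2 a b = 0.
  move=> oa ob; have ak : (a == k) = false by apply: contraNF oa => /eqP ->.
  have bk : (b == k) = false by apply: contraNF ob => /eqP ->.
  by rewrite test_vec_entry ak bk !andbF !mulr0 !subr0 addr0.
by rewrite !z ?outer_i1 ?outer_i2 //= !subrr addr0.
Qed.

Lemma vpt_ip x y z :
  [/\ ip (vpt x y z P0 N0) X = x, ip (vpt x y z P0 N0) mu = y & ip (vpt x y z P0 N0) nu = z].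
Proof.
rewrite ip_X ip_mu ip_nu (vpt12 hn) (vpt21 hn) (vpt11 hn) (vpt22 hn) /=.
by rewrite !opprK -!splitr.
Qed.

Lemma outer_exists : (1 < n)%N -> outer (inord 2 : 'I_n.+1).
Proof. by move=> n1; rewrite /outer -!val_eqE /= !inordK. Qed.

Lemma outer_gt1 (k : 'I_n.+1) : outer k -> (1 < n)%N.
Proof.
rewrite /outer -!val_eqE /= !inordK // => /andP[k0 k1].
have := ltn_ord k; case: (val k) k0 k1 => [|[|m]] // _ _.
by rewrite ltnS => /(leq_trans _); apply.
Qed.

Section Contact.
Context (a0 ae be ah bh x y z : R).
Hypotheses (p1 : 0 < a0) (p2 : 0 < ae) (p3 : 0 < be) (p4 : 0 < ah) (p5 : 0 < bh).
Notation Z0 := (vpt (a0 * x) (ae * y) (be * z) P0 N0).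
Notation v0 := (vpt x y z P0 N0).

(** The only candidate for [phi], since [d eta (A, B) = (1 / 2) ip A [Z, B]] must be
    equal to [ip A (Gam (phi B))]. *)
Definition phi_op (P N B : CM) : CM :=
  (2^-1)%:C *: Gam a0^-1 ae^-1 be^-1 ah^-1 bh^-1 P N
     (commutator (vpt (a0 * x) (ae * y) (be * z) P N) B).
Notation phi0 := (phi_op P0 N0).

Lemma phi_op_skew P N B : flag P N -> skewherm B -> skewherm (phi_op P N B).
Proof.
move=> fl sB; apply: skewZ; apply: (Gam_skew fl); apply: comm_skew => //.
exact: vpt_skew.
Qed.

Lemma phi0_coords B : skewherm B ->
  [/\ ip (phi0 B) X = crossg a0 (be * z) (ae * y) (ip B mu) (ip B nu),
      ip (phi0 B) mu = crossg ae (a0 * x) (be * z) (ip B nu) (ip B X),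
      ip (phi0 B) nu = crossg be (ae * y) (a0 * x) (ip B X) (ip B mu) &
   forall k, outer k ->
     phi0 B i1 k = row_rot ah (row11 (be * z)) (row12 (a0 * x) (ae * y)) (B i1 k) (B i2 k) /\
     phi0 B i2 k = row_rot bh (row21 (a0 * x) (ae * y)) (row22 (be * z)) (B i1 k) (B i2 k)].
Proof.
move=> sB; have fl := @flag_E R n hn.
have sC : skewherm (commutator Z0 B) by apply: comm_skew => //; exact: vpt_skew.
have [e1 e2 e3] := ip_comm_vpt hn (a0 * x) (ae * y) (be * z) B.
have row := fun i k => @comm_vpt_row R n hn (a0 * x) (ae * y) (be * z) i B k.
move: sC e1 e2 e3 row; rewrite /phi_op; move: (commutator Z0 B) => D sD e1 e2 e3 row.
have [f1 f2 f3] := ip_Gam hn a0^-1 ae^-1 be^-1 ah^-1 bh^-1 sD.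
split.
- by rewrite ipZl f1 e1.
- by rewrite ipZl f2 e2.
- by rewrite ipZl f3 e3.
- move=> k ok; rewrite !mxZ (Gam1k hn _ _ _ _ _ _ ok) (Gam2k hn _ _ _ _ _ _ ok) !row //.
  by rewrite (vpt11 hn) (vpt12 hn) (vpt21 hn) (vpt22 hn).
Qed.

Lemma phi0_coords_of B c1 c2 c3 : skewherm B ->
  ip B X = c1 -> ip B mu = c2 -> ip B nu = c3 ->
  [/\ ip (phi0 B) X = crossg a0 (be * z) (ae * y) c2 c3,
      ip (phi0 B) mu = crossg ae (a0 * x) (be * z) c3 c1 &
      ip (phi0 B) nu = crossg be (ae * y) (a0 * x) c1 c2].
Proof. by move=> sB <- <- <-; have [] := phi0_coords sB. Qed.

Lemma reeb_coords_of B c1 c2 c3 : skewherm B ->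
  ip B X = c1 -> ip B mu = c2 -> ip B nu = c3 ->
  let q := a0 * x * c1 + ae * y * c2 + be * z * c3 in
  [/\ ip (- B + (ip B Z0)%:C *: v0) X = - c1 + q * x,
      ip (- B + (ip B Z0)%:C *: v0) mu = - c2 + q * y &
      ip (- B + (ip B Z0)%:C *: v0) nu = - c3 + q * z].
Proof.
move=> sB e1 e2 e3 q; have [v1 v2 v3] := vpt_ip x y z.
have -> : ip B Z0 = q by rewrite (ip_vpt hn) e1 e2 e3.
have H M c d : ip B M = c -> ip v0 M = d -> ip (- B + q%:C *: v0) M = - c + q * d.
  by move=> <- <-; rewrite ipDl ipNl ipZl.
by split; apply: H.
Qed.

(** Both operators preserve the span of [X], [mu], [nu] and, for each column,
    the pair of entries of index [eps/2]; these pieces can be tested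
    separately. *)
Lemma contact_base :
  (ip v0 Z0 = 1 /\ forall B, skewherm B ->
     same_coords (phi0 (phi0 B)) (- B + (ip B Z0)%:C *: v0)) <->
  contact_cond a0 ae be x y z /\
  ((1 < n)%N -> half_cond (a0 * x) (ae * y) (be * z) ah bh).
Proof.
have fl := @flag_E R n hn.
have [v1 v2 v3] := vpt_ip x y z.
have vZ : ip v0 Z0 = a0 * x * x + ae * y * y + be * z * z.
  by rewrite (ip_vpt hn) v1 v2 v3.
have sv : skewherm v0 by exact: vpt_skew.
have rows B k : outer k -> (- B + (ip B Z0)%:C *: v0) i1 k = - B i1 k /\
    (- B + (ip B Z0)%:C *: v0) i2 k = - B i2 k.
  move: (ip B Z0) => q ok; have e i : v0 i k = 0 by exact: vpt_outer_r.
  by split; rewrite mxD mxN mxZ e mulr0 addr0.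
have srhs B : skewherm B -> skewherm (- B + (ip B Z0)%:C *: v0).
  by move=> sB; apply: skewD; [exact: skewN|exact: skewZ].
rewrite vZ -(contact_su2 x y z p1 p2 p3); split=> [[h0 h]|[[h0 h] h']].
  split; first split=> //.
    move=> c1 c2 c3.
    have sB : skewherm (vpt c1 c2 c3 P0 N0) by exact: vpt_skew.
    have [b1 b2 b3] := vpt_ip c1 c2 c3.
    have [f1 f2 f3] := phi0_coords_of sB b1 b2 b3.
    have sB' := phi_op_skew fl sB; have [g1 g2 g3] := phi0_coords_of sB' f1 f2 f3.
    have sB'' := phi_op_skew fl sB'.
    have [r1 r2 r3] := reeb_coords_of sB b1 b2 b3.
    have /(same_coords_ip sB'' (srhs _ sB)) [E1 E2 E3 _] := h _ sB.
    split; [exact: etrans (esym g1) (etrans E1 r1)|exact: etrans (esym g2) (etrans E2 r2)|].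
    exact: etrans (esym g3) (etrans E3 r3).
  move=> n1; apply/(contact_half _ _ _ p4 p5) => b1 b2.
  have ok := outer_exists n1; set k := inord 2 in ok.
  have sB := test_vec_skew k b1 b2; have [t1 t2 _] := test_vec_rows b1 b2 ok.
  have [_ _ H] := h _ sB; have [_ _ _ f] := phi0_coords sB.
  have sB' := phi_op_skew fl sB; have [_ _ _ g] := phi0_coords sB'.
  have [f1 f2] := f k ok; have [g1 g2] := g k ok.
  have [E1 E2] := H k ok; have [r1 r2] := rows (test_vec k b1 b2) k ok.
  move: (etrans (esym g1) (etrans E1 r1)) (etrans (esym g2) (etrans E2 r2)).
  by rewrite f1 f2 t1 t2.
split=> // B sB.
have [f1 f2 f3] := phi0_coords_of sB erefl erefl erefl.
have sB' := phi_op_skew fl sB; have [g1 g2 g3] := phi0_coords_of sB' f1 f2 f3.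
have sB'' := phi_op_skew fl sB'.
have [r1 r2 r3] := reeb_coords_of sB erefl erefl erefl.
apply/(same_coords_ip sB'' (srhs _ sB)).
have [E1 E2 E3] := h (ip B X) (ip B mu) (ip B nu).
split; [exact: etrans g1 (etrans E1 (esym r1))|exact: etrans g2 (etrans E2 (esym r2))|
        exact: etrans g3 (etrans E3 (esym r3))|].
move=> k ok; have [_ _ _ f] := phi0_coords sB; have [_ _ _ g] := phi0_coords sB'.
have [F1 F2] := f k ok; have [G1 G2] := g k ok; have [R1 R2] := rows B k ok.
have /(contact_half _ _ _ p4 p5) H := h' (outer_gt1 ok).
have [H1 H2] := H (B i1 k) (B i2 k).
split.
  exact: etrans (etrans G1 (f_equal2 (row_rot _ _ _) F1 F2)) (etrans H1 (esym R1)).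
exact: etrans (etrans G2 (f_equal2 (row_rot _ _ _) F1 F2)) (etrans H2 (esym R2)).
Qed.

End Contact.

Lemma row_dot_tests k b1 b2 i A : outer k -> (i = i1 \/ i = i2) ->
  row_dot i (test_vec k b1 b2) A =
  re (test_vec k b1 b2 i k) * re (A i k) + im (test_vec k b1 b2 i k) * im (A i k).
Proof.
move=> ok hi; have [_ _ h] := test_vec_rows b1 b2 ok.
rewrite /row_dot (bigD1 k) //= big1 ?addr0 // => l /andP[ol lk].
have [z1 z2] := h l ol lk.
by case: hi => ->; rewrite ?z1 ?z2 /= !mul0r addr0.
Qed.

Lemma row_dot_tests_of k b1 b2 i A t u : outer k -> (i = i1 \/ i = i2) ->
  test_vec k b1 b2 i k = t -> A i k = u ->
  row_dot i (test_vec k b1 b2) A = re t * re u + im t * im u.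
Proof. by move=> ok hi <- <-; exact: row_dot_tests. Qed.

Lemma row_dotC i A B : row_dot i A B = row_dot i B A.
Proof. by apply: eq_bigr => k _; rewrite mulrC [X in _ + X]mulrC. Qed.

Section Killing.
Context (a0 ae be ah bh x y z : R).
Notation v0 := (vpt x y z P0 N0).
Notation Gam0 := (Gam a0 ae be ah bh P0 N0).

(** The map [ad v] is skew for the metric on the span of [X], [mu], [nu]. *)
Definition kill_cond : Prop :=
  [/\ x * (ae - be) = 0, y * (a0 - be) = 0 & z * (a0 - ae) = 0].
(** The map [ad v] is skew for the metric on the components of index [eps/2]. *)
Definition kill_half : Prop := (ah - bh) * x = 0 /\ (ah - bh) * y = 0.

(** The derivative of the metric along the flow of the invariant field, as a
    function of the coordinates. *)
Lemma killing_form A B a1 a2 a3 b1 b2 b3 : skewherm A -> skewherm B ->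
  ip A X = a1 -> ip A mu = a2 -> ip A nu = a3 ->
  ip B X = b1 -> ip B mu = b2 -> ip B nu = b3 ->
  ip (commutator v0 A) (Gam0 B) + ip A (Gam0 (commutator v0 B)) =
  a0 * ((z * a2 - y * a3) * b1 + a1 * (z * b2 - y * b3))
  + ae * ((x * a3 - z * a1) * b2 + a2 * (x * b3 - z * b1))
  + be * ((y * a1 - x * a2) * b3 + a3 * (y * b1 - x * b2))
  + 4 * ah * (row_dot i1 (commutator v0 A) B + row_dot i1 A (commutator v0 B))
  + 4 * bh * (row_dot i2 (commutator v0 A) B + row_dot i2 A (commutator v0 B)).
Proof.
move=> sA sB eA1 eA2 eA3 eB1 eB2 eB3; have fl := @flag_E R n hn.
have sv : skewherm v0 by exact: vpt_skew.
have [cA1 cA2 cA3] := ip_comm_vpt hn x y z A.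
have [cB1 cB2 cB3] := ip_comm_vpt hn x y z B.
have sCA := comm_skew sv sA; have sCB := comm_skew sv sB.
rewrite (ip_Gam0 hn _ _ _ _ _ sCA sB) (ip_Gam0 hn _ _ _ _ _ sA sCB).
have e1 := etrans cA1 (f_equal2 (fun a b => z * a - y * b) eA2 eA3).
have e2 := etrans cA2 (f_equal2 (fun a b => x * a - z * b) eA3 eA1).
have e3 := etrans cA3 (f_equal2 (fun a b => y * a - x * b) eA1 eA2).
have g1 := etrans cB1 (f_equal2 (fun a b => z * a - y * b) eB2 eB3).
have g2 := etrans cB2 (f_equal2 (fun a b => x * a - z * b) eB3 eB1).
have g3 := etrans cB3 (f_equal2 (fun a b => y * a - x * b) eB1 eB2).
have P u u' w w' : u = u' -> w = w' -> u * w = u' * w' :> R by move=> -> ->.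
have S5 (s1 s2 s3 t1 t2 t3 s1' s2' s3' t1' t2' t3' r1 r2 q1 q2 : R) :
   s1 = s1' -> s2 = s2' -> s3 = s3' -> t1 = t1' -> t2 = t2' -> t3 = t3' ->
   a0 * s1 + ae * s2 + be * s3 + 4 * ah * r1 + 4 * bh * r2
   + (a0 * t1 + ae * t2 + be * t3 + 4 * ah * q1 + 4 * bh * q2) =
   a0 * (s1' + t1') + ae * (s2' + t2') + be * (s3' + t3') + 4 * ah * (r1 + q1) + 4 * bh * (r2 + q2).
  by move=> -> -> -> -> -> ->; ring.
by apply: S5; apply: P.
Qed.

(** Besides the three basis vectors, it is enough to test pairs of vectors having a
    single entry, one in each of the two rows. *)
Lemma killing_base :
  (forall A B, skewherm A -> skewherm B ->
    ip (commutator v0 A) (Gam0 B) + ip A (Gam0 (commutator v0 B)) = 0) <->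
  kill_cond /\ ((1 < n)%N -> kill_half).
Proof.
have fl := @flag_E R n hn.
split=> [h|[[k1 k2 k3] kh] A B sA sB].
  have su2 a1 a2 a3 b1 b2 b3 :
      a0 * ((z * a2 - y * a3) * b1 + a1 * (z * b2 - y * b3))
    + ae * ((x * a3 - z * a1) * b2 + a2 * (x * b3 - z * b1))
    + be * ((y * a1 - x * a2) * b3 + a3 * (y * b1 - x * b2)) = 0.
    have sA : skewherm (vpt a1 a2 a3 P0 N0) by exact: vpt_skew.
    have sB : skewherm (vpt b1 b2 b3 P0 N0) by exact: vpt_skew.
    have [eA1 eA2 eA3] := vpt_ip a1 a2 a3; have [eB1 eB2 eB3] := vpt_ip b1 b2 b3.
    have := esym (killing_form sA sB eA1 eA2 eA3 eB1 eB2 eB3); rewrite (h _ _ sA sB).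
    have r i D c1 c2 c3 : row_dot i D (vpt c1 c2 c3 P0 N0) = 0.
      by apply: big1 => k ok; rewrite (vpt_outer_r hn) //= !mulr0 addr0.
    have r' i D c1 c2 c3 : row_dot i (vpt c1 c2 c3 P0 N0) D = 0 by rewrite row_dotC r.
    by rewrite !r !r' !addr0 !mulr0 !addr0.
  split.
    split.
    - by have := su2 0 1 0 0 0 1; rewrite !(mul0r, mulr0, mul1r, mulr1, addr0, add0r, subr0, sub0r) => e; rewrite -[RHS]e; ring.
    - by have := su2 1 0 0 0 0 1; rewrite !(mul0r, mulr0, mul1r, mulr1, addr0, add0r, subr0, sub0r) => e; apply: oppr_inj; rewrite oppr0 -[RHS]e; ring.
    - by have := su2 1 0 0 0 1 0; rewrite !(mul0r, mulr0, mul1r, mulr1, addr0, add0r, subr0, sub0r) => e; rewrite -[RHS]e; ring.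
  move=> n1; have ok := outer_exists n1; set k := inord 2 in ok.
  have T (w : C) : 4 * ah * re (row12 x y * w) + 4 * bh * (re (row21 x y) * re w + im (row21 x y) * im w) = 0.
    (* Only the products of one row of [A] with the other row of [B] survive. *)
  have sA := test_vec_skew k 1 0; have sB := test_vec_skew k 0 w.
    have [eA1 eA2 eA3] := test_vec_ip 1 0 ok; have [eB1 eB2 eB3] := test_vec_ip 0 w ok.
    have := esym (killing_form sA sB eA1 eA2 eA3 eB1 eB2 eB3); rewrite (h _ _ sA sB).
    have [tA1 tA2 _] := test_vec_rows 1 0 ok; have [tB1 tB2 _] := test_vec_rows 0 w ok.
    have rA i := etrans (comm_vpt_row hn x y z i (test_vec k 1 0) ok)
      (f_equal2 (fun a b => v0 i i1 * a + v0 i i2 * b) tA1 tA2).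
    have rB i := etrans (comm_vpt_row hn x y z i (test_vec k 0 w) ok)
      (f_equal2 (fun a b => v0 i i1 * a + v0 i i2 * b) tB1 tB2).
    have d1 := etrans (row_dotC i1 (commutator v0 (test_vec k 1 0)) (test_vec k 0 w))
      (row_dot_tests_of ok (or_introl erefl) tB1 (rA i1)).
    have d2 := etrans (row_dotC i2 (commutator v0 (test_vec k 1 0)) (test_vec k 0 w))
      (row_dot_tests_of ok (or_intror erefl) tB2 (rA i2)).
    have d3 := row_dot_tests_of ok (or_introl erefl) tA1 (rB i1).
    have d4 := row_dot_tests_of ok (or_intror erefl) tA2 (rB i2).
    have S5 (u r1 r2 q1 q2 r1' r2' q1' q2' : R) : r1 = r1' -> q1 = q1' -> r2 = r2' -> q2 = q2' ->
        u + 4 * ah * (r1 + r2) + 4 * bh * (q1 + q2) = 0 ->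
        u + 4 * ah * (r1' + r2') + 4 * bh * (q1' + q2') = 0.
      by move=> -> -> -> ->.
    move=> e0; have := S5 _ _ _ _ _ _ _ _ _ d1 d2 d3 d4 e0.
    rewrite (vpt11 hn) (vpt12 hn) (vpt21 hn) (vpt22 hn) /row12 /row21.
    case: (w) => c d /= e.
    by rewrite -[RHS]e; ring.
  split.
  - have := T 1; rewrite /row12 /row21 /= => e; apply: (mulfI (_ : 2 != 0 :> R)); first by rewrite pnatr_eq0.
    by rewrite mulr0 -[RHS]e; field.
  - have := T 'i%C; rewrite /row12 /row21 /= => e; apply: (mulfI (_ : - 2 != 0 :> R)); first by rewrite oppr_eq0 pnatr_eq0.
    by rewrite mulr0 -[RHS]e; field.
have -> := killing_form sA sB erefl erefl erefl erefl erefl erefl.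
move: (ip A X) (ip A mu) (ip A nu) (ip B X) (ip B mu) (ip B nu) => a1 a2 a3 b1 b2 b3.
have half : 4 * ah * (row_dot i1 (commutator v0 A) B + row_dot i1 A (commutator v0 B))
  + 4 * bh * (row_dot i2 (commutator v0 A) B + row_dot i2 A (commutator v0 B)) = 0.
  rewrite /row_dot -!big_split /= !mulr_sumr -big_split /= big1 // => k ok.
  have [h1 h2] := kh (outer_gt1 ok).
  rewrite !(comm_vpt_row hn) // (vpt11 hn) (vpt12 hn) (vpt21 hn) (vpt22 hn).
  case: (A i1 k) (A i2 k) (B i1 k) (B i2 k) => [p p'] [q q'] [s s'] [t t'] /=.
  have E : forall L, L = (ah - bh) * x * (2 * (q * s + q' * s' + p * t + p' * t'))
     + (ah - bh) * y * (2 * (q * s' - q' * s - p * t' + p' * t)) -> L = 0.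
    by move=> L ->; rewrite h1 h2 !mul0r addr0.
  by apply: E; field.
rewrite -addrA half addr0.
have E : forall L, L = x * (ae - be) * (a2 * b3 + a3 * b2) + y * (a0 - be) * (- a1 * b3 - a3 * b1)
   + z * (a0 - ae) * (a1 * b2 + a2 * b1) -> L = 0.
  by move=> L ->; rewrite k1 k2 k3 !mul0r !addr0.
by apply: E; ring.
Qed.

End Killing.

End BaseConditions.

(** * Frames and derivatives along the action *)

Lemma iff_and (P P' Q Q' : Prop) : (P <-> P') -> (Q <-> Q') -> (P /\ Q <-> P' /\ Q').
Proof. by move=> e1 e2; rewrite e1 e2. Qed.

Section Frames.
Context {R : realType} {n : nat} (hn : (1 <= n)%N) (r : R) (hr : 0 < r).
Notation C := R[i].
Notation CM := 'M[C]_n.+1.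
Notation RM := ('M[R]_n.+1 * 'M[R]_n.+1)%type.
Notation TM := (RM * RM)%type.
Implicit Types (A B M : CM) (p u v w : TM).
Notation P0 := (E_ 1 1 : CM).
Notation N0 := (E_ 1 2 + E_ 2 1 : CM).
Local Notation S := (@TrCP R n r).
Local Notation Nm := (@Nm R n r).

(** The manifold being an orbit, statements about [(P, N)] that are invariant by
    conjugation may be checked at the base point. *)
Lemma frameP p : S p -> exists2 a : CM, a \is unitarymx & Pm p = cj a P0 /\ Nm p = cj a N0.
Proof.
case/(TrCP_unitary hr) => a ua ->; exists a => //; split.
  exact: (etrans (Pm_act _ _) (congr1 (cj a) (Pm_oH r))).
exact: (etrans (Nm_act r _ _) (congr1 (cj a) (Nm_oH hr hn))).
Qed.

Lemma inf_act_eqP A B p : inf_act A p = inf_act B p <->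
  commutator A (Pm p) = commutator B (Pm p) /\ commutator A (Nm p) = commutator B (Nm p).
Proof.
rewrite (inf_actP hr).
have -> : Pm (inf_act B p) = commutator B (Pm p) by exact: Pm_inf_act.
by have -> : Nm (inf_act B p) = commutator B (Nm p) by exact: Nm_inf_act.
Qed.

Lemma inf_act_frame a A B p : a \is unitarymx -> Pm p = cj a P0 -> Nm p = cj a N0 ->
  skewherm A -> skewherm B ->
  inf_act (cj a A) p = inf_act (cj a B) p <-> same_coords A B.
Proof.
move=> ua eP eN sA sB; apply: (iff_trans (inf_act_eqP _ _ _)).
apply: (iff_trans _ (same_coordsP hn sA sB)).
move: (Pm p) (Nm p) eP eN => P N -> -> {P N}.
have K D D' Q : commutator (cj a D) (cj a Q) = commutator (cj a D') (cj a Q) <->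
    commutator D Q = commutator D' Q.
  have e1 := cj_comm ua D Q; have e2 := cj_comm ua D' Q.
  apply: (iff_trans (B := cj a (commutator D Q) = cj a (commutator D' Q))).
    by split=> h; [exact: etrans e1 (etrans h (esym e2))|exact: etrans (esym e1) (etrans h e2)].
  by split=> [/(can_inj (cjVK ua))|->].
exact: iff_and (K A B _) (K A B _).
Qed.

Lemma frame_skew a A : a \is unitarymx -> skewherm A ->
  exists2 B, skewherm B & A = cj a B.
Proof. by move=> ua sA; exists (cj (a^t*) A); [exact: cj_skew|rewrite cjK]. Qed.

(** All derivatives of equivariant objects below are taken along this curve. *)
Lemma action_curve A : skewherm A -> exists c : R -> CM,
  [/\ forall t, c t \is unitarymx, c 0 = 1%:M,
      forall p, S p -> curve_at S p (inf_act A p) (fun t => act (c t) p),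
      forall p, is_derive (0 : R) (1 : R) (fun t => act (c t) p) (inf_act A p)
    & forall M, isDM (0 : R) (1 : R) (fun t => cj ((c t)^t*) M) (- commutator A M)].
Proof.
move=> sA; have [c [uc c0 dc]] := unitary_curve sA.
have D M : isDM (0 : R) (1 : R) (fun t => cj (c t) M) (commutator A M).
  have := isDMM (isDMM dc (isDM_cst _ _ M)) (isDMJ dc).
  rewrite c0 ct1 mulmx0 addr0 mulmx1 mul1mx sA mulmxN.
  exact.
have D' p : is_derive (0 : R) (1 : R) (fun t => act (c t) p) (inf_act A p).
  by apply: is_derive_pair; apply: is_derive_reim; exact: D.
exists c; split=> //; last first.
  move=> M; have := isDMM (isDMM (isDMJ dc) (isDM_cst _ _ M)) dc.
  rewrite c0 ct1 mulmx0 addr0 mulmx1 mul1mx sA mulNmx.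
  have -> : - (A *m M) + M *m A = - commutator A M by rewrite commutatorE opprB addrC.
  have -> // : (fun t => cj ((c t)^t*) M) = (fun t => (c t)^t* *m M *m c t).
  by apply/funext => t; rewrite /cj ctK.
move=> p Sp; split=> //.
- by move=> t; exact: (TrCP_act hr).
- by rewrite c0 (act1 hr).
Qed.

(** For a map that is smooth on [S], one curve computes [tder]. *)
Lemma tder_curve (F : normedModType R) (f : TM -> F) p w z c :
  smooth_on S f -> S p -> curve_at S p w c ->
  is_derive (0 : R) (1 : R) (fun t => f (c t)) z -> tder S f p w = z.
Proof.
move=> sf Sp cc dz; have [f' sf' ff'] := sf _ Sp.
have tw : tangent S p w by exists c.
rewrite (tder_smooth tw sf' ff'); case: cc => Sc c0 dc.
have dc' := is_derive_comp_curve (smooth_diff p sf') c0 dc.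
apply: (is_derive_uniq dc'); apply: near_eq_is_derive dz.
have cc : {for 0, continuous c}.
  by apply/differentiable_continuous/derivable1_diffP; case: dc.
have H : nbhs (c 0) [set q | S q -> f' q = f q] by rewrite c0.
have : \forall t \near (0 : R), S (c t) -> f' (c t) = f (c t) by exact: (cc _ H).
by apply: filterS => t /(_ (Sc t)).
Qed.

(** Equivariance gives [f (act (c t) p) = act (c t) (f p)] along the flow of [A]. *)
Lemma tder_equivariant (f : TM -> TM) p A : smooth_on S f ->
  (forall a q, a \is unitarymx -> S q -> f (act a q) = act a (f q)) ->
  S p -> skewherm A -> tder S f p (inf_act A p) = inf_act A (f p).
Proof.
move=> sf ef Sp sA; have [c [uc c0 cc dc _]] := action_curve sA.
apply: (tder_curve sf Sp (cc p Sp)).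
have -> : (fun t => f (act (c t) p)) = (fun t => act (c t) (f p)).
  by apply/funext => t; exact: ef.
exact: dc.
Qed.

Lemma is_derive_ip (A B : R -> CM) dA dB :
  isDM (0 : R) (1 : R) A dA -> isDM (0 : R) (1 : R) B dB ->
  is_derive (0 : R) (1 : R) (fun t => ip (A t) (B t) : R^o) (ip dA (B 0) + ip (A 0) dB).
Proof.
move=> DA DB; have [D _] := isDC_tr (isDMM DA DB).
have -> : ip dA (B 0) + ip (A 0) dB = - 2 * complex.Re (\tr (dA *m B 0 + A 0 *m dB)).
  by rewrite mxtraceD cReD mulrDr.
exact: is_deriveZ.
Qed.

End Frames.

(** * Smoothness of the invariant metrics *)

Section Metric.
Context {R : realType} {n : nat} (hn : (1 <= n)%N) (r : R) (hr : 0 < r).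
Notation C := R[i].
Notation CM := 'M[C]_n.+1.
Notation RM := ('M[R]_n.+1 * 'M[R]_n.+1)%type.
Notation TM := (RM * RM)%type.
Implicit Types (A B M : CM) (p u v w : TM).
Notation P0 := (E_ 1 1 : CM).
Notation N0 := (E_ 1 2 + E_ 2 1 : CM).
Notation i1 := (inord 0 : 'I_n.+1).
Notation i2 := (inord 1 : 'I_n.+1).
Local Notation S := (@TrCP R n r).
Local Notation Nm := (@Nm R n r).
Local Notation lie_lift := (@lie_lift R n r).

Section Coefficients.
Context (a0 ae be ah bh : R).
Notation G := (Gam a0 ae be ah bh).

(** This expression makes sense for all vectors of the ambient space, which gives a
    smooth extension of the metric. *)
Definition can_metric p u v : R :=
  ip (lie_lift p u) (G (Pm p) (Nm p) (lie_lift p v)).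

Lemma ip_Gam_same A A' B B' : skewherm A -> skewherm A' -> skewherm B -> skewherm B' ->
  same_coords A A' -> same_coords B B' -> ip A (G P0 N0 B) = ip A' (G P0 N0 B').
Proof.
move=> sA sA' sB sB' /(same_coords_ip sA sA')[a1 a2 a3 a4].
move=> /(same_coords_ip sB sB')[b1 b2 b3 b4].
have row i : i = i1 \/ i = i2 -> row_dot i A B = row_dot i A' B'.
  by case=> ->; apply: eq_bigr => k ok; have [x1 x2] := a4 k ok; have [y1 y2] := b4 k ok;
    rewrite ?x1 ?x2 ?y1 ?y2.
rewrite (ip_Gam0 hn _ _ _ _ _ sA sB) (ip_Gam0 hn _ _ _ _ _ sA' sB').
rewrite (row i1) ?(row i2); [|by right|by left].
by move: a1 a2 a3 b1 b2 b3 => -> -> -> -> -> ->.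
Qed.

(** [lie_lift] may differ from [A] by an element of the stabiliser, on which
    [Gam] vanishes. *)
Lemma can_metric_inf_act p A B : S p -> skewherm A -> skewherm B ->
  can_metric p (inf_act A p) (inf_act B p) = ip A (G (Pm p) (Nm p) B).
Proof.
move=> Sp sA sB; rewrite /can_metric.
have tA := tangent_inf_act hr Sp sA; have tB := tangent_inf_act hr Sp sB.
move: (lie_lift_skew r p (inf_act A p)) (lie_lift_skew r p (inf_act B p)).
move: (lie_liftK hr hn Sp tA) (lie_liftK hr hn Sp tB).
move: (lie_lift p _) (lie_lift p _) => A' B' + + sA' sB'.
have [a ua [eP eN]] := frameP hn hr Sp.
have [A0 sA0 ->] := frame_skew ua sA; have [A0' sA0' ->] := frame_skew ua sA'.
have [B0 sB0 ->] := frame_skew ua sB; have [B0' sB0' ->] := frame_skew ua sB'.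
move=> /(inf_act_frame hn hr ua eP eN sA0' sA0) hA.
move=> /(inf_act_frame hn hr ua eP eN sB0' sB0) hB.
move: (Pm p) (Nm p) eP eN => P N -> ->.
rewrite !(Gam_cj ua) !(ip_cj _ _ ua).
exact: ip_Gam_same.
Qed.

Lemma can_metric_lin p u v v' (k : R) :
  can_metric p u (k *: v + v') = k * can_metric p u v + can_metric p u v'.
Proof. by rewrite /can_metric lie_lift_lin Gam_lin ipDr ipZr. Qed.

Lemma can_metric_linl p u v v' (k : R) :
  can_metric p (k *: v + v') u = k * can_metric p v u + can_metric p v' u.
Proof. by rewrite /can_metric lie_lift_lin ipDl ipZl. Qed.

Section Smoothness.
Context {E : normedModType R}.

Lemma smooth_ip (A B : E -> CM) : smM A -> smM B -> smooth (fun q => ip (A q) (B q) : R^o).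
Proof.
move=> sA sB; have [s _] := smC_tr (smMM sA sB).
exact: smoothM (smooth_cst _ _) s.
Qed.

Lemma smC_real (f : E -> R^o) : smooth f -> smC (fun q => (f q)%:C : C).
Proof. by move=> sf; split => //=; exact: smooth_cst. Qed.

Lemma smM_Xpt (P N : E -> CM) : smM P -> smM N -> smM (fun q => Xpt (P q) (N q)).
Proof. by move=> sP sN; rewrite Xpt.unlock; apply/smMZc/smMB; exact: smMM. Qed.

Lemma smM_mupt (N : E -> CM) : smM N -> smM (fun q => mupt (N q)).
Proof. by move=> sN; rewrite mupt.unlock; exact/smMZc. Qed.

Lemma smM_nupt (P N : E -> CM) : smM P -> smM N -> smM (fun q => nupt (P q) (N q)).
Proof.
by move=> sP sN; rewrite nupt.unlock; apply/smMZc/smMB; [exact: smMD|exact: smMM].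
Qed.

Lemma smM_vpt (x y z : E -> R^o) (P N : E -> CM) : smooth x -> smooth y -> smooth z ->
  smM P -> smM N -> smM (fun q => vpt (x q) (y q) (z q) (P q) (N q)).
Proof.
move=> sx sy sz sP sN; apply: smMD; first apply: smMD.
- exact: smMZ (smC_real sx) (smM_Xpt sP sN).
- exact: smMZ (smC_real sy) (smM_mupt sN).
- exact: smMZ (smC_real sz) (smM_nupt sP sN).
Qed.

Lemma smM_halfpart (D N B : E -> CM) : smM D -> smM N -> smM B ->
  smM (fun q => halfpart (D q) (N q) (B q)).
Proof.
move=> sD sN sB; rewrite /halfpart.
have sT : smM (fun q => Tpt (N q)) by rewrite Tpt.unlock; apply: smMB; [exact: smM_cst|exact: smMM].
by apply: smMD; do 2 apply: smMM => //.
Qed.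

Lemma smM_Gam (P N B : E -> CM) : smM P -> smM N -> smM B ->
  smM (fun q => G (P q) (N q) (B q)).
Proof.
move=> sP sN sB; rewrite /Gam; have sc (c : R^o) (f : E -> R^o) : smooth f -> smooth (fun q => c * f q : R^o).
  by move=> sf; exact: smoothM (smooth_cst _ _) sf.
apply: smMD; first apply: smMD.
- apply: smM_vpt => //; apply: sc; apply: smooth_ip => //;
    [exact: smM_Xpt|exact: smM_mupt|exact: smM_nupt].
- exact/smMZc/smM_halfpart.
- by apply/smMZc/smM_halfpart => //; apply: smMB => //; exact: smMM.
Qed.

Lemma smooth_can_metric (f u v : E -> TM) : smooth f -> smooth u -> smooth v ->
  smooth (fun q => can_metric (f q) (u q) (v q) : R^o).
Proof.
move=> sf su sv; apply: smooth_ip; first exact: smM_lie_lift.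
by apply: smM_Gam; [exact: smM_Pm|exact: smM_Nm|exact: smM_lie_lift].
Qed.

End Smoothness.

Definition can_form (x : TM * (TM * TM)) : R^o := can_metric x.1 x.2.1 x.2.2.

Lemma can_form_diff x : differentiable can_form x.
Proof.
apply: smooth_diff; have TM2 : all_linear_continuous (TM * (TM * TM))%type.
  by do 2 apply: (all_linear_continuous_prod TM_cont); exact: TM_cont.
apply: (smooth_can_metric (f := fst) (u := fun x => x.2.1) (v := fun x => x.2.2));
  by apply: (smooth_lin TM2).
Qed.

End Coefficients.
End Metric.

(** * The contact metric structure of an invariant pair *)

Section Structure.
Context {R : realType} {n : nat} (hn : (1 <= n)%N) (r : R) (hr : 0 < r).
Notation C := R[i].
Notation CM := 'M[C]_n.+1.
Notation RM := ('M[R]_n.+1 * 'M[R]_n.+1)%type.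
Notation TM := (RM * RM)%type.
Implicit Types (A B D M : CM) (p u v w : TM).
Notation P0 := (E_ 1 1 : CM).
Notation N0 := (E_ 1 2 + E_ 2 1 : CM).
Local Notation S := (@TrCP R n r).
Local Notation Nm := (@Nm R n r).

Lemma isDM_lin (E : normedModType R) (p w : E) (L : CM -> CM) (A : E -> CM) dA :
  (forall (k : R) M M', L (k%:C *: M + M') = k%:C *: L M + L M') ->
  isDM p w A dA -> isDM p w (fun q => L (A q)) (L dA).
Proof.
move=> hL /is_derive_reim DA.
have ll : linear (fun v : RM => reim (L (cplx v))).
  by move=> k u v; rewrite cplxP hL reimP.
have /isDM_cplx := is_derive_lin ll (RM_cont ll) DA.
by rewrite !cplxK; under eq_fun do rewrite !cplxK.
Qed.

Lemma reallinN (L : CM -> CM) (M : CM) :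
  (forall (k : R) A B, L (k%:C *: A + B) = k%:C *: L A + L B) -> L (- M) = - L M.
Proof.
move=> hL; have N1 : (-1 : R)%:C = -1 by rewrite rmorphN1.
have L0 : L 0 = 0 by have := hL (-1) 0 0; rewrite N1 !scaleN1r !addNr.
by have := hL (-1) M 0; rewrite N1 !scaleN1r L0 !addr0.
Qed.

Section Coefficients.
Context (a0 ae be ah bh x y z : R).
Hypotheses (p1 : 0 < a0) (p2 : 0 < ae) (p3 : 0 < be) (p4 : 0 < ah) (p5 : 0 < bh).
Notation G := (Gam a0 ae be ah bh).
Notation gcan := (can_metric r a0 ae be ah bh).
Notation Zpt := (vpt (a0 * x) (ae * y) (be * z)).

Lemma Gam_sym p A B : S p -> skewherm A -> skewherm B ->
  ip A (G (Pm p) (Nm p) B) = ip B (G (Pm p) (Nm p) A).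
Proof.
move=> Sp sA sB; have [a ua [-> ->]] := frameP hn hr Sp.
have [A0 sA0 ->] := frame_skew ua sA; have [B0 sB0 ->] := frame_skew ua sB.
rewrite !(Gam_cj ua) !(ip_cj _ _ ua).
rewrite (ip_Gam0 hn _ _ _ _ _ sA0 sB0) (ip_Gam0 hn _ _ _ _ _ sB0 sA0).
rewrite (row_dotC _ B0) (row_dotC _ B0).
by move: (ip A0 _) (ip B0 _) (ip A0 _) (ip B0 _) (ip A0 _) (ip B0 _) => *; ring.
Qed.

(** [Gam] maps the vector [v] of the Reeb field to its dual [Z]. *)
Lemma ip_Gam_vpt p A : S p -> skewherm A ->
  ip A (G (Pm p) (Nm p) (vpt x y z (Pm p) (Nm p))) = ip A (Zpt (Pm p) (Nm p)).
Proof.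
move=> Sp sA; have [a ua [-> ->]] := frameP hn hr Sp.
have [A0 sA0 ->] := frame_skew ua sA.
rewrite !(vpt_cj ua) !(Gam_cj ua) !(ip_cj _ _ ua).
have fl := @flag_E R n hn.
have sv : skewherm (vpt x y z P0 N0) by exact: vpt_skew.
rewrite (ip_Gam0 hn _ _ _ _ _ sA0 sv) (ip_vpt hn).
have [-> -> ->] := vpt_ip hn x y z.
have r0 i : row_dot i A0 (vpt x y z P0 N0) = 0.
  by apply: big1 => k ok; rewrite (vpt_outer_r hn) //= !mulr0 addr0.
rewrite !r0; move: (ip A0 _) (ip A0 _) (ip A0 _) => *; ring.
Qed.

Context (xi : TM -> TM) (g : TM -> TM -> TM -> R).
Hypothesis gE : forall p u v, S p -> tangent S p u -> tangent S p v ->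
  g p u v = gcan p u v.
Hypothesis xiE : forall p, S p -> xi p = inf_act (vpt x y z (Pm p) (Nm p)) p.

Lemma smM_vpt_pt : smM (fun q : TM => vpt x y z (Pm q) (Nm q)).
Proof.
apply: smM_vpt; try exact: smooth_cst.
  by apply: (@smM_Pm R n TM id); exact: smooth_idTM.
by apply: (@smM_Nm R n r TM id); exact: smooth_idTM.
Qed.

Lemma vpt_pt_skew p : S p -> skewherm (vpt x y z (Pm p) (Nm p)).
Proof. by move=> Sp; apply: vpt_skew; exact: (flag_TrCP hr hn Sp). Qed.

Lemma xi_vfield : vfield S xi.
Proof. exact: (vfield_inf_act hr smM_vpt_pt vpt_pt_skew xiE). Qed.

Lemma xi_tangent p : S p -> tangent S p (xi p).
Proof. by case: xi_vfield => _; exact. Qed.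

Lemma g_inf_act p A B : S p -> skewherm A -> skewherm B ->
  g p (inf_act A p) (inf_act B p) = ip A (G (Pm p) (Nm p) B).
Proof.
move=> Sp sA sB; have tA := tangent_inf_act hr Sp sA; have tB := tangent_inf_act hr Sp sB.
exact: etrans (gE Sp tA tB) (can_metric_inf_act hn hr _ _ _ _ _ Sp sA sB).
Qed.

Lemma tangentZD p (k : R) u u' : S p -> tangent S p u -> tangent S p u' ->
  tangent S p (k *: u + u').
Proof.
move=> Sp /(tangentP hr hn Sp) [A sA ->] /(tangentP hr hn Sp) [B sB ->].
have -> : k *: inf_act A p + inf_act B p = inf_act (k%:C *: A + B) p.
  exact: esym (etrans (inf_actD hr _ _ _) (congr1 (fun t => t + _) (inf_actZ hr _ _ _))).
by apply: (tangent_inf_act hr) => //; apply: skewD => //; exact: skewZ.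
Qed.

Lemma skew0 : skewherm (0 : CM).
Proof. by rewrite /skewherm -(subrr (0 : CM)) ctB !subrr oppr0. Qed.

Lemma inf_act0 p : inf_act (0 : CM) p = 0.
Proof. by have := inf_actZ hr 0 (0 : CM) p; rewrite scaler0 scale0r. Qed.

Lemma Gam_pos_pt p A : S p -> skewherm A -> inf_act A p != 0 ->
  0 < ip A (G (Pm p) (Nm p) A).
Proof.
move=> Sp sA; have [a ua [eP eN]] := frameP hn hr Sp.
have [A0 sA0 ->] := frame_skew ua sA => nz.
have [h0 h] := Gam_pos hn sA0 p1 p2 p3 p4 p5.
have E P N : P = cj a P0 -> N = cj a N0 ->
    ip (cj a A0) (G P N (cj a A0)) = ip A0 (G P0 N0 A0).
  by move=> -> ->; rewrite (Gam_cj ua) (ip_cj _ _ ua).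
rewrite (E _ _ eP eN) lt_neqAle h0 andbT; apply/eqP => /esym /h [hP hN].
case/eqP: nz; apply: etrans (inf_act0 p).
apply/(inf_act_eqP hr); move: (Pm p) (Nm p) eP eN => P N -> ->.
have c0 D : commutator 0 (cj a D) = 0 by rewrite commutatorE mul0mx mulmx0 subrr.
by split; rewrite -(cj_comm ua) ?hP ?hN /cj mulmx0 mul0mx; symmetry; exact: c0.
Qed.

Lemma g_riemannian : riemannian S g.
Proof.
split.
- move=> p k u u' v Sp tu tu' tv; have tw := tangentZD k Sp tu tu'.
  apply: etrans (gE Sp tw tv) _; apply: etrans (can_metric_linl _ _ _ _ _ _ _ _ _ _ _) _.
  exact: esym (f_equal2 (fun a b => k * a + b) (gE Sp tu tv) (gE Sp tu' tv)).
- move=> p u v Sp /(tangentP hr hn Sp) [A sA ->] /(tangentP hr hn Sp) [B sB ->].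
  exact: etrans (g_inf_act Sp sA sB) (etrans (Gam_sym Sp sA sB) (esym (g_inf_act Sp sB sA))).
- move=> p u Sp /(tangentP hr hn Sp) [A sA ->] nz.
  by rewrite (g_inf_act Sp sA sA); exact: Gam_pos_pt.
- move=> U V [sU tU] [sV tV] p Sp.
  have [U' sU' UU'] := sU _ Sp; have [V' sV' VV'] := sV _ Sp.
  exists (fun q => gcan q (U' q) (V' q)).
    by have := @smooth_can_metric R n r a0 ae be ah bh TM id U' V'; apply=> //; exact: smooth_idTM.
  near=> q => Sq.
  have Uq : U' q = U q by move: Sq; near: q.
  have Vq : V' q = V q by move: Sq; near: q.
  by rewrite Uq Vq; exact: esym (gE Sq (tU _ Sq) (tV _ Sq)).
Unshelve. all: by end_near. Qed.

Lemma xi_equivariant a q : a \is unitarymx -> S q -> xi (act a q) = act a (xi q).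
Proof.
move=> ua Sq; have Saq := TrCP_act hr ua Sq.
apply: etrans (xiE Saq) _; apply: esym; apply: etrans (congr1 (act a) (xiE Sq)) _.
apply: etrans (act_inf_act hr _ _ ua) _; congr (inf_act _ _).
have eP : Pm (act a q) = cj a (Pm q) by exact: Pm_act.
have eN : Nm (act a q) = cj a (Nm q) by exact: Nm_act.
move: (Pm (act a q)) (Nm (act a q)) (Pm q) (Nm q) eP eN => P' N' P N -> ->.
exact: esym (vpt_cj ua _ _ _ _ _).
Qed.

Lemma tder_xi p A : S p -> skewherm A -> tder S xi p (inf_act A p) = inf_act A (xi p).
Proof.
move=> Sp sA; apply: (tder_equivariant hr) => //; first by case: xi_vfield.
exact: xi_equivariant.
Qed.

(** Invariant fields commute with the fundamental fields of the action. *)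
Lemma lie_xi_fund p A : S p -> skewherm A -> lie S xi (inf_act A) p = 0.
Proof.
move=> Sp sA; rewrite /lie.
have -> := tder_fund hr A Sp (xi_tangent Sp).
by rewrite (tder_xi Sp sA) subrr.
Qed.

(** Along the flow of [D], moving the point amounts to moving [A] and [B] by the
    inverse flow. *)
Lemma tder_metric_fund p A B D : S p -> skewherm A -> skewherm B -> skewherm D ->
  tder S ((fun q => g q (inf_act A q) (inf_act B q)) : TM -> R^o) p (inf_act D p) =
  - (ip (commutator D A) (G (Pm p) (Nm p) B) + ip A (G (Pm p) (Nm p) (commutator D B))).
Proof.
move=> Sp sA sB sD.
have sg : smooth_on S ((fun q => g q (inf_act A q) (inf_act B q)) : TM -> R^o).
  by case: g_riemannian => _ _ _; apply; exact: vfield_fund.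
have [c [uc c0 cc _ dc]] := action_curve hr sD.
apply: (tder_curve sg Sp (cc p Sp)).
have -> : (fun t => g (act (c t) p) (inf_act A (act (c t) p)) (inf_act B (act (c t) p))) =
    (fun t => ip (cj ((c t)^t*) A) (G (Pm p) (Nm p) (cj ((c t)^t*) B))).
  apply/funext => t; have ut := uc t.
  apply: etrans (g_inf_act (TrCP_act hr ut Sp) sA sB) _.
  have eP : Pm (act (c t) p) = cj (c t) (Pm p) by exact: Pm_act.
  have eN : Nm (act (c t) p) = cj (c t) (Nm p) by exact: Nm_act.
  move: (Pm (act (c t) p)) (Nm (act (c t) p)) (Pm p) (Nm p) eP eN => P' N' P N -> ->.
  by rewrite -{1}(cjK ut A) -{1}(cjK ut B) (Gam_cj ut) (ip_cj _ _ ut).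
have dG := isDM_lin (fun k M M' => Gam_lin a0 ae be ah bh k (Pm p) (Nm p) M M') (dc B).
have := is_derive_ip (dc A) dG; rewrite c0 ct1 !cj1.
rewrite (reallinN _ (fun k M M' => Gam_lin a0 ae be ah bh k (Pm p) (Nm p) M M')).
by rewrite ipNl ipNr -opprD.
Qed.

(** The same argument for [eta], which is the product with [Z]. *)
Lemma tder_eta_fund p A B : S p -> skewherm A -> skewherm B ->
  tder S ((fun q => g q (xi q) (inf_act B q)) : TM -> R^o) p (inf_act A p) =
  - ip (commutator A B) (Zpt (Pm p) (Nm p)).
Proof.
move=> Sp sA sB.
have sg : smooth_on S ((fun q => g q (xi q) (inf_act B q)) : TM -> R^o).
  by case: g_riemannian => _ _ _; apply; [exact: xi_vfield|exact: vfield_fund].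
have [c [uc c0 cc _ dc]] := action_curve hr sA.
apply: (tder_curve sg Sp (cc p Sp)).
have -> : (fun t => g (act (c t) p) (xi (act (c t) p)) (inf_act B (act (c t) p))) =
    (fun t => ip (cj ((c t)^t*) B) (Zpt (Pm p) (Nm p))).
  apply/funext => t; have ut := uc t; have St := TrCP_act hr ut Sp.
  rewrite (xiE St); have sv := vpt_pt_skew St.
  apply: etrans (g_inf_act St sv sB) _.
  apply: etrans (Gam_sym St sv sB) _; apply: etrans (ip_Gam_vpt St sB) _.
  have eP : Pm (act (c t) p) = cj (c t) (Pm p) by exact: Pm_act.
  have eN : Nm (act (c t) p) = cj (c t) (Nm p) by exact: Nm_act.
  move: (Pm (act (c t) p)) (Nm (act (c t) p)) (Pm p) (Nm p) eP eN => P' N' P N -> ->.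
  by rewrite -{1}(cjK ut B) (vpt_cj ut) (ip_cj _ _ ut).
have := is_derive_ip (dc B) (isDM_cst _ _ (Zpt (Pm p) (Nm p))); rewrite c0 ct1 !cj1.
have -> : ip B 0 = 0 by have := ipZr 0 B 0; rewrite scaler0 mul0r.
by rewrite addr0 ipNl.
Qed.

Lemma can_form_linl p v : linear (fun u => can_form r a0 ae be ah bh (p, (u, v)) : R^o).
Proof. by move=> k u u'; exact: can_metric_linl. Qed.

Lemma can_form_linr p u : linear (fun v => can_form r a0 ae be ah bh (p, (u, v)) : R^o).
Proof. by move=> k v v'; exact: can_metric_lin. Qed.

(** The three terms of [ext_der] on fundamental fields are all multiples of
    [ip [A, B] Z], with coefficients [-1], [-1] and [1]. *)
Lemma ext_der_inf_act U V p A B : vfield S U -> vfield S V -> S p ->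
  skewherm A -> skewherm B -> U p = inf_act A p -> V p = inf_act B p ->
  ext_der S (fun q u => g q (xi q) u) U V p =
  - (2^-1 * ip (commutator A B) (Zpt (Pm p) (Nm p))).
Proof.
move=> vU vV Sp sA sB eU eV.
have D W W' := ext_der_pointwise (U := W) (V := W') (@can_form_diff R n r a0 ae be ah bh)
  can_form_linl can_form_linr gE (lie_tangent hr hn) xi_vfield.
have vA := vfield_fund hr sA; have vB := vfield_fund hr sB.
have -> : ext_der S (fun q u => g q (xi q) u) U V p =
    ext_der S (fun q u => g q (xi q) u) (inf_act A) (inf_act B) p.
  apply: etrans (D _ _ _ vU vV Sp) (etrans _ (esym (D _ _ _ vA vB Sp))).
  by rewrite eU eV.
rewrite /ext_der (tder_eta_fund Sp sA sB) (tder_eta_fund Sp sB sA).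
have -> : lie S (inf_act A) (inf_act B) p = inf_act (- commutator A B) p.
  exact: etrans (lie_fund hr Sp sA sB) (esym (inf_actN hr _ _)).
have sC := skewN (comm_skew sA sB).
have -> : g p (xi p) (inf_act (- commutator A B) p) = - ip (commutator A B) (Zpt (Pm p) (Nm p)).
  have sv := vpt_pt_skew Sp; rewrite (xiE Sp).
  apply: etrans (g_inf_act Sp sv sC) _.
  by apply: etrans (Gam_sym Sp sv sC) _; apply: etrans (ip_Gam_vpt Sp sC) _; exact: ipNl.
rewrite (commC B A) ipNl; by move: (ip _ _) => q; field.
Qed.

Notation vfr p := (vpt x y z (Pm p) (Nm p)).

(** On fundamental fields the bracket terms vanish, by [lie_xi_fund]. *)
Lemma killing_pointwise U V p A B : vfield S U -> vfield S V -> S p ->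
  skewherm A -> skewherm B -> U p = inf_act A p -> V p = inf_act B p ->
  tder S ((fun q => g q (U q) (V q)) : TM -> R^o) p (xi p)
   - (g p (lie S xi U p) (V p) + g p (U p) (lie S xi V p)) =
  - (ip (commutator (vfr p) A) (G (Pm p) (Nm p) B)
     + ip A (G (Pm p) (Nm p) (commutator (vfr p) B))).
Proof.
move=> vU vV Sp sA sB eU eV; have sv := vpt_pt_skew Sp.
have D W W' := killing_defect_pointwise (U := W) (V := W') (@can_form_diff R n r a0 ae be ah bh)
  can_form_linl can_form_linr gE (lie_tangent hr hn) xi_vfield.
have vA := vfield_fund hr sA; have vB := vfield_fund hr sB.
have g0l W : skewherm W -> g p 0 (inf_act W p) = 0.
  move=> sW; rewrite -[X in g p X _](inf_act0 p).
  apply: etrans (g_inf_act Sp skew0 sW) _.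
  by have := ipZl 0 0 (G (Pm p) (Nm p) W); rewrite scaler0 mul0r.
have g0r W : skewherm W -> g p (inf_act W p) 0 = 0.
  move=> sW; apply: etrans (g0l _ sW); rewrite -[X in g p _ X = _](inf_act0 p) -[X in _ = g p X _](inf_act0 p).
  exact: etrans (g_inf_act Sp sW skew0) (etrans (Gam_sym Sp sW skew0) (esym (g_inf_act Sp skew0 sW))).
apply: etrans (D _ _ _ vU vV Sp) _.
have -> : U p = inf_act A p by []. have -> : V p = inf_act B p by [].
apply: etrans (esym (D _ _ _ vA vB Sp)) _.
rewrite (lie_xi_fund Sp sA) (lie_xi_fund Sp sB) (g0l _ sB) (g0r _ sA) addr0 subr0.
rewrite (xiE Sp); exact: tder_metric_fund.
Qed.

Lemma killing_iff : killing S g xi <->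
  kill_cond a0 ae be x y z /\ ((1 < n)%N -> kill_half ah bh x y).
Proof.
apply: iff_trans (killing_base hn a0 ae be ah bh x y z); split.
  move=> K A B sA sB; have So := @TrCP_oH R n r hr.
  have vA := vfield_fund hr sA; have vB := vfield_fund hr sB.
  have := killing_pointwise vA vB So sA sB erefl erefl; rewrite (K _ _ vA vB _ So) subrr.
  have eP := @Pm_oH R n r; have eN := Nm_oH hr hn.
  move: (Pm _) (Nm _) eP eN => P N -> -> /esym/eqP.
  by rewrite oppr_eq0 => /eqP.
move=> base U V vU vV p Sp.
have [A sA eA] := tangentP hr hn Sp (vU.2 _ Sp).
have [B sB eB] := tangentP hr hn Sp (vV.2 _ Sp).
apply/eqP; rewrite -subr_eq0; apply/eqP.
apply: etrans (killing_pointwise vU vV Sp sA sB eA eB) _.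
apply: oppr_inj; rewrite oppr0 opprK.
have [a ua [eP eN]] := frameP hn hr Sp.
have [A0 sA0 ->] := frame_skew ua sA; have [B0 sB0 ->] := frame_skew ua sB.
move: (Pm p) (Nm p) eP eN => P N -> ->.
by rewrite (vpt_cj ua) -!(cj_comm ua) !(Gam_cj ua) !(ip_cj _ _ ua); exact: base.
Qed.

Notation phop := (phi_op a0 ae be ah bh x y z).

Definition can_phi p u : TM := inf_act (phop (Pm p) (Nm p) (lie_lift r p u)) p.

Lemma phi_op_cj a P N B : a \is unitarymx ->
  phop (cj a P) (cj a N) (cj a B) = cj a (phop P N B).
Proof. by move=> ua; rewrite /phi_op (vpt_cj ua) -(cj_comm ua) (Gam_cj ua) cjZ. Qed.

(** Hence [phi_op] defines an operator on tangent vectors. *)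
Lemma phi_op_same A A' : skewherm A -> skewherm A' -> same_coords A A' ->
  same_coords (phop P0 N0 A) (phop P0 N0 A').
Proof.
have fl := @flag_E R n hn.
move=> sA sA' /(same_coords_ip sA sA') [e1 e2 e3 e4].
have fA := phi_op_skew a0 ae be ah bh x y z fl sA.
have fA' := phi_op_skew a0 ae be ah bh x y z fl sA'.
apply/(same_coords_ip fA fA').
have [h1 h2 h3 h4] := phi0_coords hn a0 ae be ah bh x y z sA.
have [k1 k2 k3 k4] := phi0_coords hn a0 ae be ah bh x y z sA'.
split.
- exact: etrans h1 (etrans (f_equal2 _ e2 e3) (esym k1)).
- exact: etrans h2 (etrans (f_equal2 _ e3 e1) (esym k2)).
- exact: etrans h3 (etrans (f_equal2 _ e1 e2) (esym k3)).
move=> k ok; have [f1 f2] := e4 k ok; have [F1 F2] := h4 k ok; have [G1 G2] := k4 k ok.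
split; [exact: etrans F1 (etrans (f_equal2 _ f1 f2) (esym G1))|exact: etrans F2 (etrans (f_equal2 _ f1 f2) (esym G2))].
Qed.

Lemma phi_op_pt_skew p A : S p -> skewherm A -> skewherm (phop (Pm p) (Nm p) A).
Proof. by move=> Sp; apply: phi_op_skew; exact: (flag_TrCP hr hn Sp). Qed.

Lemma can_phi_inf_act p A : S p -> skewherm A ->
  can_phi p (inf_act A p) = inf_act (phop (Pm p) (Nm p) A) p.
Proof.
move=> Sp sA; rewrite /can_phi.
have tA := tangent_inf_act hr Sp sA.
move: (lie_lift_skew r p (inf_act A p)) (lie_liftK hr hn Sp tA).
move: (lie_lift r p _) => A' + + .
have [a ua [eP eN]] := frameP hn hr Sp; have fl := @flag_E R n hn.
move=> sA'; have [A0 sA0 ->] := frame_skew ua sA; have [A0' sA0' ->] := frame_skew ua sA'.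
move=> /(inf_act_frame hn hr ua eP eN sA0' sA0) hA.
have E B P N : P = cj a P0 -> N = cj a N0 -> phop P N (cj a B) = cj a (phop P0 N0 B).
  by move=> -> ->; exact: phi_op_cj.
rewrite !(E _ _ _ eP eN).
apply/(inf_act_frame hn hr ua eP eN); [exact: phi_op_skew|exact: phi_op_skew|].
exact: phi_op_same.
Qed.

(** The metric operators with inverse coefficients compose to the projection onto
    the complement of the stabiliser, which fixes [[Z, B]]. *)
Lemma ip_Gam_phi p A B : S p -> skewherm A -> skewherm B ->
  ip A (G (Pm p) (Nm p) (phop (Pm p) (Nm p) B)) =
  - (2^-1 * ip (commutator A B) (Zpt (Pm p) (Nm p))).
Proof.
move=> Sp sA sB; have [a ua [-> ->]] := frameP hn hr Sp; have fl := @flag_E R n hn.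
have [A0 sA0 ->] := frame_skew ua sA; have [B0 sB0 ->] := frame_skew ua sB.
rewrite (phi_op_cj _ _ _ ua) (Gam_cj ua) (vpt_cj ua) -(cj_comm ua) !(ip_cj _ _ ua).
have sZ : skewherm (Zpt P0 N0) by exact: vpt_skew.
have sM := comm_skew sZ sB0.
have -> : ip (commutator A0 B0) (Zpt P0 N0) = - ip A0 (commutator (Zpt P0 N0) B0).
  by rewrite ip_comm (commC B0) ipNr.
rewrite mulrN opprK.
have e1 := Gam1_comm hn (a0 * x) (ae * y) (be * z) sB0.
apply: etrans _ (congr1 (fun t => 2^-1 * ip A0 t) e1).
apply: etrans _ (congr1 (fun t => 2^-1 * t) (esym (ip_Gam0 hn 1 1 1 1 1 sA0 sM))).
have sphi := phi_op_skew a0 ae be ah bh x y z fl sB0.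
rewrite (ip_Gam0 hn _ _ _ _ _ sA0 sphi).
rewrite /phi_op; move: (commutator (Zpt P0 N0) B0) sM => M sM.
have [h1 h2 h3] := ip_Gam hn a0^-1 ae^-1 be^-1 ah^-1 bh^-1 sM.
rewrite !ipZl h1 h2 h3.
have r1 : row_dot (inord 0) A0 ((2^-1)%:C *: Gam a0^-1 ae^-1 be^-1 ah^-1 bh^-1 P0 N0 M) =
    2^-1 * (ah^-1 * row_dot (inord 0) A0 M).
  rewrite /row_dot !mulr_sumr; apply: eq_bigr => k ok.
  have -> : ((2^-1)%:C *: Gam a0^-1 ae^-1 be^-1 ah^-1 bh^-1 P0 N0 M) (inord 0) k =
    (2^-1)%:C * (ah^-1%:C * M (inord 0) k).
    by rewrite mxZ; congr (_ * _); exact: Gam1k.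
  rewrite !Re_rM !Im_rM; move: (A0 _ _) (M _ _) => [u u'] [w w'] /=; ring.
have r2 : row_dot (inord 1) A0 ((2^-1)%:C *: Gam a0^-1 ae^-1 be^-1 ah^-1 bh^-1 P0 N0 M) =
    2^-1 * (bh^-1 * row_dot (inord 1) A0 M).
  rewrite /row_dot !mulr_sumr; apply: eq_bigr => k ok.
  have -> : ((2^-1)%:C *: Gam a0^-1 ae^-1 be^-1 ah^-1 bh^-1 P0 N0 M) (inord 1) k =
    (2^-1)%:C * (bh^-1%:C * M (inord 1) k).
    by rewrite mxZ; congr (_ * _); exact: Gam2k.
  rewrite !Re_rM !Im_rM; move: (A0 _ _) (M _ _) => [u u'] [w w'] /=; ring.
rewrite r1 r2.
move: (ip A0 _) (ip A0 _) (ip A0 _) (ip M _) (ip M _) (ip M _) (row_dot _ A0 M) (row_dot _ A0 M).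
move=> *; field; by rewrite !gt_eqF.
Qed.

(** The two conditions on [phi_op] at the point [(P, N)], the equality of tangent
    vectors being expressed by brackets. *)
Definition contact_at (P N : CM) : Prop :=
  ip (vpt x y z P N) (Zpt P N) = 1 /\ forall B, skewherm B ->
    let D := phop P N (phop P N B) in
    let D' := - B + (ip B (Zpt P N))%:C *: vpt x y z P N in
    commutator D P = commutator D' P /\ commutator D N = commutator D' N.

Lemma contact_at_cj a : a \is unitarymx -> contact_at (cj a P0) (cj a N0) <->
  contact_cond a0 ae be x y z /\
  ((1 < n)%N -> half_cond (a0 * x) (ae * y) (be * z) ah bh).
Proof.
move=> ua; have fl := @flag_E R n hn.
apply: iff_trans (contact_base hn x y z p1 p2 p3 p4 p5).
rewrite /contact_at !(vpt_cj ua) (ip_cj _ _ ua).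
apply: iff_and; first exact: iff_refl.
have sZ : skewherm (vpt x y z P0 N0) by exact: vpt_skew.
have K B : skewherm B -> let D := phop P0 N0 (phop P0 N0 B) in
    let D' := - B + (ip B (Zpt P0 N0))%:C *: vpt x y z P0 N0 in
    (commutator (cj a D) (cj a P0) = commutator (cj a D') (cj a P0) /\
     commutator (cj a D) (cj a N0) = commutator (cj a D') (cj a N0)) <-> same_coords D D'.
  move=> sB D D'; have sD : skewherm D by do 2 apply: phi_op_skew => //.
  have sD' : skewherm D' by apply: skewD; [exact: skewN|exact: skewZ].
  apply: iff_trans _ (same_coordsP hn sD sD').
  have J F F' Q : commutator (cj a F) (cj a Q) = commutator (cj a F') (cj a Q) <->
      commutator F Q = commutator F' Q.
    have e1 := cj_comm ua F Q; have e2 := cj_comm ua F' Q.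
    apply: (iff_trans (B := cj a (commutator F Q) = cj a (commutator F' Q))).
      by split=> h; [exact: etrans e1 (etrans h (esym e2))|exact: etrans (esym e1) (etrans h e2)].
    by split=> [/(can_inj (cjVK ua))|->].
  exact: iff_and (J D D' _) (J D D' _).
split=> h B sB.
  apply/(K B sB).
  have := h _ (cj_skew a sB); rewrite !(phi_op_cj _ _ _ ua) (ip_cj _ _ ua).
  by rewrite -cjN -cjZ -cjD.
have [B0 sB0 ->] := frame_skew ua sB.
rewrite !(phi_op_cj _ _ _ ua) (ip_cj _ _ ua) -cjN -cjZ -cjD.
exact: (K _ sB0).2 (h _ sB0).
Qed.

Lemma contact_atP p : S p -> contact_at (Pm p) (Nm p) <->
  contact_cond a0 ae be x y z /\
  ((1 < n)%N -> half_cond (a0 * x) (ae * y) (be * z) ah bh).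
Proof.
move=> Sp; have [a ua [eP eN]] := frameP hn hr Sp.
by move: (Pm p) (Nm p) eP eN => P N -> ->; exact: contact_at_cj.
Qed.

Lemma contact_at_inf_act p B : S p -> contact_at (Pm p) (Nm p) -> skewherm B ->
  inf_act (phop (Pm p) (Nm p) (phop (Pm p) (Nm p) B)) p =
  - inf_act B p + ip B (Zpt (Pm p) (Nm p)) *: inf_act (vfr p) p.
Proof.
move=> Sp [_ h] sB; have /(inf_act_eqP hr) e := h _ sB.
apply: etrans e (etrans (inf_actD hr _ _ _) _).
exact: f_equal2 (inf_actN hr _ _) (inf_actZ hr _ _ _).
Qed.

Lemma eta_inf_act p B : S p -> skewherm B ->
  g p (xi p) (inf_act B p) = ip B (Zpt (Pm p) (Nm p)).
Proof.
move=> Sp sB; have sv := vpt_pt_skew Sp; rewrite (xiE Sp).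
apply: etrans (g_inf_act Sp sv sB) _.
exact: etrans (Gam_sym Sp sv sB) (ip_Gam_vpt Sp sB).
Qed.

Lemma can_phi_tensor : tensor11 S can_phi.
Proof.
split.
- move=> p u Sp tu; apply: (tangent_inf_act hr Sp); apply: (phi_op_pt_skew Sp).
  exact: lie_lift_skew.
- move=> p k u v Sp tu tv; rewrite /can_phi lie_lift_lin.
  have phD A B : phop (Pm p) (Nm p) (k%:C *: A + B) =
      k%:C *: phop (Pm p) (Nm p) A + phop (Pm p) (Nm p) B.
    by rewrite /phi_op commDr commZr Gam_lin scalerDr !scalerA mulrC.
  rewrite phD; apply: etrans (inf_actD hr _ _ _) _.
  by apply: (congr1 (fun t : TM => t + inf_act (phop (Pm p) (Nm p) (lie_lift r p v)) p)); exact: (inf_actZ hr).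
- move=> U [sU tU] p Sp; have [U' sU' UU'] := sU _ Sp.
  exists (fun q => can_phi q (U' q)).
    apply: smooth_inf_act; last exact: smooth_idTM.
    have sP : smM (fun q : TM => Pm q) by apply: (@smM_Pm R n TM id); exact: smooth_idTM.
    have sN : smM (fun q : TM => Nm q) by apply: (@smM_Nm R n r TM id); exact: smooth_idTM.
    apply: smMZc; apply: smM_Gam => //; apply: smM_comm.
      by apply: smM_vpt => //; exact: smooth_cst.
    by apply: smM_lie_lift => //; exact: smooth_idTM.
  near=> q => Sq; have Uq : U' q = U q by move: Sq; near: q.
  by rewrite Uq.
Unshelve. all: by end_near. Qed.

(** The compatibility of [phi] with the metric follows from the other axioms:
    [g (phi u, phi v) = d eta (phi u, v) = - g (v, phi (phi u))]. *)
Lemma can_contact : contact_cond a0 ae be x y z /\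
  ((1 < n)%N -> half_cond (a0 * x) (ae * y) (be * z) ah bh) ->
  contact_metric S can_phi xi g.
Proof.
move=> cc; have At p : S p -> contact_at (Pm p) (Nm p) by move=> Sp; exact/(contact_atP Sp).
have c1 p u : S p -> tangent S p u ->
    can_phi p (can_phi p u) = - u + g p (xi p) u *: xi p.
  move=> Sp /(tangentP hr hn Sp) [A sA ->].
  rewrite (can_phi_inf_act Sp sA) (can_phi_inf_act Sp (phi_op_pt_skew Sp sA)).
  rewrite (contact_at_inf_act Sp (At p Sp) sA) (eta_inf_act Sp sA).
  by rewrite (xiE Sp).
have c4 p A B : S p -> skewherm A -> skewherm B ->
    g p (inf_act A p) (can_phi p (inf_act B p)) =
    - (2^-1 * ip (commutator A B) (Zpt (Pm p) (Nm p))).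
  move=> Sp sA sB; rewrite (can_phi_inf_act Sp sB).
  exact: etrans (g_inf_act Sp sA (phi_op_pt_skew Sp sB)) (ip_Gam_phi Sp sA sB).
split; [exact: xi_vfield|exact: g_riemannian|exact: can_phi_tensor|split=> //].
- move=> p Sp; have sv := vpt_pt_skew Sp; rewrite [X in g p _ X](xiE Sp).
  by rewrite (eta_inf_act Sp sv); case: (At p Sp).
- move=> p u v Sp; have [glin gsym _ _] := g_riemannian; have tx := xi_tangent Sp.
  move=> /(tangentP hr hn Sp) [A sA ->] /(tangentP hr hn Sp) [B sB ->].
  have sfA := phi_op_pt_skew Sp sA; have sNA := skewN sA.
  have tA := tangent_inf_act hr Sp sA; have tB := tangent_inf_act hr Sp sB.
  have tNA := tangent_inf_act hr Sp sNA.
  have e := c1 p _ Sp tA; rewrite (can_phi_inf_act Sp sA) in e *.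
  have step : g p (inf_act (phop (Pm p) (Nm p) A) p) (can_phi p (inf_act B p)) =
      - g p (inf_act B p) (can_phi p (inf_act (phop (Pm p) (Nm p) A) p)).
    rewrite (c4 _ _ _ Sp sfA sB) (c4 _ _ _ Sp sB sfA) (commC B) ipNl.
    by rewrite mulrN opprK.
  have eA : - inf_act A p = inf_act (- A) p by exact: esym (inf_actN hr _ _).
  rewrite step e eA [X in g p _ X]addrC.
  rewrite (gsym _ _ _ Sp tB (tangentZD _ Sp tx tNA)) (glin _ _ _ _ _ Sp tx tNA tB).
  rewrite opprD addrC; congr (_ + _).
  apply: etrans (congr1 -%R (etrans (g_inf_act Sp sNA sB) (ipNl _ _))) _.
  by apply: etrans (opprK _) _; exact: esym (g_inf_act Sp sA sB).
- move=> U V vU vV p Sp.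
  have [A sA eA] := tangentP hr hn Sp (vU.2 _ Sp).
  have [B sB eB] := tangentP hr hn Sp (vV.2 _ Sp).
  by rewrite (ext_der_inf_act vU vV Sp sA sB eA eB) eA eB (c4 _ _ _ Sp sA sB).
Qed.

(** The tensor [phi] is determined by [d eta], the metric being nondegenerate. *)
Lemma contact_phi_uniq phi p B : contact_metric S phi xi g -> S p -> skewherm B ->
  phi p (inf_act B p) = inf_act (phop (Pm p) (Nm p) B) p.
Proof.
move=> [_ _ [tphi _ _] [_ _ _ hd]] Sp sB.
have tB := tangent_inf_act hr Sp sB.
have [D sD eD] := tangentP hr hn Sp (tphi _ _ Sp tB).
have sfB := phi_op_pt_skew Sp sB.
set F := D - phop (Pm p) (Nm p) B.
have sF : skewherm F by apply: skewD => //; exact: skewN.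
have vF := vfield_fund hr sF; have vB := vfield_fund hr sB.
have e0 := hd _ _ vF vB p Sp; rewrite eD in e0.
have e1 := etrans (esym (ext_der_inf_act vF vB Sp sF sB erefl erefl)) e0.
have e2 := etrans (ip_Gam_phi Sp sF sB) (etrans e1 (g_inf_act Sp sF sD)).
(* Both terms of [F] represent the form [d eta (., B)]. *)
have e3 : ip F (G (Pm p) (Nm p) F) = 0.
  have -> : G (Pm p) (Nm p) F = G (Pm p) (Nm p) D - G (Pm p) (Nm p) (phop (Pm p) (Nm p) B).
    rewrite /F addrC; have := Gam_lin a0 ae be ah bh (-1) (Pm p) (Nm p) (phop (Pm p) (Nm p) B) D.
    by rewrite rmorphN1 !scaleN1r => ->; exact: addrC.
  have k (s t : R) : s = t -> t - s = 0 by move=> ->; exact: subrr.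
  apply: etrans (ipDr _ _ _) _; apply: etrans (congr1 (+%R _) (ipNr _ _)) _.
  exact: k e2.
have F0 : inf_act F p = 0.
  by apply/eqP/negPn/negP => /(Gam_pos_pt Sp sF); rewrite e3 ltxx.
rewrite eD; apply/eqP; rewrite -subr_eq0; apply/eqP.
exact: etrans (esym (inf_actB hr _ _ _)) F0.
Qed.

(** A contact metric structure has [phi_op] as its tensor, and its axioms at the
    base point are the equations; conversely they propagate by equivariance. *)
Lemma contact_iff : contact_metric_structure S xi g <->
  contact_cond a0 ae be x y z /\
  ((1 < n)%N -> half_cond (a0 * x) (ae * y) (be * z) ah bh).
Proof.
split; last by move=> /can_contact cm; exists can_phi.
move=> [phi cm]; have So := @TrCP_oH R n r hr; apply/(contact_atP So).
have U B := @contact_phi_uniq phi _ B cm So.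
case: cm => [_ _ _ [h1 h2 _ _]].
split.
  have sv := vpt_pt_skew So.
  apply: etrans (esym (eta_inf_act So sv)) _; rewrite -(xiE So); exact: h2.
move=> B sB; apply/(inf_act_eqP hr).
have sfB := phi_op_pt_skew So sB.
have tB := tangent_inf_act hr So sB.
have := h1 _ _ So tB; rewrite (U _ sB) (U _ sfB) (eta_inf_act So sB) (xiE So) => e.
apply: etrans e _; apply: esym; apply: etrans (inf_actD hr _ _ _) _.
exact: f_equal2 (inf_actN hr _ _) (inf_actZ hr _ _ _).
Qed.

End Coefficients.
End Structure.

(** * The spaces of index eps/2 *)

Section HalfSpaces.
Context {R : realType} {n : nat} (hn : (1 <= n)%N).
Notation C := R[i].
Notation CM := 'M[C]_n.+1.
Implicit Types (A B D M : CM).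
Notation P0 := (E_ 1 1 : CM).
Notation N0 := (E_ 1 2 + E_ 2 1 : CM).
Notation i1 := (inord 0 : 'I_n.+1).
Notation i2 := (inord 1 : 'I_n.+1).
Notation inner l := (l = 1%N \/ l = 2%N).

Lemma outer_succ j : (0 < j < n)%N -> outer (inord j.+1 : 'I_n.+1).
Proof.
move=> /andP[j0 jn]; have lt i : (i <= n)%N -> (i < n.+1)%N by [].
by rewrite /outer -!(inj_eq val_inj) /= !inordK ?lt // ?(ltnW jn) //; case: j j0 jn.
Qed.

Lemma half_term l j (a b : R) :
  a%:C *: ((E_ l (j + 2) : CM) - E_ (j + 2) l) + b%:C *: ('i%C *: (E_ l (j + 2) + E_ (j + 2) l)) =
  test_row (inord l.-1) (inord j.+1) (a +i* b).
Proof.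
rewrite /E_ /test_row addn2 /=.
move: (delta_mx _ _) (delta_mx _ _) => D D'; apply/matrixP => s t.
rewrite !mxD !mxN !mxZ !mxD !mxN; move: (D s t) (D' s t) => [u u'] [w w'].
by apply/eqP; rewrite eq_complex /=; apply/andP; split; apply/eqP; ring.
Qed.

Lemma sp_halfP l A : sp_half l A <-> exists w : nat -> C,
  A = \sum_(1 <= j < n) test_row (inord l.-1) (inord j.+1) (w j).
Proof.
split=> [[a [b ->]]|[w ->]].
  by exists (fun j => a j +i* b j); apply: eq_bigr => j _; exact: half_term.
exists (fun j => complex.Re (w j)), (fun j => complex.Im (w j)).
by apply: eq_bigr => j _; rewrite half_term; case: (w j).
Qed.

(** The generators have two nonzero entries, in the row and column [l], and outside
    of the upper left [2 x 2] block. *)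
Lemma sp_half_props l A : inner l -> sp_half l A ->
  [/\ skewherm A,
      forall k j, k != inord l.-1 -> j != inord l.-1 -> A k j = 0 &
      forall k j, ~~ outer k -> ~~ outer j -> A k j = 0].
Proof.
move=> il /sp_halfP [w ->]; split.
- apply: (big_ind (fun M : CM => skewherm M)); [|exact: skewD|by move=> *; exact: test_row_skew].
  by rewrite /skewherm -(subrr (0 : CM)) ctB !subrr oppr0.
- move=> k j /negbTE hk /negbTE hj; rewrite summxE big1 // => m _.
  by rewrite test_row_entry hk hj andbF /= !mulr0 subrr.
- move=> k j hk hj; rewrite summxE big_nat big1 // => m hm.
  have ho := outer_succ hm.
  have ne (t : 'I_n.+1) : ~~ outer t -> (t == inord m.+1) = false.
    by move=> ht; apply/eqP => e; rewrite e ho in ht.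
  by rewrite test_row_entry !ne // andbF /= !mulr0 subrr.
Qed.

Lemma sp_half_exists l (c : 'I_n.+1 -> C) : inner l ->
  exists2 A, sp_half l A & forall k, outer k -> A (inord l.-1) k = c k.
Proof.
move=> il; pose w j := c (inord j.+1).
exists (\sum_(1 <= j < n) test_row (inord l.-1) (inord j.+1) (w j)).
  by apply/sp_halfP; exists w.
move=> k ok; have [k0 k1] : (k != 0 :> nat) /\ (k != 1 :> nat)%N.
  move: ok; rewrite /outer -!(inj_eq val_inj) /= !inordK //.
  by case/andP.
have kl : (k == inord l.-1) = false.
  by case: il => ->; move: ok => /andP[/negbTE h1 /negbTE h2] /=.
have kn := ltn_ord k; have k2 : (1 < k)%N by case: (k : nat) k0 k1 => [|[]].
rewrite summxE (bigD1_seq k.-1) /=; first last.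
- exact: iota_uniq.
- by rewrite mem_index_iota; move: k2 kn; clear; case: (k : nat) => [|j] /=; [by []|rewrite !ltnS => -> ->].
rewrite big_nat_cond big1 ?addr0 => [|j /andP[/andP[j1 jn] jk]].
  rewrite test_row_entry eqxx prednK ?(ltnW k2) // inord_val eqxx kl andbF /w.
  by rewrite prednK ?(ltnW k2) // inord_val /= mulr1 mulr0 subr0.
rewrite test_row_entry kl andbF eqxx /= mulr0 subr0.
case: eqP => [e|]; last by rewrite mulr0.
by case/eqP: jk; rewrite e inordK.
Qed.

Lemma ip_basis : [/\ ip (X : CM) X = 1, ip (mu : CM) mu = 1 & ip (nu : CM) nu = 1].
Proof.
have [h1 _ _] := @vpt_ip R n hn 1 0 0; have [_ h2 _] := @vpt_ip R n hn 0 1 0; have [_ _ h3] := @vpt_ip R n hn 0 0 1.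
split.
- by move: h1; rewrite (vptE hn) !scale0r !addr0 scale1r.
- by move: h2; rewrite (vptE hn) !scale0r add0r addr0 scale1r.
- by move: h3; rewrite (vptE hn) !scale0r !add0r scale1r.
Qed.

Lemma inner1 : ~~ outer i1. Proof. by rewrite outer_i1. Qed.
Lemma inner2 : ~~ outer i2. Proof. by rewrite outer_i2. Qed.

Lemma half_coords l A : inner l -> sp_half l A ->
  [/\ ip A X = 0, ip A mu = 0, ip A nu = 0 & A i1 i1 + A i2 i2 = 0].
Proof.
move=> il /(sp_half_props il) [_ _ h].
have z a b : ~~ outer a -> ~~ outer b -> A a b = 0 by exact: h.
rewrite ip_X ip_mu ip_nu !z ?inner1 ?inner2 //=.
by split; rewrite ?subr0 ?addr0.
Qed.

Lemma half_row1 A k : sp_half 1 A -> outer k -> A i2 k = 0.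
Proof.
move=> /(sp_half_props (or_introl erefl)) [_ h _] ok; apply: h; first by rewrite /= (neq10 hn).
by case/andP: ok.
Qed.

Lemma half_row2 A k : sp_half 2 A -> outer k -> A i1 k = 0.
Proof.
move=> /(sp_half_props (or_intror erefl)) [_ h _] ok; apply: h; first by rewrite /= (neq01 hn).
by case/andP: ok.
Qed.

Lemma ip_half l A B : inner l -> sp_half l A -> sp_half l B ->
  ip A B = 4 * row_dot i1 A B + 4 * row_dot i2 A B.
Proof.
move=> il hA hB; have [sA _ _] := sp_half_props il hA; have [sB oB _] := sp_half_props il hB.
have [x1 x2 x3 _] := half_coords il hA; have [y1 y2 y3 y4] := half_coords il hB.
have ol (k : 'I_n.+1) : outer k -> k != inord l.-1.
  by move=> /andP[h1 h2]; case: il => ->.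
have e := Gam1_reduced hn sB (fun k j hk hj => oB k j (ol k hk) (ol j hj)) y4.
apply: etrans (congr1 (ip A) (esym e)) _.
apply: etrans (ip_Gam0 hn 1 1 1 1 1 sA sB) _.
have K (u v w u' v' w' s t : R) : u = 0 -> v = 0 -> w = 0 ->
    1 * (u * u') + 1 * (v * v') + 1 * (w * w') + 4 * 1 * s + 4 * 1 * t = 4 * s + 4 * t.
  by move=> -> -> ->; ring.
exact: K x1 x2 x3.
Qed.

Lemma mx3D A B D i j : (A + B + D) i j = A i j + B i j + D i j.
Proof. by rewrite !mxD. Qed.

Lemma ip3 A B D M (c : R) : ip A M = c -> ip B M = 0 -> ip D M = 0 -> ip (A + B + D) M = c.
Proof. by move=> h1 h2 h3; rewrite ipDl ipDl h1 h2 h3 !addr0. Qed.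

(** The five subspaces are orthogonal for [ip], and [Gam] multiplies each of them by
    its coefficient. *)
Lemma ip_Gam_split (a0 ae be ah bh : R) A0 B0 A1 B1 A2 B2 A3 B3 A4 B4 :
  sp_a A0 -> sp_a B0 -> sp_m A1 -> sp_m B1 -> sp_k A2 -> sp_k B2 ->
  sp_half 1 A3 -> sp_half 1 B3 -> sp_half 2 A4 -> sp_half 2 B4 ->
  [/\ skewherm (A0 + A1 + A2 + A3 + A4), skewherm (B0 + B1 + B2 + B3 + B4) &
  ip (A0 + A1 + A2 + A3 + A4) (Gam a0 ae be ah bh P0 N0 (B0 + B1 + B2 + B3 + B4)) =
  a0 * ip A0 B0 + ae * ip A1 B1 + be * ip A2 B2 + ah * ip A3 B3 + bh * ip A4 B4].
Proof.
move=> [s1 _ <-] [t1 _ <-] [s2 _ <-] [t2 _ <-] [s3 _ <-] [t3 _ <-] h3 h3' h4 h4'.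
have fl := @flag_E R n hn.
have i1' : inner 1 by left. have i2' : inner 2 by right.
have K (a b c : R) A A' : sp_half 1 A -> sp_half 2 A' ->
    let M := a%:C *: X + b%:C *: mu + c%:C *: nu + A + A' in
    [/\ skewherm M, ip M X = a, ip M mu = b, ip M nu = c &
     forall k, outer k -> M i1 k = A i1 k /\ M i2 k = A' i2 k].
  move=> hA hA' M; have eM : M = vpt a b c P0 N0 + A + A'.
    exact: (congr1 (fun t : CM => t + A + A') (esym (vptE hn a b c))).
  move: M eM => M ->; have [sA _ _] := sp_half_props i1' hA.
  have [sA' _ _] := sp_half_props i2' hA'.
  have [x1 x2 x3 _] := half_coords i1' hA; have [y1 y2 y3 _] := half_coords i2' hA'.
  have [v1 v2 v3] := vpt_ip hn a b c.
  have sv : skewherm (vpt a b c P0 N0) by exact: vpt_skew.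
  split; [exact: skewD (skewD sv sA) sA'| | | |].
  - exact: ip3 v1 x1 y1.
  - exact: ip3 v2 x2 y2.
  - exact: ip3 v3 x3 y3.
  move=> k ok; rewrite !(mx3D (vpt a b c P0 N0) A A') (half_row1 hA ok) (half_row2 hA' ok).
  have vo i : vpt a b c P0 N0 i k = 0 by exact: vpt_outer_r.
  by rewrite !vo !addr0 !add0r.
have [sA a1 a2 a3 aR] := K s1 s2 s3 _ _ h3 h4.
have [sB b1 b2 b3 bR] := K t1 t2 t3 _ _ h3' h4'.
move: (_ + A3 + A4) (_ + B3 + B4) sA a1 a2 a3 aR sB b1 b2 b3 bR => A B sA a1 a2 a3 aR sB b1 b2 b3 bR.
split=> //; apply: etrans (ip_Gam0 hn _ _ _ _ _ sA sB) _.
have r1 : row_dot i1 A B = row_dot i1 A3 B3.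
  by apply: eq_bigr => k ok; have [-> _] := aR k ok; have [-> _] := bR k ok.
have r2 : row_dot i2 A B = row_dot i2 A4 B4.
  by apply: eq_bigr => k ok; have [_ ->] := aR k ok; have [_ ->] := bR k ok.
have z3 : row_dot i2 A3 B3 = 0.
  by apply: big1 => k ok; rewrite (half_row1 h3 ok) /= !mul0r addr0.
have z4 : row_dot i1 A4 B4 = 0.
  by apply: big1 => k ok; rewrite (half_row2 h4 ok) /= !mul0r addr0.
have h3E := ip_half i1' h3 h3'; have h4E := ip_half i2' h4 h4'.
have [e1 e2 e3] := ip_basis.
have E (s t : R) (M : CM) : ip M M = 1 -> ip (s%:C *: M) (t%:C *: M) = s * t.
  by move=> h; rewrite ipZl ipZr h mulr1.
have F (u1 u2 u3 w1 w2 w3 r r' m m' q q' l1 l2 l3 l4 l5 : R) :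
    u1 = s1 -> u2 = s2 -> u3 = s3 -> w1 = t1 -> w2 = t2 -> w3 = t3 -> r = m -> r' = m' ->
    q = 0 -> q' = 0 -> l1 = s1 * t1 -> l2 = s2 * t2 -> l3 = s3 * t3 ->
    l4 = 4 * m + 4 * q -> l5 = 4 * q' + 4 * m' ->
    a0 * (u1 * w1) + ae * (u2 * w2) + be * (u3 * w3) + 4 * ah * r + 4 * bh * r' =
    a0 * l1 + ae * l2 + be * l3 + ah * l4 + bh * l5.
  by move=> -> -> -> -> -> -> -> -> -> -> -> -> -> -> ->; ring.
exact: F a1 a2 a3 b1 b2 b3 r1 r2 z3 z4 (E _ _ _ e1) (E _ _ _ e2) (E _ _ _ e3) h3E h4E.
Qed.

(** The five subspaces span a complement of the stabiliser. *)
Lemma split_exists A : skewherm A -> exists A0 A1 A2 A3 A4,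
  [/\ [/\ sp_a A0, sp_m A1, sp_k A2, sp_half 1 A3 & sp_half 2 A4] &
   same_coords A (A0 + A1 + A2 + A3 + A4)].
Proof.
move=> sA; have i1' : inner 1 by left. have i2' : inner 2 by right.
have [A3 h3 e3] := sp_half_exists (fun k => A i1 k) i1'.
have [A4 h4 e4] := sp_half_exists (fun k => A i2 k) i2'.
exists ((ip A X)%:C *: X), ((ip A mu)%:C *: mu), ((ip A nu)%:C *: nu), A3, A4.
split.
  by split; [exact: (ex_intro2 _ _ (ip A X) I erefl)|exact: (ex_intro2 _ _ (ip A mu) I erefl)
            |exact: (ex_intro2 _ _ (ip A nu) I erefl)|exact: h3|exact: h4].
have V := vptE hn (ip A X) (ip A mu) (ip A nu).
refine (eq_ind _ (fun M => same_coords A (M + A3 + A4)) _ _ V); clear V.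
have [sA3 _ _] := sp_half_props i1' h3; have [sA4 _ _] := sp_half_props i2' h4.
have [x1 x2 x3 _] := half_coords i1' h3; have [y1 y2 y3 _] := half_coords i2' h4.
have [v1 v2 v3] := vpt_ip hn (ip A X) (ip A mu) (ip A nu).
have fl := @flag_E R n hn.
have sv : skewherm (vpt (ip A X) (ip A mu) (ip A nu) P0 N0) by exact: vpt_skew.
apply/(same_coords_ip sA (skewD (skewD sv sA3) sA4)); split.
- exact: esym (ip3 v1 x1 y1).
- exact: esym (ip3 v2 x2 y2).
- exact: esym (ip3 v3 x3 y3).
move=> k ok; rewrite !(mx3D (vpt _ _ _ P0 N0) A3 A4) (half_row1 h3 ok) (half_row2 h4 ok).
have vo a b c i : vpt a b c P0 N0 i k = 0 by exact: vpt_outer_r.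
by rewrite !vo !addr0 !add0r; split; [exact: esym (e3 k ok)|exact: esym (e4 k ok)].
Qed.

End HalfSpaces.

(** * Invariant metrics and fields from their value at the base point *)

Section Invariant.
Context {R : realType} {n : nat} (hn : (1 <= n)%N) (r : R) (hr : 0 < r).
Notation C := R[i].
Notation CM := 'M[C]_n.+1.
Notation RM := ('M[R]_n.+1 * 'M[R]_n.+1)%type.
Notation TM := (RM * RM)%type.
Implicit Types (A B D M : CM) (p u v w : TM).
Notation P0 := (E_ 1 1 : CM).
Notation N0 := (E_ 1 2 + E_ 2 1 : CM).
Local Notation S := (@TrCP R n r).
Local Notation Nm := (@Nm R n r).

Lemma inf_act_oH A B : skewherm A -> skewherm B ->
  inf_act A (oH r) = inf_act B (oH r) <-> same_coords A B.
Proof.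
move=> sA sB; apply: iff_trans (inf_act_eqP hr _ _ _) _.
apply: iff_trans _ (same_coordsP hn sA sB).
have eP := @Pm_oH R n r; have eN := Nm_oH hr hn.
by move: (Pm _) (Nm _) eP eN => P N -> ->.
Qed.

Lemma tder_act a p w : S p -> tangent S p w -> tder S (act a) p w = act a w.
Proof. by move=> Sp tw; apply: tder_lin => //; [exact: TM_cont|exact: act_lin]. Qed.

(** An invariant metric is determined by its value at the base point. *)
Lemma orthogonal_canonical g (a0 ae be ah bh : R) : orthogonal_metric r g a0 ae be ah bh ->
  forall p u v, S p -> tangent S p u -> tangent S p v ->
  g p u v = can_metric r a0 ae be ah bh p u v.
Proof.
move=> [_ inv _ base] p u v Sp tu tv.
have B0 A B : skewherm A -> skewherm B ->
    g (oH r) (inf_act A (oH r)) (inf_act B (oH r)) = ip A (Gam a0 ae be ah bh P0 N0 B).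
  move=> sA sB.
  have [A0 [A1 [A2 [A3 [A4 [[s0 s1 s2 s3 s4] eA]]]]]] := split_exists hn sA.
  have [B0 [B1 [B2 [B3 [B4 [[t0 t1 t2 t3 t4] eB]]]]]] := split_exists hn sB.
  have [sA' sB' E] := ip_Gam_split hn a0 ae be ah bh s0 t0 s1 t1 s2 t2 s3 t3 s4 t4.
  have hA := (inf_act_oH sA sA').2 eA; have hB := (inf_act_oH sB sB').2 eB.
  rewrite hA hB.
  apply: etrans (base _ _ _ _ _ _ _ _ _ _ s0 t0 s1 t1 s2 t2 s3 t3 s4 t4) _.
  apply: etrans (esym E) _; apply: esym.
  exact: (ip_Gam_same hn a0 ae be ah bh sA sA' sB sB' eA eB).
move: Sp tu tv; case=> a sa ->.
have ua : a \is unitarymx by case: sa.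
have So := @TrCP_oH R n r hr; have Sp := TrCP_act hr ua So.
move=> /(tangentP hr hn Sp) [A sA ->] /(tangentP hr hn Sp) [B sB ->].
rewrite (can_metric_inf_act hn hr _ _ _ _ _ Sp sA sB).
have [A' sA' ->] := frame_skew ua sA; have [B' sB' ->] := frame_skew ua sB.
have I D : inf_act (cj a D) (act a (oH r)) = act a (inf_act D (oH r)).
  exact: esym (act_inf_act hr _ _ ua).
have tA := tangent_inf_act hr So sA'; have tB := tangent_inf_act hr So sB'.
rewrite !I -(tder_act a So tA) -(tder_act a So tB) (inv a sa _ _ _ So tA tB).
rewrite (B0 _ _ sA' sB').
have eP : Pm (act a (oH r)) = cj a P0 := etrans (Pm_act _ _) (congr1 (cj a) (Pm_oH r)).
have eN : Nm (act a (oH r)) = cj a N0 := etrans (Nm_act _ _ _) (congr1 (cj a) (Nm_oH hr hn)).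
move: (Pm _) (Nm _) eP eN => P N -> ->.
by rewrite (Gam_cj ua) (ip_cj _ _ ua).
Qed.

Section Fields.
Context (x y z : R).

Definition can_field p : TM := inf_act (vpt x y z (Pm p) (Nm p)) p.

Lemma field_canonical xi : G_invariant_field r xi ->
  tangent S (oH r) (xi (oH r)) -> xi (oH r) = inf_act (vpt x y z P0 N0) (oH r) ->
  forall p, S p -> xi p = can_field p.
Proof.
move=> inv tx e p [a sa ->]; have ua : a \is unitarymx by case: sa.
have So := @TrCP_oH R n r hr.
have := inv a sa _ So; rewrite (tder_act _ So tx) e => <-.
apply: etrans (act_inf_act hr _ _ ua) _; congr (inf_act _ _).
have eP : Pm (act a (oH r)) = cj a P0 := etrans (Pm_act _ _) (congr1 (cj a) (Pm_oH r)).
have eN : Nm (act a (oH r)) = cj a N0 := etrans (Nm_act _ _ _) (congr1 (cj a) (Nm_oH hr hn)).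
move: (Pm _) (Nm _) eP eN => P N -> ->.
exact: esym (vpt_cj ua _ _ _ _ _).
Qed.

Context (a0 ae be ah bh : R).

Lemma invariant_pairP xi g : invariant_pair r xi g (vpt x y z P0 N0) a0 ae be ah bh ->
  [/\ forall p u v, S p -> tangent S p u -> tangent S p v ->
        g p u v = can_metric r a0 ae be ah bh p u v,
      forall p, S p -> xi p = can_field p &
      [/\ 0 < a0, 0 < ae, 0 < be, 0 < ah & 0 < bh]].
Proof.
move=> [vxi inv e om]; split; last by case: om.
  exact: orthogonal_canonical.
by apply: (field_canonical inv) => //; apply: vxi.2; exact: (TrCP_oH hr).
Qed.

Lemma can_invariant_pair : [/\ 0 < a0, 0 < ae, 0 < be, 0 < ah & 0 < bh] ->
  invariant_pair r can_field (can_metric r a0 ae be ah bh) (vpt x y z P0 N0) a0 ae be ah bh.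
Proof.
move=> pos; have So := @TrCP_oH R n r hr.
have xE p : S p -> can_field p = inf_act (vpt x y z (Pm p) (Nm p)) p by [].
split.
- exact: (xi_vfield hn hr xE).
- move=> a sa p Sp; have ua : a \is unitarymx by case: sa.
  rewrite (tder_act _ Sp (xi_tangent hn hr xE Sp)).
  exact: esym (xi_equivariant hr xE ua Sp).
- have eV := f_equal2 (vpt x y z) (@Pm_oH R n r) (Nm_oH hr hn).
  exact: (congr1 (fun M => inf_act M (oH r)) eV).
split; [| |exact: pos|].
- case: pos => p1 p2 p3 p4 p5.
  exact: (g_riemannian hn hr p1 p2 p3 p4 p5 (fun p u v _ _ _ => erefl)).
- move=> a sa p u v Sp tu tv; have ua : a \is unitarymx by case: sa.
  rewrite (tder_act a Sp tu) (tder_act a Sp tv).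
  move: tu tv => /(tangentP hr hn Sp) [A sA ->] /(tangentP hr hn Sp) [B sB ->].
  have I D : act a (inf_act D p) = inf_act (cj a D) (act a p) by exact: (act_inf_act hr _ _ ua).
  rewrite (I A) (I B); have Sap := TrCP_act hr ua Sp.
  apply: etrans (can_metric_inf_act hn hr _ _ _ _ _ Sap (cj_skew a sA) (cj_skew a sB)) _.
  apply: etrans _ (esym (can_metric_inf_act hn hr _ _ _ _ _ Sp sA sB)).
  have eP : Pm (act a p) = cj a (Pm p) by exact: Pm_act.
  have eN : Nm (act a p) = cj a (Nm p) by exact: Nm_act.
  move: (Pm (act a p)) (Nm (act a p)) (Pm p) (Nm p) eP eN => P' N' P N -> ->.
  by rewrite (Gam_cj ua) (ip_cj _ _ ua).
- move=> A0 B0 A1 B1 A2 B2 A3 B3 A4 B4 s0 t0 s1 t1 s2 t2 s3 t3 s4 t4.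
  have [sA sB E] := ip_Gam_split hn a0 ae be ah bh s0 t0 s1 t1 s2 t2 s3 t3 s4 t4.
  apply: etrans (can_metric_inf_act hn hr _ _ _ _ _ So sA sB) _.
  apply: etrans E.
  have eP := @Pm_oH R n r; have eN := Nm_oH hr hn.
  by move: (Pm _) (Nm _) eP eN => P N -> ->.
Qed.

End Fields.
End Invariant.

(** * Solving the equations *)

Section TypeAlgebra.
Context {R : realType}.

(** The equations of [contact_cond] in terms of the coordinates of the Reeb vector in
    the orthonormal frame [xi1], [xi2], [xi3]. *)
Definition frame_cond (a0 ae be c1 c2 c3 : R) : Prop :=
  [/\ c1 ^+ 2 + c2 ^+ 2 + c3 ^+ 2 = 1,
   [/\ c1 * c2 * (1 - 4 * be) = 0, c1 * c3 * (1 - 4 * ae) = 0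
     & c2 * c3 * (1 - 4 * a0) = 0] &
   [/\ c3 ^+ 2 * be ^+ 2 + c2 ^+ 2 * ae ^+ 2 = 4 * a0 * ae * be * (1 - c1 ^+ 2),
       c3 ^+ 2 * be ^+ 2 + c1 ^+ 2 * a0 ^+ 2 = 4 * a0 * ae * be * (1 - c2 ^+ 2)
     & c2 ^+ 2 * ae ^+ 2 + c1 ^+ 2 * a0 ^+ 2 = 4 * a0 * ae * be * (1 - c3 ^+ 2)]].

(** The same for [half_cond]. *)
Definition frame_half (a0 ae be c1 c2 c3 ah bh : R) : Prop :=
  c3 * (ah - bh) = 0 /\ a0 * c1 ^+ 2 + ae * c2 ^+ 2 + be * c3 ^+ 2 = 16 * ah * bh.

Lemma sqrtP (a : R) : 0 < a -> exists2 k, 0 < k & a = k ^+ 2 /\ Num.sqrt a = k.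
Proof.
move=> a0; exists (Num.sqrt a); first by rewrite sqrtr_gt0.
by rewrite sqr_sqrtr // ltW.
Qed.

Lemma sqr_pos_inj (a b : R) : 0 < a -> 0 < b -> a ^+ 2 = b ^+ 2 -> a = b.
Proof.
move=> a0 b0 /eqP; rewrite eqf_sqr => /orP[/eqP//|/eqP e].
by have := a0; rewrite e oppr_gt0 ltNge ltW.
Qed.

Lemma unit_contact (A B D c1 c2 c3 : R) : 0 < A -> 0 < B -> 0 < D ->
  contact_cond (A ^+ 2) (B ^+ 2) (D ^+ 2) (A^-1 * c1) (B^-1 * c2) (D^-1 * c3) <->
  frame_cond (A ^+ 2) (B ^+ 2) (D ^+ 2) c1 c2 c3.
Proof.
move=> A0 B0 D0; have nA := lt0r_neq0 A0; have nB := lt0r_neq0 B0; have nD := lt0r_neq0 D0.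
rewrite /contact_cond /frame_cond.
have e1 : A ^+ 2 * (A^-1 * c1) = A * c1 by field.
have e2 : B ^+ 2 * (B^-1 * c2) = B * c2 by field.
have e3 : D ^+ 2 * (D^-1 * c3) = D * c3 by field.
rewrite e1 e2 e3.
have Z (q u u' : R) : q != 0 -> u = q * u' -> (u = 0) <-> (u' = 0).
  move=> q0 ->; split=> [/eqP|->]; last by rewrite mulr0.
  by rewrite mulf_eq0 (negbTE q0) => /eqP.
have Q q u v (u' v' : R) : q != 0 -> q * (u - v) = u' - v' -> (u = v) <-> (u' = v').
  move=> q0 e; split=> h.
    by apply/eqP; rewrite -subr_eq0 -e h subrr mulr0.
  apply/eqP; rewrite -subr_eq0; apply/eqP/(mulfI q0); by rewrite e h subrr mulr0.
have i1 : A * c1 * (A^-1 * c1) + B * c2 * (B^-1 * c2) + D * c3 * (D^-1 * c3) = 1 <->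
    c1 ^+ 2 + c2 ^+ 2 + c3 ^+ 2 = 1.
  by apply: (Q 1); [exact: oner_neq0|field; rewrite nA nB nD].
have i2 : A * c1 * (B * c2) * (1 - 4 * D ^+ 2) = 0 <-> c1 * c2 * (1 - 4 * D ^+ 2) = 0.
  by apply: (Z (A * B)); [rewrite mulf_neq0|ring].
have i3 : A * c1 * (D * c3) * (1 - 4 * B ^+ 2) = 0 <-> c1 * c3 * (1 - 4 * B ^+ 2) = 0.
  by apply: (Z (A * D)); [rewrite mulf_neq0|ring].
have i4 : B * c2 * (D * c3) * (1 - 4 * A ^+ 2) = 0 <-> c2 * c3 * (1 - 4 * A ^+ 2) = 0.
  by apply: (Z (B * D)); [rewrite mulf_neq0|ring].
have q0 : 4 * A ^+ 2 * B ^+ 2 * D ^+ 2 != 0.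
  by rewrite !mulf_neq0 ?expf_neq0 // pnatr_eq0.
have i5 : ((D * c3) ^+ 2 / B ^+ 2 + (B * c2) ^+ 2 / D ^+ 2) / (4 * A ^+ 2) + A * c1 * (A^-1 * c1) = 1 <->
    c3 ^+ 2 * (D ^+ 2) ^+ 2 + c2 ^+ 2 * (B ^+ 2) ^+ 2 = 4 * A ^+ 2 * B ^+ 2 * D ^+ 2 * (1 - c1 ^+ 2).
  by apply: (Q _ _ _ _ _ q0); field; rewrite nA nB nD.
have i6 : ((D * c3) ^+ 2 / A ^+ 2 + (A * c1) ^+ 2 / D ^+ 2) / (4 * B ^+ 2) + B * c2 * (B^-1 * c2) = 1 <->
    c3 ^+ 2 * (D ^+ 2) ^+ 2 + c1 ^+ 2 * (A ^+ 2) ^+ 2 = 4 * A ^+ 2 * B ^+ 2 * D ^+ 2 * (1 - c2 ^+ 2).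
  by apply: (Q _ _ _ _ _ q0); field; rewrite nA nB nD.
have i7 : ((B * c2) ^+ 2 / A ^+ 2 + (A * c1) ^+ 2 / B ^+ 2) / (4 * D ^+ 2) + D * c3 * (D^-1 * c3) = 1 <->
    c2 ^+ 2 * (B ^+ 2) ^+ 2 + c1 ^+ 2 * (A ^+ 2) ^+ 2 = 4 * A ^+ 2 * B ^+ 2 * D ^+ 2 * (1 - c3 ^+ 2).
  by apply: (Q _ _ _ _ _ q0); field; rewrite nA nB nD.
split=> -[h1 [h2 h3 h4] [h5 h6 h7]].
  by split; [exact/i1|split; [exact/i2|exact/i3|exact/i4]|split; [exact/i5|exact/i6|exact/i7]].
by split; [exact/i1|split; [exact/i2|exact/i3|exact/i4]|split; [exact/i5|exact/i6|exact/i7]].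
Qed.

Lemma unit_half (A B D c1 c2 c3 ah bh : R) : 0 < A -> 0 < B -> 0 < D ->
  half_cond (A ^+ 2 * (A^-1 * c1)) (B ^+ 2 * (B^-1 * c2)) (D ^+ 2 * (D^-1 * c3)) ah bh <->
  frame_half (A ^+ 2) (B ^+ 2) (D ^+ 2) c1 c2 c3 ah bh.
Proof.
move=> A0 B0 D0; have nA := lt0r_neq0 A0; have nB := lt0r_neq0 B0; have nD := lt0r_neq0 D0.
have e1 : A ^+ 2 * (A^-1 * c1) = A * c1 by field.
have e2 : B ^+ 2 * (B^-1 * c2) = B * c2 by field.
have e3 : D ^+ 2 * (D^-1 * c3) = D * c3 by field.
rewrite /half_cond /frame_half e1 e2 e3 !exprMn -mulrA.
split=> -[h1 h2]; split=> //; last by rewrite h1 mulr0.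
by move/eqP: h1; rewrite mulf_eq0 (negbTE nD) => /eqP.
Qed.

(** Positivity excludes [q = - 1]. *)
Lemma balance (k c q : R) : 0 < k -> 0 < c -> 0 < q -> k / (c * q) = k * q / c <-> q = 1.
Proof.
move=> k0 c0 q0; have nk := lt0r_neq0 k0; have nc := lt0r_neq0 c0; have nq := lt0r_neq0 q0.
split=> [e|->]; last by field.
apply: sqr_pos_inj => //; rewrite expr1n.
have e1 : k / (c * q) * (c * q / k) = 1 by field; rewrite nk nc nq.
by rewrite -e1 e; field; rewrite nk nc.
Qed.

Lemma sq_quarterP (k : R) : 0 < k -> k ^+ 2 = 4^-1 <-> k = 2^-1.
Proof.
move=> k0; split=> [e|->]; last by field.
by apply: sqr_pos_inj; rewrite ?invr_gt0 // e; field.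
Qed.

Lemma mul0_iff (x u v : R) : x != 0 -> x * (u - v) = 0 <-> u = v.
Proof.
move=> nx; split=> [/eqP|->]; last by rewrite subrr mulr0.
by rewrite mulf_eq0 (negbTE nx) /= subr_eq0 => /eqP.
Qed.

Lemma mul2_iff (x y u v : R) : x != 0 -> y != 0 -> x * y * (u - v) = 0 <-> u = v.
Proof. by move=> nx ny; apply: mul0_iff; rewrite mulf_neq0. Qed.

Lemma quarterP (a : R) : 1 = 4 * a <-> a = 4^-1.
Proof. by split=> [h|->]; [apply: (mulfI (_ : 4 != 0 :> R)); [rewrite pnatr_eq0|rewrite -h; field]|field]. Qed.

Section Kinds.
Context (a0 ae be : R) (p1 : 0 < a0) (p2 : 0 < ae) (p3 : 0 < be).
Let n1 := lt0r_neq0 p1.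
Let n2 := lt0r_neq0 p2.
Let n3 := lt0r_neq0 p3.

(** The equations that are not void all say the same, up to a nonzero coefficient
    of the metric as a factor. *)
Lemma frame_axis e : e ^+ 2 = 1 ->
  [/\ frame_cond a0 ae be e 0 0 <-> a0 = 4 * ae * be,
      frame_cond a0 ae be 0 e 0 <-> ae = 4 * a0 * be &
      frame_cond a0 ae be 0 0 e <-> be = 4 * a0 * ae].
Proof.
have K (a Y : R) : a != 0 -> (a ^+ 2 = a * Y) <-> (a = Y).
  by move=> na; split=> [|->]; rewrite expr2 // => /(mulfI na).
move=> u; rewrite /frame_cond u; split; split.
- by case=> _ _ [_ h _]; apply/(K _ _ n1); apply: (etrans _ (etrans h _)); ring.
- by move=> e1; split; [ring|split; ring|]; split; rewrite e1; ring.
- by case=> _ _ [h _ _]; apply/(K _ _ n2); apply: (etrans _ (etrans h _)); ring.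
- by move=> e1; split; [ring|split; ring|]; split; rewrite e1; ring.
- by case=> _ _ [h _ _]; apply/(K _ _ n3); apply: (etrans _ (etrans h _)); ring.
- by move=> e1; split; [ring|split; ring|]; split; rewrite e1; ring.
Qed.

(** Two nonzero coordinates force the third coefficient to be [1 / 4]; the remaining
    equations then identify the first two coefficients. *)
Lemma frame_plane x y : x ^+ 2 + y ^+ 2 = 1 -> x != 0 -> y != 0 ->
  [/\ frame_cond a0 ae be x y 0 <-> ae = a0 /\ be = 4^-1,
      frame_cond a0 ae be x 0 y <-> be = a0 /\ ae = 4^-1 &
      frame_cond a0 ae be 0 x y <-> be = ae /\ a0 = 4^-1].
Proof.
move=> u nx ny; have ux : 1 - x ^+ 2 = y ^+ 2 by rewrite -u; ring.
have ny2 : y ^+ 2 != 0 by rewrite expf_neq0.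
have K (a b q : R) : a != 0 -> q = 4^-1 -> y ^+ 2 * a ^+ 2 = 4 * q * (y ^+ 2 * a * b) -> a = b.
  move=> na -> h; apply: (mulfI (mulf_neq0 ny2 na)).
  by apply: (etrans _ (etrans h _)); field.
have v : y ^+ 2 = 1 - x ^+ 2 by [].
split; split.
- case=> _ [/(mul2_iff _ _ nx ny)/quarterP q _ _] [h _ _]; split=> //; apply: K n2 q _.
  by apply: (etrans _ (etrans h _)); rewrite ?ux; ring.
- by move=> [-> ->]; split; [rewrite -u; ring|split; field|split; rewrite ?v; field].
- case=> _ [_ /(mul2_iff _ _ nx ny)/quarterP q _] [h _ _]; split=> //; apply: K n3 q _.
  by apply: (etrans _ (etrans h _)); rewrite ?ux; ring.
- by move=> [-> ->]; split; [rewrite -u; ring|split; field|split; rewrite ?v; field].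
- case=> _ [_ _ /(mul2_iff _ _ nx ny)/quarterP q] [_ h _]; split=> //; apply: K n3 q _.
  by apply: (etrans _ (etrans h _)); rewrite ?ux; ring.
- by move=> [-> ->]; split; [rewrite -u; ring|split; field|split; rewrite ?v; field].
Qed.

Lemma frame_sphere x y z : x ^+ 2 + y ^+ 2 + z ^+ 2 = 1 -> x != 0 -> y != 0 -> z != 0 ->
  frame_cond a0 ae be x y z <-> [/\ a0 = 4^-1, ae = 4^-1 & be = 4^-1].
Proof.
move=> u nx ny nz; have v : z ^+ 2 = 1 - x ^+ 2 - y ^+ 2 by rewrite -u; ring.
split=> [[_ [h1 h2 h3] _]|[-> -> ->]].
  by split; apply/quarterP; [exact/(mul2_iff _ _ ny nz)|exact/(mul2_iff _ _ nx nz)|exact/(mul2_iff _ _ nx ny)].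
by split=> //; [split; field|split; rewrite v; field].
Qed.

End Kinds.

End TypeAlgebra.

Section Trigonometry.
Context {R : realType}.

Lemma theta_rangeP (theta : R) : theta_range theta -> cos theta != 0 /\ sin theta != 0.
Proof.
move=> [/andP[t0 t2] [n1 n2 n3]]; have p0 := pi_gt0 R.
split.
  have [h|h|//] := ltgtP theta (pi / 2).
    by rewrite gt_eqF // cos_gt0_pihalf //; apply/andP; split; lra.
  have [h'|h'|//] := ltgtP theta (3 * pi / 2).
    have -> : theta = (theta - pi) + pi by ring.
    by rewrite cosDpi oppr_eq0 gt_eqF // cos_gt0_pihalf //; apply/andP; split; lra.
  have -> : theta = (theta - 2 * pi) + pi *+ 2 by rewrite mulr2n; ring.
  by rewrite cosD2pi gt_eqF // cos_gt0_pihalf //; apply/andP; split; lra.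
have [h|h|//] := ltgtP theta pi.
  by rewrite gt_eqF // sin_gt0_pi //; apply/andP.
have -> : theta = (theta - pi) + pi by ring.
by rewrite sinDpi oppr_eq0 gt_eqF // sin_gt0_pi //; apply/andP; split; lra.
Qed.

Lemma phi_rangeP (phi : R) : phi_range phi -> cos phi != 0 /\ sin phi != 0.
Proof.
move=> [/andP[t0 t2] n0]; have p0 := pi_gt0 R.
split; first by rewrite gt_eqF // cos_gt0_pihalf //; apply/andP.
have [h|h|//] := ltgtP phi 0; last first.
  by rewrite gt_eqF // sin_gt0_pi //; apply/andP; split; lra.
rewrite -oppr_eq0 -sinN gt_eqF // sin_gt0_pi //; apply/andP; split; lra.
Qed.

End Trigonometry.

(** * Structures given in an orthonormal frame *)

Section Types.
Context {R : realType} {n : nat} (hn : (1 <= n)%N) (r : R) (hr : 0 < r).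
Notation C := R[i].
Notation CM := 'M[C]_n.+1.
Notation RM := ('M[R]_n.+1 * 'M[R]_n.+1)%type.
Notation TM := (RM * RM)%type.
Notation P0 := (E_ 1 1 : CM).
Notation N0 := (E_ 1 2 + E_ 2 1 : CM).
Local Notation S := (@TrCP R n r).
Implicit Types (xi : TM -> TM) (g : TM -> TM -> TM -> R) (v : CM).

Lemma invariant_pair_pos xi g v (a0 ae be ah bh : R) :
  invariant_pair r xi g v a0 ae be ah bh ->
  [/\ 0 < a0, 0 < ae, 0 < be, 0 < ah & 0 < bh].
Proof. by case=> _ _ _ []. Qed.

(** For [n = 1] there is no component of index [eps/2], so that the last two
    coefficients can be changed at will. *)
Lemma invariant_pair_eq xi g v v' (a0 ae be ah bh a0' ae' be' ah' bh' : R) :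
  invariant_pair r xi g v a0 ae be ah bh ->
  v = v' -> a0 = a0' -> ae = ae' -> be = be' ->
  ((1 < n)%N -> ah = ah' /\ bh = bh') -> 0 < ah' -> 0 < bh' ->
  invariant_pair r xi g v' a0' ae' be' ah' bh'.
Proof.
move=> inv <- <- <- <- h p4 p5.
have [n1|n1] := ltnP 1 n; first by have [<- <-] := h n1.
case: inv => vxi ixi exi [rg ig [q0 q1 q2 _ _] og]; split=> //; split=> //.
(* The sum defining [sp_half] is empty. *)
have H0 l A : sp_half l A -> A = 0 :> CM.
  by move=> [a [b ->]]; rewrite big_geq.
move=> A0 B0 A1 B1 A2 B2 A3 B3 A4 B4 s0 t0 s1 t1 s2 t2 s3 t3 s4 t4.
have z (a : R) (A B : CM) : A = 0 -> a * ip A B = 0.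
  by move=> ->; have := ipZl 0 0 B; rewrite scaler0 mul0r => ->; rewrite mulr0.
apply: etrans (og _ _ _ _ _ _ _ _ _ _ s0 t0 s1 t1 s2 t2 s3 t3 s4 t4) _.
have Z (a a' b b' u : R) : a = 0 -> a' = 0 -> b = 0 -> b' = 0 -> u + a + b = u + a' + b'.
  by move=> -> -> -> ->.
exact: Z (z _ _ _ (H0 _ _ s3)) (z _ _ _ (H0 _ _ s3)) (z _ _ _ (H0 _ _ s4)) (z _ _ _ (H0 _ _ s4)).
Qed.

Lemma invariant_contact xi g (x y z a0 ae be ah bh : R) :
  invariant_pair r xi g (vpt x y z P0 N0) a0 ae be ah bh ->
  (contact_metric_structure S xi g <-> contact_cond a0 ae be x y z /\
     ((1 < n)%N -> half_cond (a0 * x) (ae * y) (be * z) ah bh)) /\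
  (killing S g xi <-> kill_cond a0 ae be x y z /\ ((1 < n)%N -> kill_half ah bh x y)).
Proof.
move=> /(invariant_pairP hn hr) [gE xiE [p1 p2 p3 p4 p5]].
split; first exact: (contact_iff hn hr p1 p2 p3 p4 p5 gE xiE).
exact: (killing_iff hn hr p1 p2 p3 p4 p5 gE xiE).
Qed.

Lemma imp_iff (G P Q : Prop) : (P <-> Q) -> ((G -> P) <-> (G -> Q)).
Proof. by move=> [h1 h2]; split=> h g; [exact: h1 (h g)|exact: h2 (h g)]. Qed.

Definition frame (a0 ae be c1 c2 c3 : R) : CM :=
  c1%:C *: xi1 a0 + c2%:C *: xi2 ae + c3%:C *: xi3 be.

Lemma frameE (a0 ae be c1 c2 c3 : R) : frame a0 ae be c1 c2 c3 =
  vpt ((Num.sqrt a0)^-1 * c1) ((Num.sqrt ae)^-1 * c2) ((Num.sqrt be)^-1 * c3) P0 N0.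
Proof.
rewrite (vptE hn) /frame /xi1 /xi2 /xi3 !scalerA !rcM.
by rewrite ![_%:C * c1%:C]mulrC ![_%:C * c2%:C]mulrC ![_%:C * c3%:C]mulrC.
Qed.

Lemma invariant_exists v (c1 c2 c3 a0 ae be ah bh : R) : v = frame a0 ae be c1 c2 c3 ->
  0 < a0 -> 0 < ae -> 0 < be -> 0 < ah -> 0 < bh ->
  exists xi g, invariant_pair r xi g v a0 ae be ah bh.
Proof.
move=> -> p1 p2 p3 p4 p5; rewrite frameE.
exists (can_field r ((Num.sqrt a0)^-1 * c1) ((Num.sqrt ae)^-1 * c2) ((Num.sqrt be)^-1 * c3)).
exists (can_metric r a0 ae be ah bh).
by apply: can_invariant_pair.
Qed.

(** In the frame of unit vectors, the square roots of the coefficients disappear from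
    the equations. *)
Lemma frame_contact xi g (a0 ae be ah bh c1 c2 c3 : R) :
  invariant_pair r xi g (frame a0 ae be c1 c2 c3) a0 ae be ah bh ->
  (contact_metric_structure S xi g <-> frame_cond a0 ae be c1 c2 c3 /\
     ((1 < n)%N -> frame_half a0 ae be c1 c2 c3 ah bh)) /\
  (killing S g xi <-> kill_cond a0 ae be c1 c2 c3 /\
     ((1 < n)%N -> kill_half ah bh c1 c2)).
Proof.
move=> inv; have [p1 p2 p3 _ _] := invariant_pair_pos inv.
rewrite frameE in inv; move: inv.
have [A A0 [-> ->]] := sqrtP p1; have [B B0 [-> ->]] := sqrtP p2; have [D D0 [-> ->]] := sqrtP p3.
move=> /invariant_contact [ci ki]; split.
  by apply: (iff_trans ci); apply: iff_and; [exact: unit_contact|apply: imp_iff; exact: unit_half].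
have Z (K c q : R) : 0 < K -> K^-1 * c * q = 0 <-> c * q = 0.
  move=> K0; rewrite -mulrA; split=> [/eqP|->]; last by rewrite mulr0.
  by rewrite mulf_eq0 invr_eq0 (negbTE (lt0r_neq0 K0)) => /eqP.
(* The coordinates in the frame and those of [kill_cond] differ by nonzero factors. *)
have Z' (K c q : R) : 0 < K -> q * (K^-1 * c) = 0 <-> q * c = 0.
  by move=> K0; rewrite ![q * _]mulrC; exact: Z.
apply: (iff_trans ki); apply: iff_and.
  split=> -[h1 h2 h3]; split; [exact: (Z _ _ _ A0).1 h1|exact: (Z _ _ _ B0).1 h2|
    exact: (Z _ _ _ D0).1 h3|exact: (Z _ _ _ A0).2 h1|exact: (Z _ _ _ B0).2 h2|
    exact: (Z _ _ _ D0).2 h3].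
by apply: imp_iff; apply: iff_and; exact: Z'.
Qed.

Lemma lin3 (K : pzRingType) (L : lmodType K) (U V W : L) (c1 c2 : K) :
  [/\ c1 *: U + 0 *: V + 0 *: W = c1 *: U, 0 *: U + c1 *: V + 0 *: W = c1 *: V &
      0 *: U + 0 *: V + c1 *: W = c1 *: W] /\
  [/\ c1 *: U + c2 *: V + 0 *: W = c1 *: U + c2 *: V,
      c1 *: U + 0 *: V + c2 *: W = c1 *: U + c2 *: W &
      0 *: U + c1 *: V + c2 *: W = c1 *: V + c2 *: W].
Proof. by rewrite !scale0r !addr0 !add0r. Qed.

Lemma signC (s : bool) : ((-1) ^+ s : C) = ((-1) ^+ s : R)%:C.
Proof. by case: s; rewrite ?expr1 ?expr0 ?rmorphN1. Qed.

Lemma sign_sqr (s : bool) : ((-1) ^+ s) ^+ 2 = 1 :> R.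
Proof. by case: s; rewrite ?expr0 ?expr1 ?expr1n ?sqrrN ?expr1n. Qed.

Lemma sign_neq0 (s : bool) : (-1) ^+ s != 0 :> R.
Proof. by rewrite signr_eq0. Qed.

Lemma transport xi g v v' (a0 ae be ah bh : R) : invariant_pair r xi g v a0 ae be ah bh ->
  v = v' -> invariant_pair r xi g v' a0 ae be ah bh.
Proof. by move=> D <-. Qed.

Lemma kill_axis (a0 ae be e : R) : e != 0 ->
  [/\ kill_cond a0 ae be e 0 0 <-> ae = be, kill_cond a0 ae be 0 e 0 <-> a0 = be &
      kill_cond a0 ae be 0 0 e <-> a0 = ae].
Proof.
move=> ne; rewrite /kill_cond !mul0r.
by split; split=> [[]|h]; do ?[by move=> /(mul0_iff _ _ ne)|by move=> _ /(mul0_iff _ _ ne)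
  |by move=> _ _ /(mul0_iff _ _ ne)]; split=> //; exact/(mul0_iff _ _ ne).
Qed.

Lemma kill_halfP (a b x y : R) : x != 0 \/ y != 0 -> kill_half a b x y <-> a = b.
Proof.
rewrite /kill_half ![(a - b) * _]mulrC => -[h|h]; split=> [[h1 h2]|->]; rewrite ?subrr ?mulr0 //.
  exact/(mul0_iff _ _ h).
exact/(mul0_iff _ _ h).
Qed.

Lemma axis_frame (s : bool) (a0 ae be : R) :
  [/\ (-1) ^+ s *: xi1 a0 = frame a0 ae be ((-1) ^+ s) 0 0,
      (-1) ^+ s *: xi2 ae = frame a0 ae be 0 ((-1) ^+ s) 0 &
      (-1) ^+ s *: xi3 be = frame a0 ae be 0 0 ((-1) ^+ s)].
Proof.
have [[h1 h2 h3] _] := lin3 (xi1 a0 : CM) (xi2 ae) (xi3 be) ((-1) ^+ s : R)%:C 0.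
by split; rewrite /frame signC; [exact: esym h1|exact: esym h2|exact: esym h3].
Qed.

Lemma plane_frame (a0 ae be x y : R) :
  [/\ x%:C *: xi1 a0 + y%:C *: xi2 ae = frame a0 ae be x y 0,
      x%:C *: xi1 a0 + y%:C *: xi3 be = frame a0 ae be x 0 y &
      x%:C *: xi2 ae + y%:C *: xi3 be = frame a0 ae be 0 x y].
Proof.
have [_ [h1 h2 h3]] := lin3 (xi1 a0 : CM) (xi2 ae) (xi3 be) x%:C y%:C.
by split; [exact: esym h1|exact: esym h2|exact: esym h3].
Qed.

Lemma xi_sqr (k : R) : 0 < k ->
  [/\ xi1 (k ^+ 2) = k^-1%:C *: X :> CM, xi2 (k ^+ 2) = k^-1%:C *: mu :> CM &
      xi3 (k ^+ 2) = k^-1%:C *: nu :> CM].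
Proof. by move=> k0; rewrite /xi1 /xi2 /xi3 sqrtr_sqr gtr0_norm. Qed.

Section Kinds.
Context xi g (a0 ae be ah bh : R).
Notation inv v := (invariant_pair r xi g v a0 ae be ah bh).
Notation contactS := (contact_metric_structure S xi g).
Notation killS := (killing S g xi).

Lemma axis1_structure (s : bool) : inv ((-1) ^+ s *: xi1 a0) ->
  (contactS <-> a0 = 4 * ae * be /\ ((1 < n)%N -> a0 = 16 * ah * bh)) /\
  (killS <-> ae = be /\ ((1 < n)%N -> ah = bh)).
Proof.
move=> J; have [fE _ _] := axis_frame s a0 ae be; have I := transport J fE; have [p1 p2 p3 _ _] := invariant_pair_pos I.
have [ci ki] := frame_contact I; clear J fE I; have u := sign_sqr s; have nz := sign_neq0 s.
split; [apply: (iff_trans ci)|apply: (iff_trans ki)]; apply: iff_and; try apply: imp_iff.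
- by have [] := frame_axis p1 p2 p3 u.
- by rewrite /frame_half u !expr0n /= mul0r !mulr0 !addr0 mulr1; split=> [[]|].
- by have [] := kill_axis a0 ae be nz.
- by apply: kill_halfP; left.
Qed.

Lemma axis2_structure (s : bool) : inv ((-1) ^+ s *: xi2 ae) ->
  (contactS <-> ae = 4 * a0 * be /\ ((1 < n)%N -> ae = 16 * ah * bh)) /\
  (killS <-> a0 = be /\ ((1 < n)%N -> ah = bh)).
Proof.
move=> J; have [_ fE _] := axis_frame s a0 ae be; have I := transport J fE; have [p1 p2 p3 _ _] := invariant_pair_pos I.
have [ci ki] := frame_contact I; clear J fE I; have u := sign_sqr s; have nz := sign_neq0 s.
split; [apply: (iff_trans ci)|apply: (iff_trans ki)]; apply: iff_and; try apply: imp_iff.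
- by have [] := frame_axis p1 p2 p3 u.
- by rewrite /frame_half u !expr0n /= mul0r !mulr0 addr0 add0r mulr1; split=> [[]|].
- by have [] := kill_axis a0 ae be nz.
- by apply: kill_halfP; right.
Qed.

Lemma axis3_structure (s : bool) : inv ((-1) ^+ s *: xi3 be) ->
  (contactS <-> be = 4 * a0 * ae /\ ((1 < n)%N -> ah = bh /\ be = 16 * ah * bh)) /\
  (killS <-> a0 = ae).
Proof.
move=> J; have [_ _ fE] := axis_frame s a0 ae be; have I := transport J fE; have [p1 p2 p3 _ _] := invariant_pair_pos I.
have [ci ki] := frame_contact I; clear J fE I; have u := sign_sqr s; have nz := sign_neq0 s.
split; [apply: (iff_trans ci); apply: iff_and; try apply: imp_iff|apply: (iff_trans ki)].
- by have [] := frame_axis p1 p2 p3 u.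
- rewrite /frame_half u !expr0n /= !mulr0 !add0r mulr1; apply: iff_and => //.
  exact: mul0_iff.
have [_ _ ka] := kill_axis a0 ae be nz; apply: iff_trans ka.
by split=> [[]|h] //; split=> // _; rewrite /kill_half !mulr0.
Qed.

Section Plane.
Context (x y : R) (u : x ^+ 2 + y ^+ 2 = 1) (nx : x != 0) (ny : y != 0).

Lemma plane12_structure : inv (x%:C *: xi1 a0 + y%:C *: xi2 ae) ->
  (contactS <-> (ae = a0 /\ be = 4^-1) /\ ((1 < n)%N -> a0 = 16 * ah * bh)) /\
  (contactS -> (killS <-> a0 = 4^-1 /\ ((1 < n)%N -> ah = bh))).
Proof.
move=> J; have [fE _ _] := plane_frame a0 ae be x y; have I := transport J fE; have [p1 p2 p3 _ _] := invariant_pair_pos I.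
have [ci ki] := frame_contact I; clear J fE I; have [fp _ _] := frame_plane a0 p2 p3 u nx ny.
have cE : contactS <-> (ae = a0 /\ be = 4^-1) /\ ((1 < n)%N -> a0 = 16 * ah * bh).
  apply: (iff_trans ci); split=> [[f h]|[[e1 e2] h]]; [have [e1 e2] := fp.1 f|];
    (split; [first [exact: conj e1 e2|exact: fp.2 (conj e1 e2)]|]).
    by move=> m; have [_ <-] := h m; rewrite expr0n mulr0 addr0 e1 -mulrDr u mulr1.
  move=> m; rewrite /frame_half e1 mul0r; split=> //.
  by rewrite expr0n mulr0 addr0 -mulrDr u mulr1; exact: h.
split=> // /cE [[e1 e2] _]; apply: (iff_trans ki); rewrite e1 e2; apply: iff_and.
  rewrite /kill_cond mul0r; split=> [[/(mul0_iff _ _ nx)]|->] //; by rewrite subrr !mulr0.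
by apply: imp_iff; apply: kill_halfP; left.
Qed.

Lemma plane13_structure : inv (x%:C *: xi1 a0 + y%:C *: xi3 be) ->
  (contactS <-> (be = a0 /\ ae = 4^-1) /\ ((1 < n)%N -> ah = bh /\ a0 = 16 * ah * bh)) /\
  (contactS -> (killS <-> a0 = 4^-1)).
Proof.
move=> J; have [_ fE _] := plane_frame a0 ae be x y; have I := transport J fE; have [p1 p2 p3 _ _] := invariant_pair_pos I.
have [ci ki] := frame_contact I; clear J fE I; have [_ fp _] := frame_plane a0 p2 p3 u nx ny.
have cE : contactS <-> (be = a0 /\ ae = 4^-1) /\ ((1 < n)%N -> ah = bh /\ a0 = 16 * ah * bh).
  apply: (iff_trans ci); split=> [[f h]|[[e1 e2] h]]; [have [e1 e2] := fp.1 f|];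
    (split; [first [exact: conj e1 e2|exact: fp.2 (conj e1 e2)]|]).
    move=> m; have [/(mul0_iff _ _ ny) e <-] := h m; split=> //.
    by rewrite expr0n mulr0 addr0 e1 -mulrDr u mulr1.
  move=> m; have [e e'] := h m; split; first exact/(mul0_iff _ _ ny).
  by rewrite expr0n mulr0 addr0 e1 -mulrDr u mulr1.
split=> // /cE [[e1 e2] h]; apply: (iff_trans ki); rewrite e1 e2.
rewrite /kill_cond /kill_half mul0r; split=> [[[/(mul0_iff _ _ nx)]]|->] //.
by rewrite subrr !mulr0; split=> // m; have [-> _] := h m; rewrite subrr !mul0r.
Qed.

Lemma plane23_structure : inv (x%:C *: xi2 ae + y%:C *: xi3 be) ->
  (contactS <-> (be = ae /\ a0 = 4^-1) /\ ((1 < n)%N -> ah = bh /\ ae = 16 * ah * bh)) /\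
  (contactS -> (killS <-> ae = 4^-1)).
Proof.
move=> J; have [_ _ fE] := plane_frame a0 ae be x y; have I := transport J fE; have [p1 p2 p3 _ _] := invariant_pair_pos I.
have [ci ki] := frame_contact I; clear J fE I; have [_ _ fp] := frame_plane a0 p2 p3 u nx ny.
have cE : contactS <-> (be = ae /\ a0 = 4^-1) /\ ((1 < n)%N -> ah = bh /\ ae = 16 * ah * bh).
  apply: (iff_trans ci); split=> [[f h]|[[e1 e2] h]]; [have [e1 e2] := fp.1 f|];
    (split; [first [exact: conj e1 e2|exact: fp.2 (conj e1 e2)]|]).
    move=> m; have [/(mul0_iff _ _ ny) e <-] := h m; split=> //.
    by rewrite expr0n mulr0 add0r e1 -mulrDr u mulr1.
  move=> m; have [e e'] := h m; split; first exact/(mul0_iff _ _ ny).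
  by rewrite expr0n mulr0 add0r e1 -mulrDr u mulr1.
split=> // /cE [[e1 e2] h]; apply: (iff_trans ki); rewrite e1 e2.
rewrite /kill_cond /kill_half mul0r; split=> [[[_ /(mul0_iff _ _ nx)]]|->] //.
by rewrite subrr !mulr0; split=> // m; have [-> _] := h m; rewrite subrr !mul0r.
Qed.

End Plane.

Lemma sphere_structure (x y z : R) : x ^+ 2 + y ^+ 2 + z ^+ 2 = 1 ->
  x != 0 -> y != 0 -> z != 0 -> inv (frame a0 ae be x y z) ->
  (contactS <-> [/\ a0 = 4^-1, ae = 4^-1 & be = 4^-1] /\
     ((1 < n)%N -> ah = bh /\ 4^-1 = 16 * ah * bh)) /\
  (contactS -> killS).
Proof.
move=> u nx ny nz I; have [p1 p2 p3 _ _] := invariant_pair_pos I.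
have [ci ki] := frame_contact I; clear I; have fs := frame_sphere a0 ae be u nx ny nz.
have cE : contactS <-> [/\ a0 = 4^-1, ae = 4^-1 & be = 4^-1] /\
     ((1 < n)%N -> ah = bh /\ 4^-1 = 16 * ah * bh).
  apply: (iff_trans ci); split=> [[f h]|[[e1 e2 e3] h]]; [have [e1 e2 e3] := fs.1 f; split; [exact: And3 e1 e2 e3|]|
    split; [exact: fs.2 (And3 e1 e2 e3)|]].
    move=> m; have [/(mul0_iff _ _ nz) e <-] := h m; split=> //.
    by rewrite e1 e2 e3 -!mulrDr u mulr1.
  move=> m; have [e e'] := h m; split; first exact/(mul0_iff _ _ nz).
  by rewrite e1 e2 e3 -!mulrDr u mulr1.
split=> // /cE [[e1 e2 e3] h]; apply/ki; rewrite /kill_cond e1 e2 e3 !subrr !mulr0.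
by split=> // m; have [-> _] := h m; rewrite /kill_half subrr !mul0r.
Qed.

End Kinds.

End Types.

(** * The quarter turn *)

Section Quarter.
Context {R : realType} {n : nat}.
Notation C := R[i].
Notation CM := 'M[C]_n.+1.
Implicit Types (P N B : CM).
Context (e : R) (e2 : e ^+ 2 = 1).
Notation W := (e%:C * 'i%C : C).

Lemma W2 : W * W = -1.
Proof. by apply/eqP; rewrite eq_complex /=; apply/andP; split; apply/eqP; [apply: (etrans (y := - e ^+ 2)); [|rewrite e2]|]; ring. Qed.

Lemma WJ : (W)^*%C = - W.
Proof. by apply/eqP; rewrite eq_complex /=; apply/andP; split; apply/eqP; ring. Qed.

(** Multiplication by the complex structure of [CP^n], or its opposite when
    [e = - 1]. *)
Definition quarterN P N : CM := W *: commutator P N.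

Section Flag.
Context (P N : CM) (fl : flag P N).

Lemma comm_comm_flag : commutator P (commutator P N) = N.
Proof.
rewrite !commutatorE; mxdist; rewrite -!mulmxA (mulmx_pre (flagPP fl)) ?(flagPNP fl).
have h := flagN fl.
by rewrite subr0 sub0r opprK (flagPP fl) -h.
Qed.

Lemma quarterN_sqr : quarterN P N *m quarterN P N = N *m N.
Proof.
rewrite /quarterN -scalemxAl -scalemxAr scalerA W2 scaleN1r !commutatorE; mxdist.
rewrite -!mulmxA (mulmx_pre3 (flagPNP fl)) (mulmx_pre (flagPP fl)) (flagPNP fl).
have -> : P *m (N *m (N *m P)) = P by rewrite (flagNNP fl) (flagPP fl).
have -> : N *m N = N *m (P *m N) + P.
  by rewrite {2}(flagN fl) mulmxDr (flagNNP fl).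
by rewrite mulmx0 mul0mx; move: (N *m _) => Q; apply/matrixP => i j; rewrite !mxE; ring.
Qed.

Lemma Xpt_quarter : Xpt P (quarterN P N) = e%:C *: mupt N.
Proof.
rewrite Xpt.unlock mupt.unlock -[P *m _ - _]commutatorE /quarterN commZr comm_comm_flag !scalerA.
by congr (_ *: _); rewrite mulrC mulrA.
Qed.

Lemma mupt_quarter : mupt (quarterN P N) = (- e)%:C *: Xpt P N.
Proof.
rewrite Xpt.unlock mupt.unlock -[P *m _ - _]commutatorE /quarterN !scalerA.
congr (_ *: _).
have -> : 'i%C / 2 * (e%:C * 'i%C) = ('i%C * 'i%C) * (e%:C / 2) :> C by rewrite mulrACA [_ / 2]mulrC; ring.
by rewrite -expr2 sqr_i rmorphN mulN1r mulNr.
Qed.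

Lemma nupt_quarter : nupt P (quarterN P N) = nupt P N.
Proof. by rewrite nupt.unlock quarterN_sqr. Qed.

Lemma Tpt_quarter : Tpt (quarterN P N) = Tpt N.
Proof. by rewrite Tpt.unlock quarterN_sqr. Qed.

Lemma vpt_quarter (x y z : R) : vpt x y z P (quarterN P N) = vpt (- e * y) (e * x) z P N.
Proof.
rewrite /vpt Xpt_quarter mupt_quarter nupt_quarter.
move: (Xpt P N) (mupt N) (nupt P N) => U V T.
by rewrite !scalerA -!rcM [x * e]mulrC [y * - e]mulrC; congr (_ + _); exact: addrC.
Qed.

Lemma Gam_quarter (a0 ae be ah bh : R) B :
  Gam a0 ae be ah bh P (quarterN P N) B = Gam ae a0 be ah bh P N B.
Proof.
rewrite /Gam quarterN_sqr vpt_quarter /halfpart Tpt_quarter Xpt_quarter mupt_quarter nupt_quarter.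
rewrite !ipZr.
have -> : - e * (ae * (- e * ip B (Xpt P N))) = ae * ip B (Xpt P N).
  by move: (ip _ _) => q; apply: (etrans (y := e ^+ 2 * (ae * q))); [ring|rewrite e2 mul1r].
have -> // : e * (a0 * (e * ip B (mupt N))) = a0 * ip B (mupt N).
by move: (ip _ _) => q; apply: (etrans (y := e ^+ 2 * (a0 * q))); [ring|rewrite e2 mul1r].
Qed.

Lemma phi_op_quarter (a0 ae be ah bh x y z : R) B :
  phi_op a0 ae be ah bh x y z P (quarterN P N) B =
  phi_op ae a0 be ah bh (- e * y) (e * x) z P N B.
Proof.
by rewrite /phi_op Gam_quarter vpt_quarter [- e * (ae * y)]mulrCA [e * (a0 * x)]mulrCA.
Qed.

(** The unitary matrix that multiplies the line of [P] by [e i] and fixes its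
    orthogonal. *)
Lemma quarter_flag_conj : exists2 b : CM, b \is unitarymx &
  cj b P = P /\ cj b N = quarterN P N.
Proof.
have [Q /esym QE] : exists Q : CM, 1%:M - P = Q by exists (1%:M - P).
have [sP sN PP _ _] := fl; pose b : CM := W *: P + Q.
have Qs : Q^t* = Q by rewrite QE ctB ct1 sP.
have bs : b^t* = - W *: P + Q by rewrite /b ctD ctZ sP Qs; congr (_ *: _ + _); exact: WJ.
have PQ : P *m Q = 0 by rewrite QE mulmxBr mulmx1 PP subrr.
have QP : Q *m P = 0 by rewrite QE mulmxBl mul1mx PP subrr.
have QQ : Q *m Q = Q by rewrite {1}QE mulmxBl mul1mx PQ subr0.
have WN : W * - W = 1 by rewrite mulrN W2 opprK.
have PNP : P *m N *m P = 0 by rewrite -mulmxA (flagPNP fl).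
have PNQ : P *m N *m Q = P *m N by rewrite QE mulmxBr mulmx1 PNP subr0.
have QN : Q *m N = N *m P by rewrite QE mulmxBl mul1mx {1}(flagN fl) addrC addKr.
exists b; last split.
- apply/unitarymxP; rewrite bs /b mulmxDl !mulmxDr -!scalemxAl -!scalemxAr !scalerA.
  by rewrite PP PQ QP QQ WN scale1r !scaler0 addr0 add0r QE addrC subrK.
- rewrite /cj bs /b mulmxDl -scalemxAl PP QP addr0 mulmxDr -scalemxAl -!scalemxAr scalerA.
  by rewrite -scalemxAl PP PQ WN scale1r scaler0 addr0.
rewrite /cj bs /b mulmxDl -scalemxAl QN mulmxDr !mulmxDl -!scalemxAl -!scalemxAr !scalerA.
rewrite PNP PNQ -!mulmxA PP PQ scaler0 !mulmx0 add0r addr0 /quarterN commutatorE scalerBr scaleNr.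
exact: addrC.
Qed.

End Flag.
End Quarter.

Section Isomorphism.
Context {R : realType} {n : nat} (hn : (1 <= n)%N) (r : R) (hr : 0 < r).
Notation C := R[i].
Notation CM := 'M[C]_n.+1.
Notation RM := ('M[R]_n.+1 * 'M[R]_n.+1)%type.
Notation TM := (RM * RM)%type.
Implicit Types (A B M : CM) (p u v : TM).
Notation P0 := (E_ 1 1 : CM).
Notation N0 := (E_ 1 2 + E_ 2 1 : CM).
Local Notation S := (@TrCP R n r).
Local Notation Nm := (@Nm R n r).

Definition quarter (e : R) p : TM := (p.1, reim (quarterN e (cplx p.1) (cplx p.2))).

Section Turn.
Context (e : R).

Lemma Pm_quarter p : Pm (quarter e p) = Pm p.
Proof. by []. Qed.

Lemma Nm_quarter p : Nm (quarter e p) = quarterN e (Pm p) (Nm p).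
Proof.
apply: etrans (congr1 (fun M => _ *: M) (cplxK _)) _.
apply: esym; apply: etrans (congr1 (fun M => _ *: M) (commZr _ _ _)) _.
by rewrite !scalerA mulrC.
Qed.

Lemma quarterN_cj (a P N : CM) : a \is unitarymx -> quarterN e (cj a P) (cj a N) = cj a (quarterN e P N).
Proof. by move=> ua; rewrite /quarterN -cj_comm // cjZ. Qed.

Lemma quarter_act a p : a \is unitarymx -> quarter e (act a p) = act a (quarter e p).
Proof.
move=> ua; apply: (PNm_inj hr).
  exact: (etrans (Pm_quarter (act a p)) (etrans (Pm_act a p)
    (etrans (congr1 (cj a) (esym (Pm_quarter p))) (esym (Pm_act a (quarter e p)))))).
have h1 := etrans (Nm_quarter (act a p)) (f_equal2 (quarterN e) (Pm_act a p) (Nm_act r a p)).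
have h2 := etrans (Nm_act r a (quarter e p)) (congr1 (cj a) (Nm_quarter p)).
exact: (etrans h1 (etrans (quarterN_cj (Pm p) (Nm p) ua) (esym h2))).
Qed.

Lemma quarter_smooth : smooth_on S (quarter e).
Proof.
apply: (smooth_on_global (f' := quarter e)) => //.
have s1 : smooth (fun p : TM => p.1) by apply: smooth_lin => //; exact: TM_cont.
have s2 : smooth (fun p : TM => p.2) by apply: smooth_lin => //; exact: TM_cont.
apply: smooth_pair => //; apply: smooth_reim; apply: smMZc.
by apply: smM_comm; exact: smM_cplx.
Qed.

Hypothesis e2 : e ^+ 2 = 1.

Lemma quarter_TrCP p : S p -> S (quarter e p).
Proof.
case/(TrCP_unitary hr) => a ua ->; rewrite quarter_act //; apply: (TrCP_act hr ua).
have fl := @flag_E R n hn.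
have [b ub [bP bN]] := quarter_flag_conj e2 fl.
have h1 := etrans (Pm_act b (oH r)) (congr1 (cj b) (Pm_oH r)).
have h2 := etrans (Nm_act r b (oH r)) (congr1 (cj b) (Nm_oH hr hn)).
have h3 := etrans (Pm_quarter (oH r)) (Pm_oH r).
have h4 := etrans (Nm_quarter (oH r)) (f_equal2 (quarterN e) (Pm_oH r) (Nm_oH hr hn)).
apply/(TrCP_unitary hr); exists b => //; apply: (PNm_inj hr).
  exact: (etrans h3 (etrans (esym bP) (esym h1))).
exact: (etrans h4 (etrans (esym bN) (esym h2))).
Qed.

End Turn.

Lemma quarterK (e : R) p : e ^+ 2 = 1 -> S p -> quarter (- e) (quarter e p) = p.
Proof.
move=> e2 Sp; have fl := flag_TrCP hr hn Sp; apply: (PNm_inj hr); first by [].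
apply: etrans (Nm_quarter _ _) _.
apply: etrans (f_equal2 (quarterN (- e)) (Pm_quarter e p) (Nm_quarter e p)) _.
rewrite /quarterN commZr (comm_comm_flag fl) scalerA.
have -> : (- e)%:C * 'i%C * (e%:C * 'i%C) = 1 :> C.
  by apply/eqP; rewrite eq_complex /=; apply/andP; split; apply/eqP; [apply: (etrans _ e2)|]; ring.
exact: scale1r.
Qed.

Lemma quarter_diffeo (e : R) : e ^+ 2 = 1 -> diffeo S (quarter e).
Proof.
move=> e2; have e2' : (- e) ^+ 2 = 1 by rewrite sqrrN.
exists (quarter (- e)); split; [exact: quarter_smooth|exact: quarter_smooth| |].
  by move=> p Sp; split; exact: quarter_TrCP.
move=> p Sp; split; first exact: quarterK.
by have := quarterK e2' Sp; rewrite opprK.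
Qed.

Lemma tder_quarter (e : R) p A : e ^+ 2 = 1 -> S p -> skewherm A ->
  tder S (quarter e) p (inf_act A p) = inf_act A (quarter e p).
Proof.
move=> e2 Sp sA; apply: (tder_equivariant hr (quarter_smooth e)) => // a q ua _.
exact: quarter_act.
Qed.

(** The turn maps fundamental fields to themselves, so it suffices to compare the
    data at [p] and at its image; there [vpt_quarter], [Gam_quarter] and
    [phi_op_quarter] say that [X] and [mu] are exchanged. *)
Lemma quarter_isomorphic (e x y z a0 ae be ah bh : R) xi1 g1 xi2 g2 : e ^+ 2 = 1 ->
  invariant_pair r xi1 g1 (vpt (- e * y) (e * x) z P0 N0) ae a0 be ah bh ->
  invariant_pair r xi2 g2 (vpt x y z P0 N0) a0 ae be ah bh ->
  contact_metric_structure S xi1 g1 -> contact_metric_structure S xi2 g2 ->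
  isomorphic_structures S xi1 g1 xi2 g2.
Proof.
move=> e2 /(invariant_pairP hn hr) [gE1 xE1 [p1 p2 p3 p4 p5]].
move=> /(invariant_pairP hn hr) [gE2 xE2 _].
move=> /(contact_iff hn hr p1 p2 p3 p4 p5 gE1 xE1) c1 /(contact_iff hn hr p2 p1 p3 p4 p5 gE2 xE2) c2.
have K1 := can_contact hn hr p1 p2 p3 p4 p5 gE1 xE1 c1.
have K2 := can_contact hn hr p2 p1 p3 p4 p5 gE2 xE2 c2.
exists (can_phi r ae a0 be ah bh (- e * y) (e * x) z), (can_phi r a0 ae be ah bh x y z), (quarter e).
split=> //; split.
- exact: quarter_diffeo.
- move=> p u v Sp /(tangentP hr hn Sp) [A sA ->] /(tangentP hr hn Sp) [B sB ->].
  have Sq := quarter_TrCP e2 Sp; have fl := flag_TrCP hr hn Sp.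
  rewrite (tder_quarter e2 Sp sA) (tder_quarter e2 Sp sB).
  apply: etrans (g_inf_act hn hr gE2 Sq sA sB) _.
  apply: etrans _ (esym (g_inf_act hn hr gE1 Sp sA sB)).
  apply: congr1; rewrite -(Gam_quarter e2 fl).
  exact: (congr1 (fun N => Gam a0 ae be ah bh (Pm p) N B) (Nm_quarter e p)).
- move=> p Sp; have Sq := quarter_TrCP e2 Sp; have fl := flag_TrCP hr hn Sp.
  rewrite (xE1 p Sp) (tder_quarter e2 Sp (vpt_skew fl _ _ _)) (xE2 _ Sq).
  have V := etrans (congr1 (vpt x y z (Pm p)) (Nm_quarter e p)) (vpt_quarter e2 fl x y z).
  exact: (congr1 (fun M => inf_act M (quarter e p)) (esym V)).
- move=> p u Sp /(tangentP hr hn Sp) [A sA ->].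
  have Sq := quarter_TrCP e2 Sp; have fl := flag_TrCP hr hn Sp.
  rewrite (tder_quarter e2 Sp sA).
  rewrite (can_phi_inf_act hn hr ae a0 be ah bh (- e * y) (e * x) z Sp sA).
  rewrite (can_phi_inf_act hn hr a0 ae be ah bh x y z Sq sA).
  have V := etrans (congr1 (fun N => phi_op a0 ae be ah bh x y z (Pm p) N A) (Nm_quarter e p))
     (phi_op_quarter e2 fl a0 ae be ah bh x y z A).
  rewrite (tder_quarter e2 Sp (phi_op_skew ae a0 be ah bh (- e * y) (e * x) z fl sA)).
  exact: (congr1 (fun M => inf_act M (quarter e p)) (esym V)).
Qed.

End Isomorphism.

(** * The families of structures *)

Section Families.
Context {R : realType} {n : nat} (hn : (1 <= n)%N) (r : R) (hr : 0 < r).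
Notation CM := 'M[R[i]]_n.+1.
Local Notation S := (@TrCP R n r).
Notation TM := (('M[R]_n.+1 * 'M[R]_n.+1) * ('M[R]_n.+1 * 'M[R]_n.+1))%type.
Implicit Types (xi : TM -> TM) (g : TM -> TM -> TM -> R).

Lemma orthogonal_contactI T xi g v (a0 ae be ah bh : R) : T a0 ae be v ->
  invariant_pair r xi g v a0 ae be ah bh -> contact_metric_structure S xi g ->
  orthogonal_contact T r xi g.
Proof. by move=> t D cm; exists v, a0, ae, be, ah, bh. Qed.

(** The two coefficients have a fixed product, and [q] parametrises their quotient. *)
Lemma axis_split (k a b : R) : 0 < k -> 0 < a -> 0 < b -> k ^+ 2 = 4 * a * b ->
  let q := 2 * b / k in [/\ 0 < q, a = k / (2 * q) & b = k * q / 2].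
Proof.
move=> k0 a0 b0 e q; have nk := lt0r_neq0 k0; have nb := lt0r_neq0 b0.
split; first by rewrite divr_gt0 // mulr_gt0.
  have -> : k / (2 * q) = k ^+ 2 / (4 * b) by rewrite /q; field; rewrite nk nb.
  by rewrite e; field.
by rewrite /q; field.
Qed.

Lemma half_split (k a b : R) : 0 < k -> 0 < a -> 0 < b -> k ^+ 2 = 16 * a * b ->
  let q := 4 * b / k in a = k / (4 * q) /\ b = k * q / 4.
Proof.
move=> k0 a0 b0 e q; have nk := lt0r_neq0 k0; have nb := lt0r_neq0 b0.
split.
  have -> : k / (4 * q) = k ^+ 2 / (16 * b) by rewrite /q; field; rewrite nk nb.
  by rewrite e; field.
by rewrite /q; field.
Qed.

Lemma half_eq (k a b : R) : 0 < k -> 0 < a -> a = b -> k ^+ 2 = 16 * a * b ->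
  a = k / 4 /\ b = k / 4.
Proof.
move=> k0 a0 <- e; have -> : a = k / 4; last by [].
by apply: sqr_pos_inj => //; [rewrite divr_gt0|rewrite exprMn e; field].
Qed.

Lemma family_AI_structure xi g (s : bool) (k qe qh : R) : 0 < k -> 0 < qe -> 0 < qh ->
  data_AI r xi g s k qe qh -> contact_metric_structure S xi g /\
  (killing S g xi <-> qe = 1 /\ ((1 < n)%N -> qh = 1)).
Proof.
move=> k0 q0 h0 D; have [xE _ _] := @xi_sqr R n k k0; have nk := lt0r_neq0 k0.
have [ci ki] := axis1_structure hn hr (transport D (congr1 (fun v : CM => (-1) ^+ s *: v) (esym xE))).
have nq := lt0r_neq0 q0; have nh := lt0r_neq0 h0.
split; first by apply/ci; split=> [|_]; field; rewrite ?nk ?nq ?nh.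
apply: (iff_trans ki); apply: iff_and; first exact: balance.
by apply: imp_iff; exact: balance.
Qed.

Lemma family_AI xi g : orthogonal_contact type_AI r xi g <->
  exists (s : bool) (k qe qh : R), [/\ 0 < k, 0 < qe, 0 < qh & data_AI r xi g s k qe qh].
Proof.
split=> [[v [a0 [ae [be [ah [bh [[s ->] J cm]]]]]]]|[s [k [qe [qh [k0 q0 h0 D]]]]]]; last first.
  have [cm _] := family_AI_structure k0 q0 h0 D; have [xE _ _] := @xi_sqr R n k k0.
  by apply: (orthogonal_contactI _ D cm); exists s; congr (_ *: _).
have [p1 p2 p3 p4 p5] := invariant_pair_pos J.
have [e h] := (axis1_structure hn hr J).1.1 cm; have [k k0 [ek rk]] := sqrtP p1.
rewrite ek in e h; have [q0 f1 f2] := axis_split k0 p2 p3 e.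
exists s, k, (2 * be / k), (4 * bh / k).
have h0 : 0 < 4 * bh / k by rewrite divr_gt0 // mulr_gt0.
split=> //; rewrite /data_AI -rk; apply: (invariant_pair_eq J erefl); rewrite rk //.
- by move=> n1; exact: half_split (h n1).
- by rewrite divr_gt0 // mulr_gt0.
- by rewrite divr_gt0 // mulr_gt0.
Qed.

Lemma family_AII_structure xi g (s : bool) (k qe qh : R) : 0 < k -> 0 < qe -> 0 < qh ->
  data_AII r xi g s k qe qh -> contact_metric_structure S xi g /\
  (killing S g xi <-> qe = 1 /\ ((1 < n)%N -> qh = 1)).
Proof.
move=> k0 q0 h0 D; have [_ xE _] := @xi_sqr R n k k0; have nk := lt0r_neq0 k0.
have [ci ki] := axis2_structure hn hr (transport D (congr1 (fun v : CM => (-1) ^+ s *: v) (esym xE))).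
have nq := lt0r_neq0 q0; have nh := lt0r_neq0 h0.
split; first by apply/ci; split=> [|_]; field; rewrite ?nk ?nq ?nh.
apply: (iff_trans ki); apply: iff_and; first exact: balance.
by apply: imp_iff; exact: balance.
Qed.

Lemma family_AII xi g : orthogonal_contact type_AII r xi g <->
  exists (s : bool) (k qe qh : R), [/\ 0 < k, 0 < qe, 0 < qh & data_AII r xi g s k qe qh].
Proof.
split=> [[v [a0 [ae [be [ah [bh [[s ->] J cm]]]]]]]|[s [k [qe [qh [k0 q0 h0 D]]]]]]; last first.
  have [cm _] := family_AII_structure k0 q0 h0 D; have [_ xE _] := @xi_sqr R n k k0.
  by apply: (orthogonal_contactI _ D cm); exists s; congr (_ *: _).
have [p1 p2 p3 p4 p5] := invariant_pair_pos J.
have [e h] := (axis2_structure hn hr J).1.1 cm; have [k k0 [ek rk]] := sqrtP p2.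
rewrite ek in e h; have [q0 f1 f2] := axis_split k0 p1 p3 e.
exists s, k, (2 * be / k), (4 * bh / k).
have h0 : 0 < 4 * bh / k by rewrite divr_gt0 // mulr_gt0.
split=> //; rewrite /data_AII -rk; apply: (invariant_pair_eq J erefl); rewrite rk //.
- by move=> n1; exact: half_split (h n1).
- by rewrite divr_gt0 // mulr_gt0.
- by rewrite divr_gt0 // mulr_gt0.
Qed.

Lemma family_AIII_structure xi g (s : bool) (k qe : R) : 0 < k -> 0 < qe ->
  data_AIII r xi g s k qe -> contact_metric_structure S xi g /\
  (killing S g xi <-> qe = 1).
Proof.
move=> k0 q0 D; have [_ _ xE] := @xi_sqr R n k k0; have nk := lt0r_neq0 k0.
have [ci ki] := axis3_structure hn hr (transport D (congr1 (fun v : CM => (-1) ^+ s *: v) (esym xE))).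
have nq := lt0r_neq0 q0.
split; first by apply/ci; split=> [|_]; [field; rewrite ?nk ?nq|split=> //; field].
by apply: (iff_trans ki); exact: balance.
Qed.

Lemma family_AIII xi g : orthogonal_contact type_AIII r xi g <->
  exists (s : bool) (k qe : R), [/\ 0 < k, 0 < qe & data_AIII r xi g s k qe].
Proof.
split=> [[v [a0 [ae [be [ah [bh [[s ->] J cm]]]]]]]|[s [k [qe [k0 q0 D]]]]]; last first.
  have [cm _] := family_AIII_structure k0 q0 D; have [_ _ xE] := @xi_sqr R n k k0.
  by apply: (orthogonal_contactI _ D cm); exists s; congr (_ *: _).
have [p1 p2 p3 p4 p5] := invariant_pair_pos J.
have [e h] := (axis3_structure hn hr J).1.1 cm; have [k k0 [ek rk]] := sqrtP p3.
rewrite ek in e h; have [q0 f1 f2] := axis_split k0 p1 p2 e.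
exists s, k, (2 * ae / k); split=> //; rewrite /data_AIII -rk.
apply: (invariant_pair_eq J erefl); rewrite rk ?divr_gt0 //.
by move=> n1; have [e1 e2] := h n1; exact: half_eq.
Qed.

Lemma scale2 (K : comPzRingType) (L : lmodType K) (a b c : K) (U V : L) :
  a *: (b *: U + c *: V) = b *: (a *: U) + c *: (a *: V).
Proof. by rewrite scalerDr !scalerA ![a * _]mulrC. Qed.

Lemma scale3 (K : comPzRingType) (L : lmodType K) (a b c d : K) (U V W : L) :
  a *: (b *: U + c *: V + d *: W) = b *: (a *: U) + c *: (a *: V) + d *: (a *: W).
Proof. by rewrite !scalerDr !scalerA ![a * _]mulrC. Qed.

Lemma family_BI_vec (k theta : R) : 0 < k ->
  k^-1%:C *: ((cos theta)%:C *: X + (sin theta)%:C *: mu) =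
  (cos theta)%:C *: xi1 (k ^+ 2) + (sin theta)%:C *: xi2 (k ^+ 2) :> CM.
Proof. by move=> k0; have [e1 e2 _] := @xi_sqr R n k k0; rewrite e1 e2; exact: scale2. Qed.

Lemma family_BI_structure xi g (theta k qh : R) : theta_range theta -> 0 < k -> 0 < qh ->
  data_BI r xi g theta k qh -> contact_metric_structure S xi g /\
  (killing S g xi <-> k = 2^-1 /\ ((1 < n)%N -> qh = 1)).
Proof.
move=> /theta_rangeP [n1 n2] k0 h0 D; have nk := lt0r_neq0 k0.
have [ci ki] := plane12_structure hn hr (cos2Dsin2 theta) n1 n2 (transport D (family_BI_vec theta k0)).
have nh := lt0r_neq0 h0.
have cm : contact_metric_structure S xi g by apply/ci; split=> // _; field; rewrite ?nk ?nh.
split=> //; apply: (iff_trans (ki cm)); apply: iff_and; first exact: sq_quarterP.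
by apply: imp_iff; exact: balance.
Qed.

Lemma family_BI xi g : orthogonal_contact type_BI r xi g <->
  exists theta k qh : R, [/\ theta_range theta, 0 < k, 0 < qh & data_BI r xi g theta k qh].
Proof.
split=> [[v [a0 [ae [be [ah [bh [[theta tr ->] J cm]]]]]]]|[theta [k [qh [tr k0 h0 D]]]]]; last first.
  have [cm _] := family_BI_structure tr k0 h0 D.
  by apply: (orthogonal_contactI _ D cm); exists theta => //; exact: family_BI_vec.
have [p1 p2 p3 p4 p5] := invariant_pair_pos J; have [n1 n2] := theta_rangeP tr.
have [[e1 e2] h] := (plane12_structure hn hr (cos2Dsin2 theta) n1 n2 J).1.1 cm.
have [k k0 [ek rk]] := sqrtP p1; rewrite ek in e1 h.
have vE := esym (family_BI_vec theta k0); rewrite -[in X in X + _ = _]ek -e1 in vE.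
have h0 : 0 < 4 * bh / k by rewrite divr_gt0 // mulr_gt0.
exists theta, k, (4 * bh / k); split=> //; apply: (invariant_pair_eq J vE) => //.
- by move=> m; exact: half_split (h m).
- by rewrite divr_gt0 // mulr_gt0.
- by rewrite divr_gt0 // mulr_gt0.
Qed.

Lemma family_BII_vec (k theta : R) : 0 < k ->
  k^-1%:C *: ((cos theta)%:C *: X + (sin theta)%:C *: nu) =
  (cos theta)%:C *: xi1 (k ^+ 2) + (sin theta)%:C *: xi3 (k ^+ 2) :> CM.
Proof. by move=> k0; have [e1 _ e2] := @xi_sqr R n k k0; rewrite e1 e2; exact: scale2. Qed.

Lemma family_BII_structure xi g (theta k : R) : theta_range theta -> 0 < k ->
  data_BII r xi g theta k -> contact_metric_structure S xi g /\
  (killing S g xi <-> k = 2^-1).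
Proof.
move=> /theta_rangeP [n1 n2] k0 D; have nk := lt0r_neq0 k0.
have [ci ki] := plane13_structure hn hr (cos2Dsin2 theta) n1 n2 (transport D (family_BII_vec theta k0)).
have cm : contact_metric_structure S xi g by apply/ci; split=> // _; split=> //; field.
by split=> //; apply: (iff_trans (ki cm)); exact: sq_quarterP.
Qed.

Lemma family_BII xi g : orthogonal_contact type_BII r xi g <->
  exists theta k : R, [/\ theta_range theta, 0 < k & data_BII r xi g theta k].
Proof.
split=> [[v [a0 [ae [be [ah [bh [[theta tr ->] J cm]]]]]]]|[theta [k [tr k0 D]]]]; last first.
  have [cm _] := family_BII_structure tr k0 D.
  by apply: (orthogonal_contactI _ D cm); exists theta => //; exact: family_BII_vec.
have [p1 p2 p3 p4 p5] := invariant_pair_pos J; have [n1 n2] := theta_rangeP tr.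
have [[e1 e2] h] := (plane13_structure hn hr (cos2Dsin2 theta) n1 n2 J).1.1 cm.
have [k k0 [ek rk]] := sqrtP p1; rewrite ek in e1 h.
have vE := esym (family_BII_vec theta k0); rewrite -[in X in X + _ = _]ek -e1 in vE.
exists theta, k; split=> //; apply: (invariant_pair_eq J vE); rewrite ?divr_gt0 //.
by move=> m; have [e3 e4] := h m; exact: half_eq.
Qed.

Lemma family_BIII_vec (k theta : R) : 0 < k ->
  k^-1%:C *: ((cos theta)%:C *: mu + (sin theta)%:C *: nu) =
  (cos theta)%:C *: xi2 (k ^+ 2) + (sin theta)%:C *: xi3 (k ^+ 2) :> CM.
Proof. by move=> k0; have [_ e1 e2] := @xi_sqr R n k k0; rewrite e1 e2; exact: scale2. Qed.

Lemma family_BIII_structure xi g (theta k : R) : theta_range theta -> 0 < k ->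
  data_BIII r xi g theta k -> contact_metric_structure S xi g /\
  (killing S g xi <-> k = 2^-1).
Proof.
move=> /theta_rangeP [n1 n2] k0 D; have nk := lt0r_neq0 k0.
have [ci ki] := plane23_structure hn hr (cos2Dsin2 theta) n1 n2 (transport D (family_BIII_vec theta k0)).
have cm : contact_metric_structure S xi g by apply/ci; split=> // _; split=> //; field.
by split=> //; apply: (iff_trans (ki cm)); exact: sq_quarterP.
Qed.

Lemma family_BIII xi g : orthogonal_contact type_BIII r xi g <->
  exists theta k : R, [/\ theta_range theta, 0 < k & data_BIII r xi g theta k].
Proof.
split=> [[v [a0 [ae [be [ah [bh [[theta tr ->] J cm]]]]]]]|[theta [k [tr k0 D]]]]; last first.
  have [cm _] := family_BIII_structure tr k0 D.
  by apply: (orthogonal_contactI _ D cm); exists theta => //; exact: family_BIII_vec.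
have [p1 p2 p3 p4 p5] := invariant_pair_pos J; have [n1 n2] := theta_rangeP tr.
have [[e1 e2] h] := (plane23_structure hn hr (cos2Dsin2 theta) n1 n2 J).1.1 cm.
have [k k0 [ek rk]] := sqrtP p2; rewrite ek in e1 h.
have vE := esym (family_BIII_vec theta k0); rewrite -[in X in X + _ = _]ek -e1 in vE.
exists theta, k; split=> //; apply: (invariant_pair_eq J vE); rewrite ?divr_gt0 //.
by move=> m; have [e3 e4] := h m; exact: half_eq.
Qed.

Lemma family_C_vec (theta phi : R) :
  2%:C *: ((cos theta * cos phi)%:C *: X + (sin theta * cos phi)%:C *: mu + (sin phi)%:C *: nu) =
  frame 4^-1 4^-1 4^-1 (cos theta * cos phi) (sin theta * cos phi) (sin phi) :> CM.
Proof.
have s4 : 4^-1 = 2^-1 ^+ 2 :> R by field.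
have h2 : 0 < 2^-1 :> R by rewrite invr_gt0.
have [e1 e2 e3] := @xi_sqr R n _ h2; rewrite /frame s4 e1 e2 e3 invrK; exact: scale3.
Qed.

Lemma sphere_coords (t p : R) :
  (cos t * cos p) ^+ 2 + (sin t * cos p) ^+ 2 + sin p ^+ 2 = 1.
Proof. by rewrite !exprMn -mulrDl cos2Dsin2 mul1r cos2Dsin2. Qed.

Lemma sphere_coords_neq0 (theta phi : R) : theta_range theta -> phi_range phi ->
  [/\ cos theta * cos phi != 0, sin theta * cos phi != 0 & sin phi != 0].
Proof. by move=> /theta_rangeP [n1 n2] /phi_rangeP [m1 m2]; rewrite !mulf_neq0. Qed.

Lemma family_C_structure xi g (theta phi : R) : theta_range theta -> phi_range phi ->
  data_C r xi g theta phi -> contact_metric_structure S xi g /\ killing S g xi.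
Proof.
move=> tr pr D; have [n1 n2 n3] := sphere_coords_neq0 tr pr.
have [ci ki] := sphere_structure hn hr (sphere_coords theta phi) n1 n2 n3 (transport D (family_C_vec theta phi)).
have cm : contact_metric_structure S xi g by apply/ci; split=> // _; split=> //; field.
by split; [|exact: ki].
Qed.

Lemma family_C xi g : orthogonal_contact type_C r xi g <->
  exists theta phi : R, [/\ theta_range theta, phi_range phi & data_C r xi g theta phi].
Proof.
split=> [[v [a0 [ae [be [ah [bh [[theta [phi [tr pr ->]]] J cm]]]]]]]|[theta [phi [tr pr D]]]]; last first.
  have [cm _] := family_C_structure tr pr D.
  apply: (orthogonal_contactI _ D cm).
  by exists theta, phi; split=> //; exact: family_C_vec.
have [p1 p2 p3 p4 p5] := invariant_pair_pos J; have [n1 n2 n3] := sphere_coords_neq0 tr pr.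
have [[e1 e2 e3] h] := (sphere_structure hn hr (sphere_coords theta phi) n1 n2 n3 J).1.1 cm.
have fE : frame a0 ae be (cos theta * cos phi) (sin theta * cos phi) (sin phi) =
    frame 4^-1 4^-1 4^-1 (cos theta * cos phi) (sin theta * cos phi) (sin phi) :> CM.
  by rewrite e1 e2 e3.
have vE := etrans fE (esym (family_C_vec theta phi)).
have v8 : 0 < 8^-1 :> R by rewrite invr_gt0.
exists theta, phi; split; [exact: tr|exact: pr|].
apply: (invariant_pair_eq J vE e1 e2 e3 _ v8 v8).
move=> m; have [e4 e5] := h m; have -> : 8^-1 = 2^-1 / 4 :> R by field.
have v2 : 0 < 2^-1 :> R by rewrite invr_gt0.
by apply: (half_eq v2 p4 e4); rewrite -e5; field.
Qed.

(** The sign of the turn is chosen according to those of the two Reeb vectors. *)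
Lemma AI_AII_isomorphic (k qe qh : R) (s1 s2 : bool) xi1 xi2 g1 g2 :
  0 < k -> 0 < qe -> 0 < qh ->
  data_AI r xi1 g1 s1 k qe qh -> data_AII r xi2 g2 s2 k qe qh ->
  isomorphic_structures S xi1 g1 xi2 g2.
Proof.
move=> k0 q0 h0 D1 D2.
have [c1 _] := family_AI_structure k0 q0 h0 D1.
have [c2 _] := family_AII_structure k0 q0 h0 D2.
(* Since [mu] becomes [- e X], the turn carries one Reeb vector to the other. *)
pose e : R := - ((-1) ^+ s1 * (-1) ^+ s2).
have u1 : ((-1) ^+ s1) ^+ 2 = 1 :> R by exact: sign_sqr.
have u2 : ((-1) ^+ s2) ^+ 2 = 1 :> R by exact: sign_sqr.
have e2 : e ^+ 2 = 1 by rewrite sqrrN exprMn u1 u2 mulr1.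
have [x1 x2 _] := @xi_sqr R n k k0.
have [f1 _ _] := @axis_frame R n s1 (k ^+ 2) (k / (2 * qe)) (k * qe / 2).
have [_ f2 _] := @axis_frame R n s2 (k / (2 * qe)) (k ^+ 2) (k * qe / 2).
have I1 := transport D1 (etrans (congr1 (fun v : CM => (-1) ^+ s1 *: v) (esym x1)) (etrans f1 (frameE hn _ _ _ _ _ _))).
have I2 := transport D2 (etrans (congr1 (fun v : CM => (-1) ^+ s2 *: v) (esym x2)) (etrans f2 (frameE hn _ _ _ _ _ _))).
apply: (quarter_isomorphic hn hr e2 _ I2 c1 c2); apply: (transport I1).
rewrite !mulr0; congr (vpt _ _ _ _ _); rewrite /e opprK.
move: (Num.sqrt _)^-1 ((-1) ^+ s1) ((-1) ^+ s2) u2 => a u v h.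
by apply: (etrans (y := a * u * v ^+ 2)); [rewrite h mulr1|ring].
Qed.

End Families.

Theorem theorem5p5 (R : realType) (n : nat) (hn : (1 <= n)%N)
    (r : R) (hr : 0 < r) :
  let V := (('M[R]_n.+1 * 'M[R]_n.+1) * ('M[R]_n.+1 * 'M[R]_n.+1))%type in
  let S : set V := TrCP r in
  (* Type AI *)
  ((forall (xi : V -> V) (g : V -> V -> V -> R),
      orthogonal_contact type_AI r xi g <->
      exists (s : bool) (k qe qh : R), [/\ 0 < k, 0 < qe, 0 < qh & data_AI r xi g s k qe qh])
   /\ (forall (s : bool) (k qe qh : R), 0 < k -> 0 < qe -> 0 < qh ->
      (exists (xi : V -> V) (g : V -> V -> V -> R),
         data_AI r xi g s k qe qh) /\
      (forall (xi : V -> V) (g : V -> V -> V -> R),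
         data_AI r xi g s k qe qh ->
         (K_contact S xi g <-> qe = 1 /\ ((1 < n)%N -> qh = 1)))))
  /\
  (* Type AII *)
  ((forall (xi : V -> V) (g : V -> V -> V -> R),
      orthogonal_contact type_AII r xi g <->
      exists (s : bool) (k qe qh : R), [/\ 0 < k, 0 < qe, 0 < qh & data_AII r xi g s k qe qh])
   /\ (forall (s : bool) (k qe qh : R), 0 < k -> 0 < qe -> 0 < qh ->
      (exists (xi : V -> V) (g : V -> V -> V -> R),
         data_AII r xi g s k qe qh) /\
      (forall (xi : V -> V) (g : V -> V -> V -> R),
         data_AII r xi g s k qe qh ->
         (K_contact S xi g <-> qe = 1 /\ ((1 < n)%N -> qh = 1)))))
  /\
  (* Type AIII *)
  ((forall (xi : V -> V) (g : V -> V -> V -> R),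
      orthogonal_contact type_AIII r xi g <->
      exists (s : bool) (k qe : R), [/\ 0 < k, 0 < qe & data_AIII r xi g s k qe])
   /\ (forall (s : bool) (k qe : R), 0 < k -> 0 < qe ->
      (exists (xi : V -> V) (g : V -> V -> V -> R),
         data_AIII r xi g s k qe) /\
      (forall (xi : V -> V) (g : V -> V -> V -> R),
         data_AIII r xi g s k qe ->
         (K_contact S xi g <-> qe = 1))))
  /\
  (* Type BI *)
  ((forall (xi : V -> V) (g : V -> V -> V -> R),
      orthogonal_contact type_BI r xi g <->
      exists theta k qh : R,
        [/\ theta_range theta, 0 < k, 0 < qh & data_BI r xi g theta k qh])
   /\ (forall theta k qh : R, theta_range theta -> 0 < k -> 0 < qh ->
      (exists (xi : V -> V) (g : V -> V -> V -> R),
         data_BI r xi g theta k qh) /\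
      (forall (xi : V -> V) (g : V -> V -> V -> R),
         data_BI r xi g theta k qh ->
         (K_contact S xi g <-> k = 2^-1 /\ ((1 < n)%N -> qh = 1)))))
  /\
  (* Type BII *)
  ((forall (xi : V -> V) (g : V -> V -> V -> R),
      orthogonal_contact type_BII r xi g <->
      exists theta k : R,
        [/\ theta_range theta, 0 < k & data_BII r xi g theta k])
   /\ (forall theta k : R, theta_range theta -> 0 < k ->
      (exists (xi : V -> V) (g : V -> V -> V -> R),
         data_BII r xi g theta k) /\
      (forall (xi : V -> V) (g : V -> V -> V -> R),
         data_BII r xi g theta k ->
         (K_contact S xi g <-> k = 2^-1))))
  /\
  (* Type BIII *)
  ((forall (xi : V -> V) (g : V -> V -> V -> R),
      orthogonal_contact type_BIII r xi g <->
      exists theta k : R,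
        [/\ theta_range theta, 0 < k & data_BIII r xi g theta k])
   /\ (forall theta k : R, theta_range theta -> 0 < k ->
      (exists (xi : V -> V) (g : V -> V -> V -> R),
         data_BIII r xi g theta k) /\
      (forall (xi : V -> V) (g : V -> V -> V -> R),
         data_BIII r xi g theta k ->
         (K_contact S xi g <-> k = 2^-1))))
  /\
  (* Type C *)
  ((forall (xi : V -> V) (g : V -> V -> V -> R),
      orthogonal_contact type_C r xi g <->
      exists theta phi : R,
        [/\ theta_range theta, phi_range phi & data_C r xi g theta phi])
   /\ (forall theta phi : R, theta_range theta -> phi_range phi ->
      (exists (xi : V -> V) (g : V -> V -> V -> R),
         data_C r xi g theta phi) /\
      (forall (xi : V -> V) (g : V -> V -> V -> R),
         data_C r xi g theta phi -> K_contact S xi g)))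
  /\
  (* Types AI and AII with the same triple are isomorphic *)
  (forall k qe qh : R, 0 < k -> 0 < qe -> 0 < qh ->
    forall (s1 s2 : bool) (xi1 xi2 : V -> V) (g1 g2 : V -> V -> V -> R),
      data_AI r xi1 g1 s1 k qe qh -> data_AII r xi2 g2 s2 k qe qh ->
      isomorphic_structures S xi1 g1 xi2 g2).
Proof.
have kc (V : normedModType R) (S : set V) xi g (P : Prop) :
    contact_metric_structure S xi g /\ (killing S g xi <-> P) -> (K_contact S xi g <-> P).
  by move=> [c k]; split=> [[_ /k]|/k].
have pos (k q c : R) : 0 < k -> 0 < q -> 0 < c ->
    [/\ 0 < k ^+ 2, 0 < k / c, 0 < k / (c * q) & 0 < k * q / c].
  by move=> k0 q0 c0; rewrite exprn_gt0 ?divr_gt0 ?mulr_gt0.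
have [c2 c4] : 0 < 2 :> R /\ 0 < 4 :> R by split.
have [v4 v8] : 0 < 4^-1 :> R /\ 0 < 8^-1 :> R by rewrite !invr_gt0.
move=> V S; split; [|split; [|split; [|split; [|split; [|split; [|split]]]]]].
- split=> [xi g|s k qe qh k0 q0 h0]; first exact: family_AI.
  split; last by move=> xi g D; apply: kc; exact: (family_AI_structure hn hr k0 q0 h0 D).
  have [xE _ _] := @xi_sqr R n k k0; have [f _ _] := @axis_frame R n s (k ^+ 2) (k / (2 * qe)) (k * qe / 2).
  have [b0 _ b1 b2] := pos _ _ _ k0 q0 c2; have [_ _ b3 b4] := pos _ _ _ k0 h0 c4.
  exact: (invariant_exists hn hr (etrans (congr1 (fun v : 'M[R[i]]_n.+1 => (-1) ^+ s *: v) (esym xE)) f)).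
- split=> [xi g|s k qe qh k0 q0 h0]; first exact: family_AII.
  split; last by move=> xi g D; apply: kc; exact: (family_AII_structure hn hr k0 q0 h0 D).
  have [_ xE _] := @xi_sqr R n k k0; have [_ f _] := @axis_frame R n s (k / (2 * qe)) (k ^+ 2) (k * qe / 2).
  have [b0 _ b1 b2] := pos _ _ _ k0 q0 c2; have [_ _ b3 b4] := pos _ _ _ k0 h0 c4.
  exact: (invariant_exists hn hr (etrans (congr1 (fun v : 'M[R[i]]_n.+1 => (-1) ^+ s *: v) (esym xE)) f)).
- split=> [xi g|s k qe k0 q0]; first exact: family_AIII.
  split; last by move=> xi g D; apply: kc; exact: (family_AIII_structure hn hr k0 q0 D).
  have [_ _ xE] := @xi_sqr R n k k0; have [_ _ f] := @axis_frame R n s (k / (2 * qe)) (k * qe / 2) (k ^+ 2).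
  have [b0 _ b1 b2] := pos _ _ _ k0 q0 c2; have [_ b3 _ _] := pos _ _ _ k0 q0 c4.
  exact: (invariant_exists hn hr (etrans (congr1 (fun v : 'M[R[i]]_n.+1 => (-1) ^+ s *: v) (esym xE)) f)).
- split=> [xi g|theta k qh tr k0 h0]; first exact: family_BI.
  split; last by move=> xi g D; apply: kc; exact: (family_BI_structure hn hr tr k0 h0 D).
  have [f _ _] := @plane_frame R n (k ^+ 2) (k ^+ 2) 4^-1 (cos theta) (sin theta).
  have [b0 _ b1 b2] := pos _ _ _ k0 h0 c4.
  exact: (invariant_exists hn hr (etrans (family_BI_vec theta k0) f)).
- split=> [xi g|theta k tr k0]; first exact: family_BII.
  split; last by move=> xi g D; apply: kc; exact: (family_BII_structure hn hr tr k0 D).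
  have [_ f _] := @plane_frame R n (k ^+ 2) 4^-1 (k ^+ 2) (cos theta) (sin theta).
  have [b0 b1 _ _] := pos _ _ _ k0 k0 c4.
  exact: (invariant_exists hn hr (etrans (family_BII_vec theta k0) f)).
- split=> [xi g|theta k tr k0]; first exact: family_BIII.
  split; last by move=> xi g D; apply: kc; exact: (family_BIII_structure hn hr tr k0 D).
  have [_ _ f] := @plane_frame R n 4^-1 (k ^+ 2) (k ^+ 2) (cos theta) (sin theta).
  have [b0 b1 _ _] := pos _ _ _ k0 k0 c4.
  exact: (invariant_exists hn hr (etrans (family_BIII_vec theta k0) f)).
- split=> [xi g|theta phi tr pr]; first exact: family_C.
  split; last by move=> xi g /(family_C_structure hn hr tr pr).
  exact: (invariant_exists hn hr (family_C_vec theta phi)).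
by move=> k qe qh k0 q0 h0 s1 s2 xi1 xi2 g1 g2; exact: AI_AII_isomorphic.
Qed.
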